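(* Let $H$ be a quasi-Hopf algebra over a field $k$, $\mathbb{A}$ an $H$-bicomodule algebra and $C$ an $H$-bimodule coalgebra. Then the category of left-right Yetter-Drinfeld modules ${}_{\mathbb{A}}\mathcal{YD}(H)^C$ is isomorphic to the category of left comodules over the $\mathbb{A}$-coring $\mathfrak{C}'=C\otimes\mathbb{A}$ with the following structure. The $\mathbb{A}$-bimodule structure is given by $$u\cdot(c\otimes u')\cdot u''=u_{[0]_{\langle1\rangle}}\cdot c\cdot S^{-1}(u_{[-1]})\otimes u_{[0]_{\langle0\rangle}}u'u'',$$ and the comultiplication and counit are defined by $$\Delta_{\mathfrak{C}'}(c\otimes u)=\big(\theta^3\tilde x^3_\rho(\tilde X^3_\lambda)_{\langle1\rangle_2}\cdot c_{\underline2}\cdot S^{-1}(\tilde X^1_\lambda g^1)\otimes1_{\mathbb{A}}\big)\otimes_{\mathbb{A}}\big(\theta^2_{\langle1\rangle}\tilde x^2_\rho(\tilde X^3_\lambda)_{\langle1\rangle_1}\cdot c_{\underline1}\cdot S^{-1}(\theta^1\tilde X^2_\lambda g^2)\otimes\theta^2_{\langle0\rangle}\tilde x^1_\rho(\tilde X^3_\lambda)_{\langle0\rangle}u\big),$$ $$\varepsilon_{\mathfrak{C}'}(c\otimes u)=\underline\varepsilon(c)u,$$ for all $u,u',u''\in\mathbb{A}$ and $c\in C$.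
   Context: $k$ is a field, $\otimes=\otimes_k$; algebras are associative and unital; summation is implicit. Quasi-bialgebra $(H,\Delta,\varepsilon,\Phi)$: an algebra $H$, algebra maps $\Delta:H\to H\otimes H$, $\varepsilon:H\to k$, an invertible $\Phi\in H^{\otimes3}$ with $(id\otimes\Delta)\Delta(h)=\Phi(\Delta\otimes id)\Delta(h)\Phi^{-1}$, $(id\otimes\varepsilon)\Delta(h)=h=(\varepsilon\otimes id)\Delta(h)$, $(1\otimes\Phi)(id\otimes\Delta\otimes id)(\Phi)(\Phi\otimes1)=(id\otimes id\otimes\Delta)(\Phi)(\Delta\otimes id\otimes id)(\Phi)$, $(id\otimes\varepsilon\otimes id)(\Phi)=1\otimes1$. Write $\Delta(h)=h_1\otimes h_2$, $\Phi=X^1\otimes X^2\otimes X^3$, $\Phi^{-1}=x^1\otimes x^2\otimes x^3$. A quasi-Hopf algebra has in addition an algebra anti-automorphism $S$ and $\alpha,\beta\in H$ with $S(h_1)\alpha h_2=\varepsilon(h)\alpha$, $h_1\beta S(h_2)=\varepsilon(h)\beta$, $X^1\beta S(X^2)\alpha X^3=1$, $S(x^1)\alpha x^2\beta S(x^3)=1$; convention: $\varepsilon(\alpha)=\varepsilon(\beta)=1$, $\varepsilon\circ S=\varepsilon$. Drinfeld twist: $f=(S\otimes S)(\Delta^{\rm cop}(x^1))\,\gamma\,\Delta(x^2\beta S(x^3))\in H\otimes H$, where $\gamma=S(A^2)\alpha A^3\otimes S(A^1)\alpha A^4$, $A^1\otimes A^2\otimes A^3\otimes A^4=(\Phi\otimes1)(\Delta\otimes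 id\otimes id)(\Phi^{-1})$, $\Delta^{\rm cop}(h)=h_2\otimes h_1$. It is invertible; its inverse is written $f^{-1}=g^1\otimes g^2$, and $f\Delta(S(h))f^{-1}=(S\otimes S)(\Delta^{\rm cop}(h))$. Left $H$-comodule algebra $(\mathfrak{B},\lambda,\Phi_\lambda)$: algebra $\mathfrak{B}$, algebra map $\lambda:\mathfrak{B}\to H\otimes\mathfrak{B}$, invertible $\Phi_\lambda\in H\otimes H\otimes\mathfrak{B}$ with $(id\otimes\lambda)(\lambda(b))\Phi_\lambda=\Phi_\lambda(\Delta\otimes id)(\lambda(b))$, $(1_H\otimes\Phi_\lambda)(id\otimes\Delta\otimes id)(\Phi_\lambda)(\Phi\otimes1)=(id\otimes id\otimes\lambda)(\Phi_\lambda)(\Delta\otimes id\otimes id)(\Phi_\lambda)$, $(\varepsilon\otimes id)\lambda=id$, $(id\otimes\varepsilon\otimes id)(\Phi_\lambda)=(\varepsilon\otimes id\otimes id)(\Phi_\lambda)=1\otimes1$. Right $H$-comodule algebra $(\mathfrak{A},\rho,\Phi_\rho)$: algebra $\mathfrak{A}$, algebra map $\rho:\mathfrak{A}\to\mathfrak{A}\otimes H$, invertible $\Phi_\rho\in\mathfrak{A}\otimes H\otimes H$ with $\Phi_\rho(\rho\otimes id)(\rho(a))=(id\otimes\Delta)(\rho(a))\Phi_\rho$, $(1\otimes\Phi)(id\otimes\Delta\otimes id)(\Phi_\rho)(\Phi_\rho\otimes1_H)=(id\otimes id\otimes\Delta)(\Phi_\rho)(\rho\otimes id\otimes id)(\Phi_\rho)$,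 $(id\otimes\varepsilon)\rho=id$, $(id\otimes\varepsilon\otimes id)(\Phi_\rho)=(id\otimes id\otimes\varepsilon)(\Phi_\rho)=1\otimes1$. Notation: $\lambda(u)=u_{[-1]}\otimes u_{[0]}$, $\rho(u)=u_{\langle0\rangle}\otimes u_{\langle1\rangle}$, $\Phi_\lambda=\tilde X^1_\lambda\otimes\tilde X^2_\lambda\otimes\tilde X^3_\lambda$, $\Phi_\lambda^{-1}=\tilde x^1_\lambda\otimes\tilde x^2_\lambda\otimes\tilde x^3_\lambda$, similarly for $\Phi_\rho^{\pm1}$. $H$-bicomodule algebra $(\mathbb{A},\lambda,\rho,\Phi_\lambda,\Phi_\rho,\Phi_{\lambda,\rho})$: $(\mathbb{A},\lambda,\Phi_\lambda)$ is a left and $(\mathbb{A},\rho,\Phi_\rho)$ a right $H$-comodule algebra, and $\Phi_{\lambda,\rho}=\Theta^1\otimes\Theta^2\otimes\Theta^3\in H\otimes\mathbb{A}\otimes H$ is invertible, with inverse $\theta^1\otimes\theta^2\otimes\theta^3$, such that $\Phi_{\lambda,\rho}(\lambda\otimes id)(\rho(u))=(id\otimes\rho)(\lambda(u))\Phi_{\lambda,\rho}$, $(1_H\otimes\Phi_{\lambda,\rho})(id\otimes\lambda\otimes id)(\Phi_{\lambda,\rho})(\Phi_\lambda\otimes1_H)=(id\otimes id\otimes\rho)(\Phi_\lambda)(\Delta\otimes id\otimes id)(\Phi_{\lambda,\rho})$, $(1_H\otimes\Phi_\rho)(id\otimes\rho\otimes id)(\Phi_{\lambda,\rho})(\Phi_{\lambda,\rho}\otimes1_H)=(id\otimes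 id\otimes\Delta)(\Phi_{\lambda,\rho})(\lambda\otimes id\otimes id)(\Phi_\rho)$. $H$-bimodule coalgebra $C$: an $(H,H)$-bimodule with $\underline\Delta:C\to C\otimes C$, $\underline\Delta(c)=c_{\underline1}\otimes c_{\underline2}$, and $\underline\varepsilon:C\to k$ such that $\Phi\cdot(\underline\Delta\otimes id)(\underline\Delta(c))\cdot\Phi^{-1}=(id\otimes\underline\Delta)(\underline\Delta(c))$, $\underline\Delta(h\cdot c)=h_1\cdot c_{\underline1}\otimes h_2\cdot c_{\underline2}$, $\underline\Delta(c\cdot h)=c_{\underline1}\cdot h_1\otimes c_{\underline2}\cdot h_2$, $(\underline\varepsilon\otimes id)\underline\Delta=(id\otimes\underline\varepsilon)\underline\Delta=id$, $\underline\varepsilon(h\cdot c)=\varepsilon(h)\underline\varepsilon(c)$, $\underline\varepsilon(c\cdot h)=\underline\varepsilon(c)\varepsilon(h)$. Left-right $(H,\mathbb{A},C)$-Yetter-Drinfeld module: a left $\mathbb{A}$-module $M$ with a linear map $\rho_M:M\to M\otimes C$, $\rho_M(m)=m_{(0)}\otimes m_{(1)}$, such that $\underline\varepsilon(m_{(1)})m_{(0)}=m$, $(\theta^2\cdot m_{(0)})_{(0)}\otimes(\theta^2\cdot m_{(0)})_{(1)}\cdot\theta^1\otimes\theta^3\cdot m_{(1)}=\tilde x^1_\rho\cdot(\tilde x^3_\lambda\cdot m)_{(0)}\otimes\tilde x^2_\rho\cdot(\tilde x^3_\lambda\cdot m)_{(1)_{\underline1}}\cdot\tilde x^1_\lambda\otimes\tilde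 x^3_\rho\cdot(\tilde x^3_\lambda\cdot m)_{(1)_{\underline2}}\cdot\tilde x^2_\lambda$, and $u_{\langle0\rangle}\cdot m_{(0)}\otimes u_{\langle1\rangle}\cdot m_{(1)}=(u_{[0]}\cdot m)_{(0)}\otimes(u_{[0]}\cdot m)_{(1)}\cdot u_{[-1]}$ for all $u\in\mathbb{A}$, $m\in M$. Morphisms preserve the $\mathbb{A}$-action and the $C$-coaction. An $R$-coring is a coalgebra $(\mathcal{C},\Delta_{\mathcal{C}},\varepsilon_{\mathcal{C}})$ in the monoidal category of $R$-bimodules; a left $\mathcal{C}$-comodule is a left $R$-module $M$ with a left $R$-linear, coassociative and counital map $M\to\mathcal{C}\otimes_RM$; morphisms are left $R$-linear maps compatible with the coactions. *)

(* Defs.v *)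
From HB Require Import structures.
From mathcomp Require Import all_boot all_order all_algebra.
From mathcomp Require Import generic_quotient.
From mathcomp.classical Require Import boolp.

Set Implicit Arguments.
Unset Strict Implicit.
Unset Printing Implicit Defensive.

Import GRing.Theory.
Local Open Scope ring_scope.
Local Open Scope quotient_scope.

(* Balanced tensor product V (x)_R W of abelian groups, for a right action [ra]
   of R on V and a left action [la] of R on W: formal sums of pairs (v, w),
   identified when no balanced biadditive map can tell them apart.  Only the
   raw actions occur in the type, so no module axiom is needed to form it. *)
Section TensorProduct.
Variables (R : Type) (V W : zmodType) (ra : V -> R -> V) (la : R -> W -> W).

Record balanced (Z : zmodType) (b : V -> W -> Z) : Prop := Balanced {
  balancedDl : forall v v' w, b (v + v') w = b v w + b v' w;
  balancedDr : forall v w w', b v (w + w') = b v w + b v w';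
  balancedM : forall v r w, b (ra v r) w = b v (la r w)
}.

Definition tsum_seq (Z : zmodType) (b : V -> W -> Z) (s : seq (V * W)) : Z :=
  \sum_(p <- s) b p.1 p.2.

Definition teqv (s t : seq (V * W)) : bool :=
  `[< forall (Z : zmodType) (b : V -> W -> Z), balanced b ->
        tsum_seq b s = tsum_seq b t >].

Lemma teqv_equiv : equiv_class_of teqv.
Proof.
split=> [s|s t|t s u].
- exact/asboolP.
- by apply/asboolP/asboolP => H Z b bb; rewrite H.
- by move=> /asboolP st /asboolP tu; apply/asboolP => Z b bb; rewrite st ?tu.
Qed.

Canonical teqv_rel := EquivRelPack teqv_equiv.

Definition tprod : Type := {eq_quot teqv}.

HB.instance Definition _ := Choice.on tprod.
HB.instance Definition _ : Quotient (seq (V * W)) tprod := Quotient.on tprod.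

Definition pure (v : V) (w : W) : tprod := \pi_tprod [:: (v, w)].

(* Sweedler's implicit summation: [tsum t E] is the sum of [E x y] over a
   decomposition t = sum of x (x) y.  It does not depend on the decomposition
   as soon as E is balanced, see [tsum_pi]. *)
Definition tsum (Z : zmodType) (t : tprod) (E : V -> W -> Z) : Z :=
  tsum_seq E (repr t).

Lemma eq_tprod (s t : seq (V * W)) :
  \pi_tprod s = \pi_tprod t <->
  forall (Z : zmodType) (b : V -> W -> Z), balanced b ->
    tsum_seq b s = tsum_seq b t.
Proof.
split; first by move=> /eqmodP /asboolP.
by move=> H; apply/eqmodP/asboolP.
Qed.

Lemma tsum_pi (Z : zmodType) (b : V -> W -> Z) (s : seq (V * W)) :
  balanced b -> tsum (\pi_tprod s) b = tsum_seq b s.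
Proof.
move=> bb; rewrite /tsum.
by apply: (proj1 (eq_tprod _ _)) => //; rewrite reprK.
Qed.

Lemma tsum_pure (Z : zmodType) (b : V -> W -> Z) v w :
  balanced b -> tsum (pure v w) b = b v w.
Proof. by move=> bb; rewrite tsum_pi // /tsum_seq big_seq1. Qed.

Lemma tprod_eqP (s t : tprod) :
  (forall (Z : zmodType) (b : V -> W -> Z), balanced b -> tsum s b = tsum t b) ->
  s = t.
Proof. by move=> H; rewrite -[s]reprK -[t]reprK; apply/eq_tprod. Qed.

Definition tadd (s t : tprod) : tprod := \pi_tprod (repr s ++ repr t).
Definition topp (s : tprod) : tprod :=
  \pi_tprod [seq (- p.1, p.2) | p <- repr s].
Definition tzero : tprod := \pi_tprod [::].

Lemma balanced0l (Z : zmodType) (b : V -> W -> Z) w : balanced b -> b 0 w = 0.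
Proof. by case=> D _ _; apply: (addIr (b 0 w)); rewrite -D !add0r. Qed.

Lemma balancedNl (Z : zmodType) (b : V -> W -> Z) v w :
  balanced b -> b (- v) w = - b v w.
Proof.
move=> bb; apply: (addIr (b v w)).
by rewrite -(balancedDl bb) !addNr (balanced0l w bb).
Qed.

Lemma tsum_add (Z : zmodType) (b : V -> W -> Z) s t :
  balanced b -> tsum (tadd s t) b = tsum s b + tsum t b.
Proof. by move=> bb; rewrite tsum_pi // /tsum_seq big_cat. Qed.

Lemma tsum_opp (Z : zmodType) (b : V -> W -> Z) s :
  balanced b -> tsum (topp s) b = - tsum s b.
Proof.
move=> bb; rewrite tsum_pi // /tsum_seq big_map -sumrN.
by apply: eq_bigr => p _; rewrite (balancedNl _ _ bb).
Qed.

Lemma tsum_zero (Z : zmodType) (b : V -> W -> Z) :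
  balanced b -> tsum tzero b = 0.
Proof. by move=> bb; rewrite tsum_pi // /tsum_seq big_nil. Qed.

Lemma taddA : associative tadd.
Proof. by move=> s t u; apply: tprod_eqP => Z b bb; rewrite !tsum_add ?addrA. Qed.

Lemma taddC : commutative tadd.
Proof. by move=> s t; apply: tprod_eqP => Z b bb; rewrite !tsum_add // addrC. Qed.

Lemma tadd0 : left_id tzero tadd.
Proof.
by move=> s; apply: tprod_eqP => Z b bb; rewrite tsum_add ?tsum_zero ?add0r.
Qed.

Lemma taddN : left_inverse tzero topp tadd.
Proof.
move=> s; apply: tprod_eqP => Z b bb.
by rewrite tsum_add ?tsum_opp ?tsum_zero ?addNr.
Qed.

HB.instance Definition _ := GRing.isZmodule.Build tprod taddA taddC tadd0 taddN.

Lemma tsumD (Z : zmodType) (b : V -> W -> Z) (s t : tprod) :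
  balanced b -> tsum (s + t) b = tsum s b + tsum t b.
Proof. exact: tsum_add. Qed.

Lemma tsum0 (Z : zmodType) (b : V -> W -> Z) :
  balanced b -> tsum (0 : tprod) b = 0.
Proof. exact: tsum_zero. Qed.

Lemma tsumN (Z : zmodType) (b : V -> W -> Z) (s : tprod) :
  balanced b -> tsum (- s) b = - tsum s b.
Proof. exact: tsum_opp. Qed.

Lemma eq_tsum (Z : zmodType) (b b' : V -> W -> Z) (t : tprod) :
  b =2 b' -> tsum t b = tsum t b'.
Proof. by move=> e; apply: eq_bigr => p _; rewrite e. Qed.

Lemma tsum_split (Z : zmodType) (b b' : V -> W -> Z) (t : tprod) :
  tsum t (fun v w => b v w + b' v w) = tsum t b + tsum t b'.
Proof. exact: big_split. Qed.

Lemma tsum_sum (Z : zmodType) (b : V -> W -> Z) (I : Type) (s : seq I)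
    (F : I -> tprod) :
  balanced b -> tsum (\sum_(i <- s) F i) b = \sum_(i <- s) tsum (F i) b.
Proof.
move=> bb; elim: s => [|i s IH]; first by rewrite !big_nil tsum0.
by rewrite !big_cons tsumD ?IH.
Qed.

Lemma pure_balanced : balanced pure.
Proof.
split=> [v v' w|v w w'|v r w]; apply: tprod_eqP => Z b bb;
  by rewrite ?tsumD ?tsum_pure // ?(balancedDl bb) ?(balancedDr bb)
             ?(balancedM bb).
Qed.

Lemma tprodE (t : tprod) : t = \sum_(p <- repr t) pure p.1 p.2.
Proof.
rewrite -{1}[t]reprK; elim: (repr t) => [|[v w] s IH].
  by rewrite big_nil.
rewrite big_cons -IH; apply: tprod_eqP => Z b bb.
by rewrite tsumD // tsum_pure // !tsum_pi // /tsum_seq big_cons.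
Qed.

Lemma tprod_ind (P : tprod -> Prop) :
  P 0 -> (forall v w, P (pure v w)) -> (forall s t, P s -> P t -> P (s + t)) ->
  forall t, P t.
Proof. by move=> P0 Pp PD t; rewrite [t]tprodE; apply: big_ind. Qed.

(* Universal property. *)
Lemma tprod_lift (Z : zmodType) (b : V -> W -> Z) : balanced b ->
  exists! F : tprod -> Z,
    (forall s t, F (s + t) = F s + F t) /\ (forall v w, F (pure v w) = b v w).
Proof.
move=> bb; exists (fun t => tsum t b); split.
  by split=> [s t|v w]; rewrite ?tsumD ?tsum_pure.
move=> F [FD Fp]; apply: funext => t; elim/tprod_ind: t.
- by rewrite tsum0 //; apply: (addIr (F 0)); rewrite -FD !add0r.
- by move=> v w; rewrite tsum_pure ?Fp.
- by move=> s t IHs IHt; rewrite tsumD // FD IHs IHt.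
Qed.

End TensorProduct.

Notation "\sw_ ( x & y <- t ) E" := (tsum t (fun x y => E))
  (at level 41, E at level 41, x name, y name, t at level 50,
   format "'[' \sw_ ( x  &  y  <-  t ) '/  '  E ']'") : ring_scope.
Notation "\sw_ ( x & y & z <- t ) E" :=
  (tsum t (fun x yz => tsum yz (fun y z => E)))
  (at level 41, E at level 41, x name, y name, z name, t at level 50,
   format "'[' \sw_ ( x  &  y  &  z  <-  t ) '/  '  E ']'") : ring_scope.
Notation "\sw_ ( x & y & z & w <- t ) E" :=
  (tsum t (fun x yzw => tsum yzw (fun y zw => tsum zw (fun z w => E))))
  (at level 41, E at level 41, x name, y name, z name, w name, t at level 50,
   format "'[' \sw_ ( x  &  y  &  z  &  w  <-  t ) '/  '  E ']'") : ring_scope.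

(* Associative unital algebras over k.  MathComp's [algType] is not used because
   it excludes the zero algebra.  [pz_class] is the vector space structure of
   [pz_sort], kept as one block so that [pz_lmod (pzAlgebra_tens A B)] below
   converts at once to the vector space A (x) B. *)
Record isPzAlgebra (k : pzRingType) (V : lmodType k) := IsPzAlgebra {
  pz_one : V;
  pz_mul : V -> V -> V;
  pz_mulA : associative pz_mul;
  pz_mul1 : left_id pz_one pz_mul;
  pz_mulr1 : right_id pz_one pz_mul;
  pz_mulDl : left_distributive pz_mul +%R;
  pz_mulDr : right_distributive pz_mul +%R;
  pz_mulZl : forall a x y, a *: pz_mul x y = pz_mul (a *: x) y;
  pz_mulZr : forall a x y, a *: pz_mul x y = pz_mul x (a *: y)
}.

Record pzAlgebra (k : pzRingType) := PzAlgebra {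
  pz_sort :> Type;
  pz_class : GRing.Lmodule.axioms_ k pz_sort;
  pz_alg : isPzAlgebra (GRing.Lmodule.Pack pz_class)
}.

Canonical pz_lmod (k : pzRingType) (A : pzAlgebra k) : lmodType k :=
  GRing.Lmodule.Pack (pz_class A).

HB.instance Definition _ (k : pzRingType) (A : pzAlgebra k) :=
  GRing.Zmodule.copy (pz_sort A) (pz_lmod A).
HB.instance Definition _ (k : pzRingType) (A : pzAlgebra k) :=
  GRing.Zmodule_isPzRing.Build (pz_sort A)
    (pz_mulA (pz_alg A)) (pz_mul1 (pz_alg A)) (pz_mulr1 (pz_alg A))
    (pz_mulDl (pz_alg A)) (pz_mulDr (pz_alg A)).

Definition pz_ring (k : pzRingType) (A : pzAlgebra k) : pzRingType := pz_sort A.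

Coercion pz_lmod : pzAlgebra >-> GRing.Lmodule.type.
Coercion pz_ring : pzAlgebra >-> GRing.PzRing.type.

Lemma pzscalerAl (k : pzRingType) (A : pzAlgebra k) (a : k) (x y : A) :
  a *: (x * y) = (a *: x) * y.
Proof. exact: pz_mulZl. Qed.

Lemma pzscalerAr (k : pzRingType) (A : pzAlgebra k) (a : k) (x y : A) :
  a *: (x * y) = x * (a *: y).
Proof. exact: pz_mulZr. Qed.

Definition alg_map (k : pzRingType) (A B : pzAlgebra k) (f : A -> B) : Prop :=
  linear f /\ monoid_morphism f.

Section TensorOverField.
Variables (k : fieldType) (V W : lmodType k).

Definition tens : Type :=
  tprod (fun (v : V) (a : k) => a *: v) (fun (a : k) (w : W) => a *: w).

HB.instance Definition _ := GRing.Zmodule.on tens.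

Definition ot (v : V) (w : W) : tens := pure _ _ v w.

Definition tscale (a : k) (t : tens) : tens :=
  \sw_(v & w <- t) ot (a *: v) w.

Lemma tscale_bal a : balanced (fun (v : V) (a : k) => a *: v)
  (fun (a : k) (w : W) => a *: w) (fun v w => ot (a *: v) w).
Proof.
have [Dl Dr M] := pure_balanced (fun (v : V) (a : k) => a *: v)
  (fun (a : k) (w : W) => a *: w).
split=> [v v' w|v w w'|v r w].
- by rewrite scalerDr [LHS]Dl.
- exact: Dr.
- by rewrite scalerA mulrC -scalerA [LHS]M.
Qed.

Lemma tscale_ot a v w : tscale a (ot v w) = ot (a *: v) w.
Proof. exact: tsum_pure (tscale_bal a). Qed.

Lemma tscaleDr : right_distributive tscale +%R.
Proof. by move=> a s t; apply: tsumD (tscale_bal a). Qed.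

Lemma tscale0 a : tscale a 0 = 0.
Proof. exact: tsum0 (tscale_bal a). Qed.

Lemma tscaleA a b t : tscale a (tscale b t) = tscale (a * b) t.
Proof.
elim/tprod_ind: t => [|v w|s t IHs IHt]; first by rewrite !tscale0.
  by rewrite -/(ot v w) !tscale_ot scalerA.
by rewrite !tscaleDr IHs IHt.
Qed.

Lemma tscale1 : left_id 1 tscale.
Proof.
move=> t; elim/tprod_ind: t => [|v w|s t IHs IHt]; first by rewrite !tscale0.
  by rewrite -/(ot v w) !tscale_ot scale1r.
by rewrite !tscaleDr IHs IHt.
Qed.

Lemma tscaleDl t : {morph tscale^~ t : a b / a + b}.
Proof.
move=> a b /=; elim/tprod_ind: t => [|v w|s t IHs IHt].
- by rewrite !tscale0 addr0.
- rewrite -/(ot v w) !tscale_ot scalerDl.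
  exact: (balancedDl (pure_balanced _ _)).
- by rewrite !tscaleDr IHs IHt addrACA.
Qed.

HB.instance Definition _ :=
  GRing.Zmodule_isLmodule.Build k tens tscaleA tscale1 tscaleDr tscaleDl.

Lemma otDl v v' w : ot (v + v') w = ot v w + ot v' w.
Proof. exact: (balancedDl (pure_balanced _ _)). Qed.

Lemma otDr v w w' : ot v (w + w') = ot v w + ot v w'.
Proof. exact: (balancedDr (pure_balanced _ _)). Qed.

Lemma otZl a v w : ot (a *: v) w = a *: ot v w.
Proof. by rewrite [RHS]tscale_ot. Qed.

Lemma otZr a v w : ot v (a *: w) = a *: ot v w.
Proof.
rewrite -otZl; apply/esym.
exact: (balancedM (pure_balanced (fun (v : V) (a : k) => a *: v)
                                 (fun (a : k) (w : W) => a *: w)) v a w).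
Qed.

End TensorOverField.

Arguments ot {k V W} & v w.

Notation "V \otimes W" := (tens V W)
  (at level 38, right associativity) : type_scope.
Notation "v \ot w" := (ot v w)
  (at level 38, right associativity) : ring_scope.

Section TensorAlgebra.
Variables (k : fieldType) (A B : pzAlgebra k).
Local Notation T := (A \otimes B)%type.
Local Notation bal := (balanced (fun (v : A) (a : k) => a *: v)
                                (fun (a : k) (w : B) => a *: w)).

Definition tmul (s t : T) : T :=
  \sw_(a & b <- s) \sw_(c & d <- t) (a * c) \ot (b * d).
Definition tone : T := (1 : A) \ot (1 : B).

Lemma tmul_bal a b : bal (fun c d => (a * c) \ot (b * d)).
Proof.
split=> [v v' w|v w w'|v r w].
- by rewrite mulrDr otDl.
- by rewrite mulrDr otDr.
- by rewrite -pzscalerAr -pzscalerAr otZl otZr.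
Qed.

Lemma tmul_bal2 (t : T) :
  bal (fun a b => \sw_(c & d <- t) (a * c) \ot (b * d)).
Proof.
split=> [v v' w|v w w'|v r w]; rewrite -?tsum_split; apply: eq_tsum => c d.
- by rewrite mulrDl otDl.
- by rewrite mulrDl otDr.
- by rewrite -pzscalerAl -pzscalerAl otZl otZr.
Qed.

Lemma tmul_ot a b c d : tmul (a \ot b) (c \ot d) = (a * c) \ot (b * d).
Proof.
by rewrite /tmul [LHS](tsum_pure _ _ (tmul_bal2 _)) (tsum_pure _ _ (tmul_bal _ _)).
Qed.

Lemma tmulDl : left_distributive tmul +%R.
Proof. by move=> s s' t; apply: tsumD (tmul_bal2 t). Qed.

Lemma tmulDr : right_distributive tmul +%R.
Proof.
move=> s t t'; rewrite /tmul -tsum_split; apply: eq_tsum => a b.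
exact: tsumD (tmul_bal a b).
Qed.

Lemma tmul0l (t : T) : tmul 0 t = 0.
Proof. by apply: (addIr (tmul 0 t)); rewrite -tmulDl !add0r. Qed.

Lemma tmul0r (t : T) : tmul t 0 = 0.
Proof. by apply: (addIr (tmul t 0)); rewrite -tmulDr !add0r. Qed.

Lemma tmulA : associative tmul.
Proof.
move=> s t u.
elim/tprod_ind: s => [|a b|s s' IHs IHs']; first by rewrite !tmul0l.
  elim/tprod_ind: t => [|c d|t t' IHt IHt']; first by rewrite !(tmul0l, tmul0r).
    elim/tprod_ind: u => [|e g|u u' IHu IHu']; first by rewrite !tmul0r.
      by rewrite -/(ot a b) -/(ot c d) -/(ot e g) !tmul_ot !mulrA.
    by rewrite !tmulDr IHu IHu'.
  by rewrite !(tmulDr, tmulDl) IHt IHt'.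
by rewrite !tmulDl IHs IHs'.
Qed.

Lemma tmul1l : left_id tone tmul.
Proof.
move=> t; elim/tprod_ind: t => [|c d|t t' IHt IHt']; first by rewrite tmul0r.
  by rewrite -/(ot c d) tmul_ot !mul1r.
by rewrite tmulDr IHt IHt'.
Qed.

Lemma tmul1r : right_id tone tmul.
Proof.
move=> t; elim/tprod_ind: t => [|c d|t t' IHt IHt']; first by rewrite tmul0l.
  by rewrite -/(ot c d) tmul_ot !mulr1.
by rewrite tmulDl IHt IHt'.
Qed.

Lemma tmulZl (x : k) (s t : T) : x *: tmul s t = tmul (x *: s) t.
Proof.
elim/tprod_ind: s => [|a b|s s' IHs IHs'].
- by rewrite tmul0l !scaler0 tmul0l.
- elim/tprod_ind: t => [|c d|t t' IHt IHt']; first by rewrite !tmul0r scaler0.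
    by rewrite -/(ot a b) -/(ot c d) tmul_ot -!otZl tmul_ot -pzscalerAl.
  by rewrite !tmulDr scalerDr IHt IHt'.
- by rewrite tmulDl !scalerDr tmulDl IHs IHs'.
Qed.

Lemma tmulZr (x : k) (s t : T) : x *: tmul s t = tmul s (x *: t).
Proof.
elim/tprod_ind: s => [|a b|s s' IHs IHs'].
- by rewrite !tmul0l scaler0.
- elim/tprod_ind: t => [|c d|t t' IHt IHt'].
  + by rewrite scaler0 !tmul0r scaler0.
  + by rewrite -/(ot a b) -/(ot c d) tmul_ot -!otZl tmul_ot -pzscalerAr.
  + by rewrite tmulDr !scalerDr tmulDr IHt IHt'.
- by rewrite !tmulDl scalerDr IHs IHs'.
Qed.

Canonical pzAlgebra_tens : pzAlgebra k := @PzAlgebra k T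
  (GRing.Lmodule.class (T : lmodType k))
  (@IsPzAlgebra k (T : lmodType k) tone tmul
     tmulA tmul1l tmul1r tmulDl tmulDr tmulZl tmulZr).

HB.instance Definition _ := GRing.PzRing.copy T (pz_sort pzAlgebra_tens).

Lemma otM a b c d : (a \ot b) * (c \ot d) = (a * c) \ot (b * d) :> T.
Proof. exact: tmul_ot. Qed.

Lemma otone : 1 = (1 : A) \ot (1 : B) :> T.
Proof. by []. Qed.

End TensorAlgebra.

(* Iterated tensor products are nested to the right: U (x) (V (x) W). *)
Section TensorMaps.
Variable k : fieldType.

(* id (x) f *)
Definition idT (U V V' : lmodType k) (f : V -> V') (t : U \otimes V)
    : U \otimes V' := \sw_(u & v <- t) u \ot f v.

(* f (x) id, with (V1 (x) V2) (x) W identified with V1 (x) (V2 (x) W) *)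
Definition fT (V V1 V2 W : lmodType k) (f : V -> V1 \otimes V2)
    (t : V \otimes W) : V1 \otimes (V2 \otimes W) :=
  \sw_(v & w <- t) \sw_(v1 & v2 <- f v) v1 \ot v2 \ot w.

(* e (x) id and id (x) e, for a linear form e *)
Definition formT (V W : lmodType k) (e : V -> k^o) (t : V \otimes W) : W :=
  \sw_(v & w <- t) e v *: w.
Definition idTform (V W : lmodType k) (e : W -> k^o) (t : V \otimes W) : V :=
  \sw_(v & w <- t) e w *: v.

(* t (x) 1 *)
Definition tens1 (U V W : lmodType k) (A : pzAlgebra k)
    (t : U \otimes (V \otimes W)) : U \otimes (V \otimes (W \otimes A)) :=
  \sw_(u & v & w <- t) u \ot v \ot w \ot (1 : A).

End TensorMaps.

Definition inverses (R : pzRingType) (x y : R) : Prop := x * y = 1 /\ y * x = 1.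

(* The two-sided inverse of x if there is one, and 0 otherwise. *)
Definition inverse (R : pzRingType) (x : R) : R :=
  if pselect (exists y, inverses x y) is left h then sval (cid h) else 0.

Record quasiBialgebra (k : fieldType) := QuasiBialgebra {
  qb_alg :> pzAlgebra k;
  Delta : qb_alg -> qb_alg \otimes qb_alg;
  eps : qb_alg -> k^o;
  Phi : qb_alg \otimes (qb_alg \otimes qb_alg);
  Phi_inv : qb_alg \otimes (qb_alg \otimes qb_alg);
  Delta_alg : alg_map Delta;
  eps_linear : linear eps;
  eps_monoid : monoid_morphism eps;
  PhiV : inverses Phi Phi_inv;
  Delta_coassoc : forall h,
    idT Delta (Delta h) = Phi * fT Delta (Delta h) * Phi_inv;
  idTeps_Delta : forall h, idTform eps (Delta h) = h;
  epsT_Delta : forall h, formT eps (Delta h) = h;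
  Phi_cocycle :
    (1 \ot Phi) * idT (fT Delta) Phi * tens1 qb_alg Phi =
    idT (idT Delta) Phi * fT Delta Phi;
  Phi_eps : idT (formT eps) Phi = 1
}.

Record quasiHopf (k : fieldType) := QuasiHopf {
  qh_qb :> quasiBialgebra k;
  S : qh_qb -> qh_qb;
  Sinv : qh_qb -> qh_qb;
  alpha : qh_qb;
  beta : qh_qb;
  S_linear : linear S;
  S_one : S 1 = 1;
  S_antimul : forall g h, S (g * h) = S h * S g;
  SK : cancel S Sinv;
  SinvK : cancel Sinv S;
  S_alpha : forall h,
    \sw_(h1 & h2 <- Delta h) (S h1 * alpha * h2) = eps h *: alpha;
  S_beta : forall h,
    \sw_(h1 & h2 <- Delta h) (h1 * beta * S h2) = eps h *: beta;
  Phi_alpha_beta :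
    \sw_(X1 & X2 & X3 <- Phi qh_qb) (X1 * beta * S X2 * alpha * X3) = 1;
  Phi_inv_alpha_beta :
    \sw_(x1 & x2 & x3 <- Phi_inv qh_qb) (S x1 * alpha * x2 * beta * S x3) = 1;
  eps_alpha : eps alpha = 1;
  eps_beta : eps beta = 1;
  eps_S : forall h, eps (S h) = eps h
}.

Arguments alpha {k}.
Arguments beta {k}.

Section DrinfeldTwist.
Variables (k : fieldType) (H : quasiHopf k).

Definition drinfeld_gamma : H \otimes H :=
  \sw_(A1 & A2 & A3 & A4 <- tens1 H (Phi H) * fT (@Delta k H) (Phi_inv H))
    (S A2 * alpha H * A3) \ot (S A1 * alpha H * A4).

Definition drinfeld_twist : H \otimes H :=
  \sw_(x1 & x2 & x3 <- Phi_inv H)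
    ((\sw_(h1 & h2 <- Delta x1) (S h2 \ot S h1)) *
     drinfeld_gamma * Delta (x2 * beta H * S x3)).

Definition drinfeld_twist_inv : H \otimes H := inverse drinfeld_twist.

End DrinfeldTwist.

Record leftComoduleAlgebra (k : fieldType) (H : quasiBialgebra k)
    (B : pzAlgebra k) := LeftComoduleAlgebra {
  lam : B -> H \otimes B;
  Phil : H \otimes (H \otimes B);
  Phil_inv : H \otimes (H \otimes B);
  lam_alg : alg_map lam;
  PhilV : inverses Phil Phil_inv;
  lam_coassoc : forall b,
    idT lam (lam b) * Phil = Phil * fT (@Delta k H) (lam b);
  Phil_cocycle :
    (1 \ot Phil) * idT (fT (@Delta k H)) Phil * tens1 B (Phi H) =
    idT (idT lam) Phil * fT (@Delta k H) Phil;
  lam_eps : forall b, formT (@eps k H) (lam b) = b;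
  Phil_eps2 : idT (formT (@eps k H)) Phil = 1;
  Phil_eps1 : formT (@eps k H) Phil = 1
}.

Record rightComoduleAlgebra (k : fieldType) (H : quasiBialgebra k)
    (B : pzAlgebra k) := RightComoduleAlgebra {
  rho : B -> B \otimes H;
  Phir : B \otimes (H \otimes H);
  Phir_inv : B \otimes (H \otimes H);
  rho_alg : alg_map rho;
  PhirV : inverses Phir Phir_inv;
  rho_coassoc : forall b,
    Phir * fT rho (rho b) = idT (@Delta k H) (rho b) * Phir;
  Phir_cocycle :
    (1 \ot Phi H) * idT (fT (@Delta k H)) Phir * tens1 H Phir =
    idT (idT (@Delta k H)) Phir * fT rho Phir;
  rho_eps : forall b, idTform (@eps k H) (rho b) = b;
  Phir_eps2 : idT (formT (@eps k H)) Phir = 1;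
  Phir_eps3 : idT (idTform (@eps k H)) Phir = 1
}.

Record bicomoduleAlgebra (k : fieldType) (H : quasiBialgebra k) :=
    BicomoduleAlgebra {
  bca_alg :> pzAlgebra k;
  bca_left :> leftComoduleAlgebra H bca_alg;
  bca_right :> rightComoduleAlgebra H bca_alg;
  Philr : H \otimes (bca_alg \otimes H);
  Philr_inv : H \otimes (bca_alg \otimes H);
  PhilrV : inverses Philr Philr_inv;
  lam_rho : forall u,
    Philr * fT (lam bca_left) (rho bca_right u) =
    idT (rho bca_right) (lam bca_left u) * Philr;
  Philr_cocyclel :
    (1 \ot Philr) * idT (fT (lam bca_left)) Philr * tens1 H (Phil bca_left) =
    idT (idT (rho bca_right)) (Phil bca_left) * fT (@Delta k H) Philr;
  Philr_cocycler :
    (1 \ot Phir bca_right) * idT (fT (rho bca_right)) Philr * tens1 H Philr =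
    idT (idT (@Delta k H)) Philr * fT (lam bca_left) (Phir bca_right)
}.

Record bimoduleCoalgebra (k : fieldType) (H : quasiBialgebra k) :=
    BimoduleCoalgebra {
  bc_mod :> lmodType k;
  lactC : H -> bc_mod -> bc_mod;
  ractC : bc_mod -> H -> bc_mod;
  DeltaC : bc_mod -> bc_mod \otimes bc_mod;
  epsC : bc_mod -> k^o;
  lactC_linearl : forall c, linear (lactC^~ c);
  lactC_linearr : forall h, linear (lactC h);
  ractC_linearl : forall h, linear (ractC^~ h);
  ractC_linearr : forall c, linear (ractC c);
  lactC1 : forall c, lactC 1 c = c;
  lactCM : forall g h c, lactC (g * h) c = lactC g (lactC h c);
  ractC1 : forall c, ractC c 1 = c;
  ractCM : forall c g h, ractC c (g * h) = ractC (ractC c g) h;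
  lractC : forall g c h, ractC (lactC g c) h = lactC g (ractC c h);
  DeltaC_linear : linear DeltaC;
  epsC_linear : linear epsC;
  DeltaC_coassoc : forall c,
    (\sw_(X1 & X2 & X3 <- Phi H)
     \sw_(c1 & c2 & c3 <- fT DeltaC (DeltaC c))
     \sw_(x1 & x2 & x3 <- Phi_inv H)
       (ractC (lactC X1 c1) x1 \ot ractC (lactC X2 c2) x2
          \ot ractC (lactC X3 c3) x3))
    = idT DeltaC (DeltaC c);
  DeltaC_lact : forall h c, DeltaC (lactC h c) =
    \sw_(h1 & h2 <- Delta h) \sw_(c1 & c2 <- DeltaC c)
      (lactC h1 c1 \ot lactC h2 c2);
  DeltaC_ract : forall c h, DeltaC (ractC c h) =
    \sw_(c1 & c2 <- DeltaC c) \sw_(h1 & h2 <- Delta h)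
      (ractC c1 h1 \ot ractC c2 h2);
  epsCT_DeltaC : forall c, formT epsC (DeltaC c) = c;
  idTepsC_DeltaC : forall c, idTform epsC (DeltaC c) = c;
  epsC_lact : forall h c, epsC (lactC h c) = eps h * epsC c;
  epsC_ract : forall c h, epsC (ractC c h) = epsC c * eps h
}.

Notation "h |>> c" := (lactC h c) (at level 40, left associativity).
Notation "c <<| h" := (ractC c h) (at level 40, left associativity).

Record category := Category {
  ob :> Type;
  hom : ob -> ob -> Type;
  idm : forall x, hom x x;
  cmp : forall x y z, hom y z -> hom x y -> hom x z;
  cmp_idl : forall x y (f : hom x y), cmp (idm y) f = f;
  cmp_idr : forall x y (f : hom x y), cmp f (idm x) = f;
  cmpA : forall x y z t (f : hom z t) (g : hom y z) (h : hom x y),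
    cmp f (cmp g h) = cmp (cmp f g) h
}.

Record functor (C D : category) := Functor {
  fob :> C -> D;
  fmor : forall x y, hom x y -> hom (fob x) (fob y);
  fmor_id : forall x, fmor (idm x) = idm (fob x);
  fmor_cmp : forall x y z (g : hom y z) (f : hom x y),
    fmor (cmp g f) = cmp (fmor g) (fmor f)
}.

Definition fid (C : category) : functor C C.
Proof. by exists id (fun x y f => f). Defined.

Definition fcomp (C D E : category) (G : functor D E) (F : functor C D)
  : functor C E.
Proof.
exists (fun x => G (F x)) (fun x y f => fmor G (fmor F f)).
- by move=> x; rewrite !fmor_id.
- by move=> x y z g f; rewrite !fmor_cmp.
Defined.

Definition isomorphic_cat (C D : category) : Prop :=
  exists (F : functor C D) (G : functor D C),
    fcomp G F = fid C /\ fcomp F G = fid D.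

(* A left module over a k-algebra, seen as a k-vector space. *)
Section Restriction.
Variables (k : fieldType) (A : pzAlgebra k) (M : lmodType A).

Definition kspace : Type := M.

HB.instance Definition _ := GRing.Zmodule.on kspace.

Definition kscale (a : k) (m : kspace) : kspace := (a *: (1 : A)) *: (m : M).

Lemma kscaleA a b m : kscale a (kscale b m) = kscale (a * b) m.
Proof. by rewrite /kscale scalerA -pzscalerAl mul1r scalerA. Qed.

Lemma kscale1 : left_id 1 kscale.
Proof. by move=> m; rewrite /kscale !scale1r. Qed.

Lemma kscaleDr : right_distributive kscale +%R.
Proof. by move=> a m n; rewrite /kscale [LHS]scalerDr. Qed.

Lemma kscaleDl m : {morph kscale^~ m : a b / a + b}.
Proof. by move=> a b; rewrite /kscale [in LHS]scalerDl [LHS]scalerDl. Qed.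

HB.instance Definition _ :=
  GRing.Zmodule_isLmodule.Build k kspace kscaleA kscale1 kscaleDr kscaleDl.

End Restriction.

Section YetterDrinfeld.
Variables (k : fieldType) (H : quasiHopf k).
Variables (A : bicomoduleAlgebra H) (C : bimoduleCoalgebra H).

Record ydModule := YdModule {
  yd_mod :> lmodType A;
  yd_coact : kspace yd_mod -> kspace yd_mod \otimes C;
  yd_coact_linear : linear yd_coact;
  yd_counit : forall m, idTform (@epsC k H C) (yd_coact m) = m;
  yd_coassoc : forall m : yd_mod,
    \sw_(t1 & t2 & t3 <- Philr_inv A)
    \sw_(m0 & m1 <- yd_coact m)
    \sw_(n0 & n1 <- yd_coact (t2 *: (m0 : yd_mod)))
      (n0 \ot (n1 <<| t1) \ot (t3 |>> m1)) =
    \sw_(x1 & x2 & x3 <- Phir_inv A)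
    \sw_(y1 & y2 & y3 <- Phil_inv A)
    \sw_(n0 & n1 <- yd_coact (y3 *: m))
    \sw_(c1 & c2 <- DeltaC n1)
      (((x1 *: (n0 : yd_mod) : kspace yd_mod))
         \ot (x2 |>> c1 <<| y1) \ot (x3 |>> c2 <<| y2));
  yd_compat : forall (u : A) (m : yd_mod),
    \sw_(u0 & u1 <- rho A u) \sw_(m0 & m1 <- yd_coact m)
      ((u0 *: (m0 : yd_mod) : kspace yd_mod) \ot (u1 |>> m1)) =
    \sw_(v & u0 <- lam A u) \sw_(n0 & n1 <- yd_coact (u0 *: m))
      (n0 \ot (n1 <<| v))
}.

Record ydHom (M N : ydModule) := YdHom {
  yd_fun :> M -> N;
  yd_fun_linear : linear yd_fun;
  yd_fun_coact : forall m,
    yd_coact (yd_fun m) =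
    \sw_(m0 & m1 <- yd_coact m) ((yd_fun m0 : kspace N) \ot m1)
}.

Lemma ydHom_eq (M N : ydModule) (f g : ydHom M N) : f =1 g -> f = g.
Proof.
case: f g => [f fl fc] [g gl gc] /= /funext fg; subst g.
by rewrite (Prop_irrelevance fl gl) (Prop_irrelevance fc gc).
Qed.

Definition ydId (M : ydModule) : ydHom M M.
Proof.
exists id; first by [].
by move=> m; rewrite [LHS]tprodE.
Defined.

Lemma ydcomp_linear (M N P : ydModule) (g : ydHom N P) (f : ydHom M N) :
  linear (g \o f).
Proof. by move=> a x y; rewrite /= (yd_fun_linear f) (yd_fun_linear g). Qed.

Lemma ydHom_balanced (M N : ydModule) (f : ydHom M N) :
  balanced (fun (v : kspace M) (a : k) => a *: v)
    (fun (a : k) (w : C) => a *: w)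
    (fun m0 m1 => (f m0 : kspace N) \ot m1).
Proof.
have fD x y : f (x + y) = f x + f y.
  by have := yd_fun_linear f 1 x y; rewrite !scale1r.
have f0 : f 0 = 0 by apply: (addIr (f 0)); rewrite -fD !add0r.
have fZ a x : f (a *: x) = a *: f x.
  by have := yd_fun_linear f a x 0; rewrite f0 !addr0.
split=> [v v' w|v w w'|v r w].
- by rewrite [f _]fD [LHS]otDl.
- exact: otDr.
- by rewrite [f _]fZ otZr -otZl.
Qed.

Lemma ydcomp_coact (M N P : ydModule) (g : ydHom N P) (f : ydHom M N) (m : M) :
  yd_coact ((g \o f) m) =
  \sw_(m0 & m1 <- yd_coact m) (((g \o f) m0 : kspace P) \ot m1).
Proof.
rewrite /= (yd_fun_coact g) (yd_fun_coact f).
rewrite [LHS](tsum_sum _ _ (ydHom_balanced g)).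
by apply: eq_bigr => p _; rewrite [LHS](tsum_pure _ _ (ydHom_balanced g)).
Qed.

Definition ydComp (M N P : ydModule) (g : ydHom N P) (f : ydHom M N) :
  ydHom M P := YdHom (ydcomp_linear g f) (ydcomp_coact g f).

Definition ydCategory : category.
Proof.
exists ydModule ydHom ydId ydComp.
- by move=> M N f; apply: ydHom_eq.
- by move=> M N f; apply: ydHom_eq.
- by move=> M N P Q f g h; apply: ydHom_eq.
Defined.

End YetterDrinfeld.

Record bimodule (R : pzRingType) (V : zmodType) := Bimodule {
  lact : R -> V -> V;
  ract : V -> R -> V;
  lactDl : forall r s v, lact (r + s) v = lact r v + lact s v;
  lactDr : forall r v w, lact r (v + w) = lact r v + lact r w;
  ractDl : forall v w r, ract (v + w) r = ract v r + ract w r;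
  ractDr : forall v r s, ract v (r + s) = ract v r + ract v s;
  lact1 : forall v, lact 1 v = v;
  lactM : forall r s v, lact (r * s) v = lact r (lact s v);
  ract1 : forall v, ract v 1 = v;
  ractM : forall v r s, ract v (r * s) = ract (ract v r) s;
  lract : forall r v s, ract (lact r v) s = lact r (ract v s)
}.

(* V (x)_R W for a bimodule V and a left action [la] of R on W, with its left
   action of R. *)
Section BimoduleTensor.
Variables (R : pzRingType) (V : zmodType) (B : bimodule R V).
Variables (W : zmodType) (la : R -> W -> W).

Definition btens : zmodType := tprod (ract B) la.

Definition bpure (v : V) (w : W) : btens := pure (ract B) la v w.

Definition btens_lact (r : R) (t : btens) : btens :=
  \sw_(v & w <- t) bpure (lact B r v) w.

End BimoduleTensor.

Arguments bpure {R V B W la} & v w.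
Arguments btens_lact {R V} B {W} la r t.

Record coring (R : pzRingType) (V : zmodType) := Coring {
  cr_bimod :> bimodule R V;
  cr_Delta : V -> btens cr_bimod (lact cr_bimod);
  cr_eps : V -> R;
  cr_DeltaD : forall v w, cr_Delta (v + w) = cr_Delta v + cr_Delta w;
  cr_DeltaMl : forall r v, cr_Delta (lact cr_bimod r v) =
    \sw_(v1 & v2 <- cr_Delta v) bpure (lact cr_bimod r v1) v2;
  cr_DeltaMr : forall v r, cr_Delta (ract cr_bimod v r) =
    \sw_(v1 & v2 <- cr_Delta v) bpure v1 (ract cr_bimod v2 r);
  cr_epsD : forall v w, cr_eps (v + w) = cr_eps v + cr_eps w;
  cr_epsMl : forall r v, cr_eps (lact cr_bimod r v) = r * cr_eps v;
  cr_epsMr : forall v r, cr_eps (ract cr_bimod v r) = cr_eps v * r;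
  cr_coassoc : forall v,
    \sw_(v1 & v2 <- cr_Delta v) \sw_(v11 & v12 <- cr_Delta v1)
      bpure v11 (bpure v12 v2) =
    \sw_(v1 & v2 <- cr_Delta v) bpure v1 (cr_Delta v2)
    :> btens cr_bimod (btens_lact cr_bimod (lact cr_bimod));
  cr_counitl : forall v,
    \sw_(v1 & v2 <- cr_Delta v) lact cr_bimod (cr_eps v1) v2 = v;
  cr_counitr : forall v,
    \sw_(v1 & v2 <- cr_Delta v) ract cr_bimod v1 (cr_eps v2) = v
}.

Section Comodules.
Variables (R : pzRingType) (V : zmodType) (D : coring R V).

Record comodule := Comodule {
  cm_mod :> lmodType R;
  cm_coact : cm_mod -> btens D ( *:%R : R -> cm_mod -> cm_mod);
  cm_coactD : forall m n, cm_coact (m + n) = cm_coact m + cm_coact n;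
  cm_coactZ : forall r m, cm_coact (r *: m) =
    \sw_(v & n <- cm_coact m) bpure (lact D r v) n;
  cm_coassoc : forall m,
    \sw_(v & n <- cm_coact m) \sw_(v1 & v2 <- cr_Delta D v)
      bpure v1 (bpure v2 n) =
    \sw_(v & n <- cm_coact m) bpure v (cm_coact n)
    :> btens D (btens_lact D ( *:%R : R -> cm_mod -> cm_mod));
  cm_counit : forall m, \sw_(v & n <- cm_coact m) cr_eps D v *: n = m
}.

Record comoduleHom (M N : comodule) := ComoduleHom {
  cm_fun :> M -> N;
  cm_fun_linear : linear cm_fun;
  cm_fun_coact : forall m,
    cm_coact (cm_fun m) = \sw_(v & n <- cm_coact m) bpure v (cm_fun n)
}.

Lemma comoduleHom_eq (M N : comodule) (f g : comoduleHom M N) :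
  f =1 g -> f = g.
Proof.
case: f g => [f fl fc] [g gl gc] /= /funext fg; subst g.
by rewrite (Prop_irrelevance fl gl) (Prop_irrelevance fc gc).
Qed.

Definition comoduleId (M : comodule) : comoduleHom M M.
Proof.
exists id; first by [].
by move=> m; rewrite [LHS]tprodE.
Defined.

Lemma comodule_comp_linear (M N P : comodule)
    (g : comoduleHom N P) (f : comoduleHom M N) : linear (g \o f).
Proof. by move=> a x y; rewrite /= (cm_fun_linear f) (cm_fun_linear g). Qed.

Lemma comoduleHom_balanced (M N : comodule) (f : comoduleHom M N) :
  balanced (ract D) ( *:%R : R -> M -> M)
    (fun v n => bpure v (f n) : btens D ( *:%R : R -> N -> N)).
Proof.
have fD x y : f (x + y) = f x + f y.
  by have := cm_fun_linear f 1 x y; rewrite !scale1r.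
have f0 : f 0 = 0 by apply: (addIr (f 0)); rewrite -fD !add0r.
have fZ a x : f (a *: x) = a *: f x.
  by have := cm_fun_linear f a x 0; rewrite f0 !addr0.
have [Dl Dr M'] := pure_balanced (ract D) ( *:%R : R -> N -> N).
by split=> [v v' w|v w w'|v r w]; rewrite ?fD ?fZ; [apply: Dl|apply: Dr|apply: M'].
Qed.

Lemma comodule_comp_coact (M N P : comodule)
    (g : comoduleHom N P) (f : comoduleHom M N) (m : M) :
  cm_coact ((g \o f) m) = \sw_(v & n <- cm_coact m) bpure v ((g \o f) n).
Proof.
rewrite /= (cm_fun_coact g) (cm_fun_coact f).
rewrite [LHS](tsum_sum _ _ (comoduleHom_balanced g)).
by apply: eq_bigr => p _; rewrite [LHS](tsum_pure _ _ (comoduleHom_balanced g)).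
Qed.

Definition comoduleComp (M N P : comodule)
    (g : comoduleHom N P) (f : comoduleHom M N) : comoduleHom M P :=
  ComoduleHom (comodule_comp_linear g f) (comodule_comp_coact g f).

Definition comoduleCategory : category.
Proof.
exists comodule comoduleHom comoduleId comoduleComp.
- by move=> M N f; apply: comoduleHom_eq.
- by move=> M N f; apply: comoduleHom_eq.
- by move=> M N P Q f g h; apply: comoduleHom_eq.
Defined.

End Comodules.

(* Main.v *)
From HB Require Import structures.
Require Import Defs.
From mathcomp Require Import all_boot all_order all_algebra.
From mathcomp.classical Require boolp.
Import GRing.Theory.
Local Open Scope ring_scope.
Set Implicit Arguments.
Unset Strict Implicit.
Unset Printing Implicit Defensive.

(* Put p = X2 S^-1(X1 beta) (x) X3 and q = S(x1) alpha x2 (x) x3, with X = Phi_lambda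
   and x its inverse.  For left A-modules M and N, the A-linear maps
   M -> (C (x) A) (x)_A N are in bijection with the k-linear maps
   phi : M -> N (x) C such that
     u<0> phi0 (x) u<1> phi1 = phi(u[0] m)0 (x) phi(u[0] m)1 u[-1];
   the map phi attached to f is pi f, where pi is the map
     (c (x) u) (x) n  |->  q2<0> u n (x) q2<1> c S^-1(q1),
   and f is recovered from phi with the help of p.  The comultiplication is the
   A-linear map delta such that iterating pi along delta gives the right-hand side
   of the Yetter-Drinfeld coassociativity axiom for pi.  A linear map f : M -> (C (x) A) (x)_A M
   is then coassociative if and only if pi f satisfies that axiom, because iterating pi twice
   separates A-linear maps.  Iterating it three times reduces the coassociativity of delta
   itself to the cocycle identities.  The explicit formula for delta comes from
   the value of (id (x) lambda)(p)(1 (x) p) in terms of p and the Drinfeld twist f,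
   which rests on f Delta(S h) f^-1 = (S (x) S) Delta^cop h; the latter is an
   instance of the uniqueness, up to conjugation, of antipodes along an algebra map. *)

(** * Linear and bilinear maps on Sweedler sums *)

Section Lin.
Variable k : fieldType.

(** A direct check that the explicit comultiplication is coassociative would have to carry f^-1
    through every step. Instead, with D = C (x) A, the map delta is built on D (x)_A N for all left
    A-modules N at once and is natural in N. The coring is the case N = A: naturality under right
    multiplications of A gives right linearity, and naturality under the orbit maps A -> N recovers
    delta on N. The twist enters only when the formula is computed. All calculations take place over
    k, because D (x)_A N is identified with N (x) C. If the associators are trivial and alpha = beta
    = 1, then p = q = 1 (x) 1 and pi is this identification. The calculations share one pattern: a
    cocycle identity or quasi-coassociativity brings two legs of the same element together as S(h1)
    alpha h2 or h1 beta S(h2), the pair collapses to a counit, and the counit removes an associator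
    or a coproduct. A Sweedler sum is a sum over a chosen representative, so the rules that change
    the tensor require multilinear summands; [lin_core] discharges these conditions. *)

Definition lin (V W : lmodType k) (f : V -> W) : Prop := linear f.

Implicit Types U V W Z : lmodType k.

Lemma linD V W (f : V -> W) : lin f -> forall x y, f (x + y) = f x + f y.
Proof. by move=> l x y; have := l 1 x y; rewrite !scale1r. Qed.
Lemma lin0 V W (f : V -> W) : lin f -> f 0 = 0.
Proof. by move=> l; apply: (addIr (f 0)); rewrite -linD // !add0r. Qed.
Lemma linZ V W (f : V -> W) : lin f -> forall a x, f (a *: x) = a *: f x.
Proof. by move=> l a x; have := l a x 0; rewrite (lin0 l) !addr0. Qed.
Lemma lin_id V : lin (fun x : V => x).
Proof. by []. Qed.
Lemma lin_comp U V W (g : V -> W) (f : U -> V) : lin g -> lin f -> lin (fun x => g (f x)).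
Proof. by move=> lg lf a x y; rewrite lf lg. Qed.

Definition bil U V W (E : U -> V -> W) : Prop :=
  (forall b, lin (fun a => E a b)) /\ (forall a, lin (E a)).

Lemma bil_bal U V W (E : U -> V -> W) : bil E ->
  balanced (fun (v : U) (a : k) => a *: v) (fun (a : k) (w : V) => a *: w) E.
Proof.
move=> [l r]; split=> [v v' w|v w w'|v a w].
- exact: (linD (l w)).
- exact: (linD (r v)).
- by rewrite (linZ (l w)) (linZ (r v)).
Qed.

(** The sum runs over one fixed representative of t, so linearity holds term by term. In [lin_tsumt]
    the tensor varies, and bilinearity is what makes the representatives comparable. *)
Lemma lin_tsumE (U V : zmodType) R (ra : U -> R -> U) (la : R -> V -> V) W Z (t : tprod ra la) (E : W -> U -> V -> Z) :
  (forall a b, lin (fun x => E x a b)) -> lin (fun x => tsum t (E x)).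
Proof.
move=> l c x y; rewrite /tsum /tsum_seq scaler_sumr -big_split.
by apply: eq_bigr => p _; rewrite /= l.
Qed.

Lemma lin_tsumt U V W Z (t : W -> U \otimes V) (E : U -> V -> Z) :
  lin t -> bil E -> lin (fun x => tsum (t x) E).
Proof.
move=> lt b c x y; rewrite lt.
rewrite [LHS](tsumD _ _ (bil_bal b)); congr (_ + _).
elim/tprod_ind: (t x) => [|v w|s s' IHs IHs'].
- by rewrite scaler0 (tsum0 (bil_bal b)) scaler0.
- rewrite -/(ot v w) -otZl [LHS](tsum_pure _ _ (bil_bal b)).
  by rewrite [in RHS](tsum_pure _ _ (bil_bal b)) (linZ (b.1 w)).
- by rewrite scalerDr [LHS](tsumD _ _ (bil_bal b)) IHs IHs' (tsumD _ _ (bil_bal b)) scalerDr.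
Qed.

Lemma tsum_ot U V Z (a : U) (b : V) (E : U -> V -> Z) : bil E -> tsum (a \ot b) E = E a b.
Proof. by move=> l; apply: (tsum_pure _ _ (bil_bal l)). Qed.

Lemma tsum_ext U V Z Z' (t : U \otimes V) (E : U -> V -> Z) (f : Z -> Z') :
  lin f -> f (tsum t E) = tsum t (fun a b => f (E a b)).
Proof.
move=> l; rewrite /tsum /tsum_seq.
by apply: (big_morph f (linD l) (lin0 l)).
Qed.

Lemma tsum_id U V (t : U \otimes V) : tsum t (fun a b => a \ot b) = t.
Proof. by rewrite [RHS]tprodE. Qed.
End Lin.

Section Lin2.
Variable k : fieldType.
Implicit Types U V W Z : lmodType k.

Lemma lin_otl U V Z (f : U -> V) (b : Z) : lin f -> lin (fun x => f x \ot b).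
Proof. by move=> l a x y; rewrite l otDl otZl. Qed.
Lemma lin_otr U V Z (f : U -> V) (b : Z) : lin f -> lin (fun x => b \ot f x).
Proof. by move=> l a x y; rewrite l otDr otZr. Qed.
Lemma lin_mull U (A : pzAlgebra k) (f : U -> A) (b : A) : lin f -> lin (fun x => f x * b).
Proof. by move=> l a x y; rewrite l mulrDl pzscalerAl. Qed.
Lemma lin_mulr U (A : pzAlgebra k) (f : U -> A) (b : A) : lin f -> lin (fun x => b * f x).
Proof. by move=> l a x y; rewrite l mulrDr pzscalerAr. Qed.
(* The forms [eps] and [epsC] take values in [k^o]; using [*:] on them directly lets
   unification wander between the module structures of [k^o]. *)
Definition ksc V (a : k^o) (v : V) : V := (a : k) *: v.
Lemma lin_kscl U V (f : U -> k^o) (v : V) : lin f -> lin (fun x => ksc (f x) v).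
Proof. by move=> l a x y; rewrite /ksc l scalerDl scalerA. Qed.
Lemma lin_kscr U V (f : U -> V) (c : k^o) : lin f -> lin (fun x => ksc c (f x)).
Proof. by move=> l a x y; rewrite /ksc l scalerDr !scalerA mulrC. Qed.
Lemma lin_scalel U V (f : U -> k^o) (v : V) : lin f -> lin (fun x => (f x : k) *: v).
Proof. by move=> l a x y; rewrite l scalerDl scalerA. Qed.
Lemma lin_scaler U V (f : U -> V) (c : k) : lin f -> lin (fun x => c *: f x).
Proof. by move=> l a x y; rewrite l scalerDr !scalerA mulrC. Qed.

Lemma tsum_exch (U V U' V' : zmodType) R R' (ra : U -> R -> U) (la : R -> V -> V) (ra' : U' -> R' -> U') (la' : R' -> V' -> V') (Z : zmodType) (s : tprod ra la) (t : tprod ra' la')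
   (E : U -> V -> U' -> V' -> Z) :
  tsum s (fun a b => tsum t (fun c d => E a b c d)) = tsum t (fun c d => tsum s (fun a b => E a b c d)).
Proof. exact: exchange_big. Qed.

Lemma eq_tsum2 (U V : zmodType) R (ra : U -> R -> U) (la : R -> V -> V) (Z : zmodType) (E E' : U -> V -> Z) (t : tprod ra la) :
  (forall a b, E a b = E' a b) -> tsum t E = tsum t E'.
Proof. exact: eq_tsum. Qed.

Lemma tsum_congt (U V : zmodType) R (ra : U -> R -> U) (la : R -> V -> V) (Z : zmodType) (E : U -> V -> Z) (t t' : tprod ra la) :
  t = t' -> tsum t E = tsum t' E.
Proof. by move=> ->. Qed.

(** The form in which [swp] uses an exchange of sums: y is the other side of the goal, [front] pulls
    its sum over t outermost, and this determines E'. *)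
Lemma tsum_swp (U V : zmodType) R (ra : U -> R -> U) (la : R -> V -> V) (Z : zmodType) (E E' : U -> V -> Z) (t : tprod ra la) (y : Z) :
  y = tsum t E' -> (forall a b, E a b = E' a b) -> tsum t E = y.
Proof. by move=> -> /eq_tsum2. Qed.

Lemma tsum_tsum U V Z (U' V' : zmodType) R (ra : U' -> R -> U') (la : R -> V' -> V') (s : tprod ra la) (F : U' -> V' -> U \otimes V) (E : U -> V -> Z) :
  bil E -> tsum (tsum s F) E = tsum s (fun a b => tsum (F a b) E).
Proof. move=> b; exact: (tsum_sum _ _ (bil_bal b)). Qed.
End Lin2.

(** * Sums over composite tensors; linearity of the structure maps *)

Section MLin.
Variable k : fieldType.
Implicit Types (U V W X Y T Z : lmodType k).
Definition mlin3 U V W Z (E : U -> V -> W -> Z) : Prop :=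
  [/\ forall b c, lin (fun a => E a b c), forall a c, lin (fun b => E a b c)
    & forall a b, lin (fun c => E a b c)].
Definition mlin4 U V W X Z (E : U -> V -> W -> X -> Z) : Prop :=
  (forall b c d, lin (fun a => E a b c d)) /\ (forall a, mlin3 (E a)).

Definition sw2 U V Z (E : U -> V -> Z) (t : U \otimes V) : Z := tsum t E.
Definition sw3 U V W Z (E : U -> V -> W -> Z) (t : U \otimes (V \otimes W)) : Z :=
  \sw_(a & b & c <- t) E a b c.
Definition sw4 U V W X Z (E : U -> V -> W -> X -> Z) (t : U \otimes (V \otimes (W \otimes X))) : Z :=
  \sw_(a & b & c & d <- t) E a b c d.

Lemma tsum_mul (A B : pzAlgebra k) Z (s t : A \otimes B) (E : A -> B -> Z) : bil E ->
  tsum (s * t) E = tsum s (fun a b => tsum t (fun c d => E (a * c) (b * d))).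
Proof.
move=> bE.
have -> : s * t = \sw_(a & b <- s) \sw_(c & d <- t) (a * c) \ot (b * d) by [].
rewrite tsum_tsum //; apply: eq_tsum2 => a b; rewrite tsum_tsum //; apply: eq_tsum2 => c d.
by rewrite tsum_ot.
Qed.

Lemma tsum_one (A B : pzAlgebra k) Z (E : A -> B -> Z) : bil E ->
  tsum (1 : A \otimes B) E = E 1 1.
Proof. exact: tsum_ot. Qed.

Lemma tsum_idT U V W Z (f : V -> W) (t : U \otimes V) (E : U -> W -> Z) : bil E ->
  tsum (idT f t) E = tsum t (fun a b => E a (f b)).
Proof.
move=> bE; rewrite /idT tsum_tsum //; apply: eq_tsum2 => a b.
by rewrite tsum_ot.
Qed.

Lemma tsum_fT U V1 V2 V Z (f : V -> V1 \otimes V2) (t : V \otimes U)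
   (E : V1 -> V2 \otimes U -> Z) : bil E ->
  tsum (fT f t) E = \sw_(v & w <- t) \sw_(v1 & v2 <- f v) E v1 (v2 \ot w).
Proof.
move=> bE; rewrite /fT tsum_tsum //; apply: eq_tsum2 => a b.
by rewrite tsum_tsum //; apply: eq_tsum2 => c d; rewrite tsum_ot.
Qed.

Lemma tsum_tens1 U V W (A : pzAlgebra k) Z (t : U \otimes (V \otimes W))
   (E : U -> V \otimes (W \otimes A) -> Z) : bil E ->
  tsum (tens1 A t) E = \sw_(u & v & w <- t) E u (v \ot w \ot (1 : A)).
Proof.
move=> bE; rewrite /tens1 tsum_tsum //; apply: eq_tsum2 => a b.
by rewrite tsum_tsum //; apply: eq_tsum2 => c d; rewrite tsum_ot.
Qed.

Variables (H : quasiHopf k).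
Lemma lin_S : lin (@S k H). Proof. exact: S_linear. Qed.
Lemma lin_Sinv : lin (@Sinv k H).
Proof. by move=> a x y; apply: (can_inj (@SK k H)); rewrite lin_S !SinvK. Qed.
Lemma lin_eps : lin (@eps k H). Proof. exact: eps_linear. Qed.
Lemma lin_Delta : lin (@Delta k H). Proof. exact: (Delta_alg H).1. Qed.
Lemma Delta1 : Delta (1 : H) = 1. Proof. exact: (Delta_alg H).2.1. Qed.
Lemma DeltaM (a b : H) : Delta (a * b) = Delta a * Delta b.
Proof. exact: (Delta_alg H).2.2. Qed.
Lemma SinvM (a b : H) : Sinv (a * b) = Sinv b * Sinv a.
Proof. by apply: (can_inj (@SK k H)); rewrite S_antimul !SinvK. Qed.
Lemma Sinv1 : Sinv (1 : H) = 1.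
Proof. by apply: (can_inj (@SK k H)); rewrite S_one !SinvK. Qed.
Lemma eps_Sinv (h : H) : eps (Sinv h) = eps h.
Proof. by rewrite -[in RHS](SinvK h) eps_S. Qed.

Variables (B : pzAlgebra k) (L : leftComoduleAlgebra H B) (R : rightComoduleAlgebra H B).
Lemma lin_lam : lin (lam L). Proof. exact: (lam_alg L).1. Qed.
Lemma lam1 : lam L 1 = 1. Proof. exact: (lam_alg L).2.1. Qed.
Lemma lamM (a b : B) : lam L (a * b) = lam L a * lam L b.
Proof. exact: (lam_alg L).2.2. Qed.
Lemma lin_rho : lin (rho R). Proof. exact: (rho_alg R).1. Qed.
Lemma rho1 : rho R 1 = 1. Proof. exact: (rho_alg R).2.1. Qed.
Lemma rhoM (a b : B) : rho R (a * b) = rho R a * rho R b.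
Proof. exact: (rho_alg R).2.2. Qed.

Variables (C : bimoduleCoalgebra H).
Lemma lin_DeltaC : lin (@DeltaC k H C). Proof. exact: DeltaC_linear. Qed.
Lemma lin_epsC : lin (@epsC k H C). Proof. exact: epsC_linear. Qed.
Lemma lin_lactl U (f : U -> H) (c : C) : lin f -> lin (fun x => f x |>> c).
Proof. by move=> l; apply: (lin_comp (g := fun h => h |>> c)) l; apply: lactC_linearl. Qed.
Lemma lin_lactr U (h : H) (f : U -> C) : lin f -> lin (fun x => h |>> f x).
Proof. by move=> l; apply: (lin_comp (g := fun c => h |>> c)) l; apply: lactC_linearr. Qed.
Lemma lin_ractl U (f : U -> C) (h : H) : lin f -> lin (fun x => f x <<| h).
Proof. by move=> l; apply: (lin_comp (g := fun c => c <<| h)) l; apply: ractC_linearl. Qed.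
Lemma lin_ractr U (f : U -> H) (c : C) : lin f -> lin (fun x => c <<| f x).
Proof. by move=> l; apply: (lin_comp (g := fun h => c <<| h)) l; apply: ractC_linearr. Qed.
End MLin.

(** * Sweedler calculus *)

Create HintDb lindb.
#[global] Hint Resolve lin_S lin_Sinv lin_eps lin_Delta lin_lam lin_rho lin_DeltaC lin_epsC : lindb.

Ltac lin_fun := solve [assumption | auto with lindb nocore].

(* A partially applied hypothesis [mlin3 E], [mlin4 E], ... provides linearity in each slot. *)
Ltac lin_hyp := cbv beta;
  match goal with
  | h : bil _ |- _ => solve [apply h]
  | h : mlin3 _ |- _ => solve [apply h]
  | h : mlin4 _ |- _ => solve [apply h]
  | h : forall _, _ |- _ => solve [apply h]
  end.

Notation "a *:: v" := (ksc a v) (at level 40, left associativity).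

(** Directed by syntax: one slot of each product-like term is expected to contain the variable, and
    the other is recognised as a constant function. *)
Ltac lin_core :=
  cbv beta;
  lazymatch goal with
  | |- forall _, _ => intro; lin_core
  | |- bil _ => split; lin_core
  | |- mlin3 _ => split; lin_core
  | |- mlin4 _ => split; lin_core
  | |- lin (fun x => x) => exact (@lin_id _ _)
  | |- lin (fun x => tsum (@?t x) (@?E x)) =>
      lazymatch t with
      | (fun _ => ?c) => refine (@lin_tsumE _ _ _ _ _ _ _ _ c E _)
      | _ => refine (@lin_tsumt _ _ _ _ _ t _ _ _)
      end; lin_core
  | |- lin (fun x => ot (@?f x) (@?g x)) =>
      lazymatch g with
      | (fun _ => ?c) => refine (@lin_otl _ _ _ _ f c _)
      | _ => refine (@lin_otr _ _ _ _ g _ _)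
      end; lin_core
  | |- lin (fun x => GRing.mul (@?f x) (@?g x)) =>
      lazymatch g with
      | (fun _ => ?c) => refine (@lin_mull _ _ _ f c _)
      | _ => refine (@lin_mulr _ _ _ g _ _)
      end; lin_core
  | |- lin (fun x => ksc (@?f x) (@?g x)) =>
      lazymatch g with
      | (fun _ => ?c) => refine (@lin_kscl _ _ _ f c _)
      | _ => refine (@lin_kscr _ _ _ g _ _)
      end; lin_core
  | |- lin (fun x => GRing.scale (@?f x) (@?g x)) =>
      lazymatch g with
      | (fun _ => ?c) => refine (@lin_scalel _ _ _ f c _)
      | _ => refine (@lin_scaler _ _ _ g _ _)
      end; lin_core
  | |- lin (fun x => lactC (@?f x) (@?g x)) =>
      lazymatch g with
      | (fun _ => ?c) => refine (@lin_lactl _ _ _ _ f c _)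
      | _ => refine (@lin_lactr _ _ _ _ _ g _)
      end; lin_core
  | |- lin (fun x => ractC (@?f x) (@?g x)) =>
      lazymatch g with
      | (fun _ => ?c) => refine (@lin_ractl _ _ _ _ f c _)
      | _ => refine (@lin_ractr _ _ _ _ g _ _)
      end; lin_core
  | |- lin (fun x => _ _) =>
      match goal with
      | |- lin (fun x => ?h (@?a x)) => refine (@lin_comp _ _ _ _ h a _ _)
      | |- lin (fun x => ?h (@?a x) (@?b x)) =>
          lazymatch b with (fun _ => ?b') => refine (@lin_comp _ _ _ _ (fun y => h y b') a _ _) end
      | |- lin (fun x => ?h (@?a x) (@?b x) (@?c x)) =>
          lazymatch b with (fun _ => ?b') => lazymatch c with (fun _ => ?c') =>
          refine (@lin_comp _ _ _ _ (fun y => h y b' c') a _ _) end end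
      | |- lin (fun x => ?h (@?a x) (@?b x) (@?c x) (@?d x)) =>
          lazymatch b with (fun _ => ?b') => lazymatch c with (fun _ => ?c') =>
          lazymatch d with (fun _ => ?d') =>
          refine (@lin_comp _ _ _ _ (fun y => h y b' c' d') a _ _) end end end
      | |- lin (fun x => ?h (@?a x) (@?b x) (@?c x) (@?d x) (@?e x)) =>
          lazymatch b with (fun _ => ?b') => lazymatch c with (fun _ => ?c') =>
          lazymatch d with (fun _ => ?d') => lazymatch e with (fun _ => ?e') =>
          refine (@lin_comp _ _ _ _ (fun y => h y b' c' d' e') a _ _) end end end end
      | |- lin (fun x => ?h (@?a x) (@?b x) (@?c x) (@?d x) (@?e x) (@?f x)) =>
          lazymatch b with (fun _ => ?b') => lazymatch c with (fun _ => ?c') =>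
          lazymatch d with (fun _ => ?d') => lazymatch e with (fun _ => ?e') =>
          lazymatch f with (fun _ => ?f') =>
          refine (@lin_comp _ _ _ _ (fun y => h y b' c' d' e' f') a _ _) end end end end end
      end; [first [lin_fun | lin_hyp] | lin_core]
  | |- lin ?f => first [lin_fun | lin_hyp]
  end.

Definition mults (k : fieldType) (A B : pzAlgebra k) (f : A -> B) := forall a b, f (a * b) = f a * f b.
Definition antimults (k : fieldType) (A B : pzAlgebra k) (f : A -> B) := forall a b, f (a * b) = f b * f a.
Definition unital (k : fieldType) (A B : pzAlgebra k) (f : A -> B) := f 1 = 1.

Ltac leaf_hook := idtac.

Ltac leaf :=
  rewrite ?(mulrA, mul1r, mulr1, scale1r, S_antimul, SinvM, S_one, Sinv1, ractCM, lactCM, lactC1, ractC1, lractC, SinvK, SK);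
  repeat match goal with
  | h : unital _ |- _ => progress rewrite !h ?mul1r ?mulr1
  | h : mults _ |- _ => progress rewrite !h ?mulrA
  | h : antimults _ |- _ => progress rewrite !h ?mulrA
  end; leaf_hook.
(** Only a probe: elaborating it in [lmod_of] makes canonical structure inference find the vector
    space structure on T. *)
Definition lmodule_of (k : pzRingType) (Z : lmodType k) (x : Z) := Z.

Ltac lmod_of T tac :=
  let r := constr:(fun x : T => lmodule_of x) in
  lazymatch r with (fun x => @lmodule_of _ ?Z _) => tac Z end.

(** Hooks redefined once actions and cofree modules are available: [nrm_expand] supplies an equation
    for a tensor that is not decomposed otherwise, and [nrm_hook] tidies a tensor that stays. *)
Ltac nrm_hook t := fail.
Ltac nrm_expand t := fail.

(** Turns sums over composite tensors into nested sums over atomic ones. The right-hand side of the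
    goal is an evar that receives the normal form; [lf] says what to do with the summand. *)
Ltac nrm_in lf Z :=
  cbv beta;
  lazymatch goal with
  | |- tsum ?t ?F = _ =>
    lazymatch t with
    | tsum _ _ => etransitivity; [refine (@tsum_tsum _ _ _ Z _ _ _ _ _ _ _ F _); lin_core | nrm_in lf Z]
    | @ot ?k ?V ?W ?v ?w => etransitivity; [refine (@tsum_ot k V W Z v w F _); lin_core | nrm_in lf Z]
    | @GRing.mul ?R ?s ?t' =>
        etransitivity; [match R with
          | _ ?A ?B => refine (@tsum_mul _ A B Z s t' F _)
          | _ (@pzAlgebra_tens _ ?A ?B) => refine (@tsum_mul _ A B Z s t' F _)
          | _ (_ (@pzAlgebra_tens _ ?A ?B)) => refine (@tsum_mul _ A B Z s t' F _)
          | _ (_ ?A ?B) => refine (@tsum_mul _ A B Z s t' F _) end; lin_core | nrm_in lf Z]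
    | @GRing.one ?R =>
        etransitivity; [match R with
          | _ ?A ?B => refine (@tsum_one _ A B Z F _)
          | _ (@pzAlgebra_tens _ ?A ?B) => refine (@tsum_one _ A B Z F _)
          | _ (_ (@pzAlgebra_tens _ ?A ?B)) => refine (@tsum_one _ A B Z F _)
          | _ (_ ?A ?B) => refine (@tsum_one _ A B Z F _) end; lin_core | nrm_in lf Z]
    | @idT ?k ?U ?V ?W ?f ?s => etransitivity; [refine (@tsum_idT k U V W Z f s F _); lin_core | nrm_in lf Z]
    | @fT ?k ?V ?V1 ?V2 ?W ?f ?s => etransitivity; [refine (@tsum_fT k W V1 V2 V Z f s F _); lin_core | nrm_in lf Z]
    | @tens1 ?k ?U ?V ?W ?A ?s => etransitivity; [refine (@tsum_tens1 k U V W A Z s F _); lin_core | nrm_in lf Z]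
    | @Delta _ _ (@GRing.one _) => etransitivity; [apply tsum_congt; apply Delta1 | nrm_in lf Z]
    | @lam _ _ _ _ (@GRing.one _) => etransitivity; [apply tsum_congt; apply lam1 | nrm_in lf Z]
    | @rho _ _ _ _ (@GRing.one _) => etransitivity; [apply tsum_congt; apply rho1 | nrm_in lf Z]
    | Delta (GRing.mul _ _) => etransitivity; [apply tsum_congt; apply DeltaM | nrm_in lf Z]
    | lam _ (GRing.mul _ _) => etransitivity; [apply tsum_congt; apply lamM | nrm_in lf Z]
    | rho _ (GRing.mul _ _) => etransitivity; [apply tsum_congt; apply rhoM | nrm_in lf Z]
    | _ => tryif (etransitivity; [apply tsum_congt; nrm_expand t|]) then nrm_in lf Z
           else (first [nrm_hook t | idtac]; apply eq_tsum2; intros ? ?; nrm_in lf Z)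
    end
  | |- _ => lf Z
  end.

Ltac no_flat Z := reflexivity.
Ltac nrm := lazymatch goal with |- @eq ?T _ _ => lmod_of T ltac:(nrm_in no_flat) end.

(* also expand products in tensor algebras at the leaves *)
Ltac flat Z :=
  lazymatch goal with
  | |- @GRing.mul ?R ?x ?y = _ =>
      first [etransitivity; [symmetry;
          match R with
          | _ ?A ?B => refine (@tsum_id _ (pz_lmod A) (pz_lmod B) (GRing.mul x y))
          | _ (@pzAlgebra_tens _ ?A ?B) => refine (@tsum_id _ (pz_lmod A) (pz_lmod B) (GRing.mul x y))
          | _ (_ (@pzAlgebra_tens _ ?A ?B)) => refine (@tsum_id _ (pz_lmod A) (pz_lmod B) (GRing.mul x y))
          | _ (_ ?A ?B) => refine (@tsum_id _ (pz_lmod A) (pz_lmod B) (GRing.mul x y))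
          end | nrm_in flat Z]
        | reflexivity]
  | |- _ => reflexivity
  end.
Ltac nrmf := lazymatch goal with |- @eq ?T _ _ => lmod_of T ltac:(nrm_in flat) end.

Ltac front t :=
  lazymatch goal with
  | |- tsum ?s ?F = _ =>
      (constr_eq s t; reflexivity)
      + (etransitivity; [apply eq_tsum2; intros ? ?; cbv beta; front t | cbv beta; apply tsum_exch])
  end.

Ltac swp :=
  cbv beta;
  lazymatch goal with
  | |- tsum ?t ?F = _ =>
      eapply tsum_swp; [front t | cbv beta; intros ? ?; swp]
  | |- _ => leaf; reflexivity
  end.

(* normalise both sides, then permute the summations *)
Ltac sw := etransitivity; [nrm | symmetry; etransitivity; [nrm | once swp]].
Ltac swf := etransitivity; [nrmf | symmetry; etransitivity; [nrmf | once swp]].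

Lemma step_trans (T : Type) (l r x y : T) : l = r -> x = l -> r = y -> x = y.
Proof. by move=> -> -> ->. Qed.

(* [step (apply: rule)] rewrites the left-hand side of a goal with the rule, up to the
   normalisation and the exchange of Sweedler sums done by [sw]; [stepf] also
   expands products in tensor algebras under the sums. *)
Tactic Notation "step" tactic3(tac) :=
  eapply step_trans; [tac; lin_core | sw | cbv beta].
Tactic Notation "stepf" tactic3(tac) :=
  eapply step_trans; [tac; lin_core | swf | cbv beta].

(** * Algebra maps between tensor algebras, and inverses *)

Section Rules.
Variable k : fieldType.
Implicit Types (U V W X Y T Z : lmodType k).

Lemma under2 U V Z (t : U \otimes V) (F G : U -> V -> Z) :
  (forall a b, F a b = G a b) -> \sw_(a & b <- t) F a b = \sw_(a & b <- t) G a b.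
Proof. exact: eq_tsum2. Qed.
Lemma under3 U V W Z (t : U \otimes (V \otimes W)) (F G : U -> V -> W -> Z) :
  (forall a b c, F a b c = G a b c) -> \sw_(a & b & c <- t) F a b c = \sw_(a & b & c <- t) G a b c.
Proof. by move=> e; apply: eq_tsum2 => a bc; apply: eq_tsum2 => b c. Qed.

Lemma idTM (U A B : pzAlgebra k) (f : A -> B) (s t : U \otimes A) :
  alg_map f -> idT f (s * t) = idT f s * idT f t.
Proof.
move=> [lf [f1 fM]]; have lf' : lin f by [].
rewrite -[RHS]tsum_id /idT.
etransitivity; [nrm|symmetry; etransitivity; [nrm|]].
by apply: eq_tsum2 => a b; apply: eq_tsum2 => c d; rewrite fM.
Qed.

Lemma alg_idT (U A B : pzAlgebra k) (f : A -> B) : alg_map f -> alg_map (idT f : U \otimes A -> U \otimes B).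
Proof.
move=> af; have [lf [f1 fM]] := af; have lf' : lin f by [].
split.
  rewrite -/(lin _) /idT; lin_core.
split; first by rewrite /idT [LHS]tsum_one ?f1 //; lin_core.
by move=> s t; apply: idTM.
Qed.

Lemma fTM (U A B C : pzAlgebra k) (f : A -> B \otimes C) (s t : A \otimes U) :
  alg_map f -> fT f (s * t) = fT f s * fT f t.
Proof.
move=> [lf [f1 fM]]; have lf' : lin f by [].
rewrite -[RHS]tsum_id /fT.
etransitivity; [nrm|symmetry; etransitivity; [nrm|]].
etransitivity; last first.
  apply: eq_tsum2 => a b; apply: eq_tsum2 => c d; symmetry.
  rewrite fM; nrm.
apply: eq_tsum2 => a b; rewrite tsum_exch; apply: eq_tsum2 => c d.
apply: eq_tsum2 => e g; apply: eq_tsum2 => e' g'.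
by rewrite otM.
Qed.

Lemma alg_fT (U A B C : pzAlgebra k) (f : A -> B \otimes C) :
  alg_map f -> alg_map (fT f : A \otimes U -> B \otimes (C \otimes U)).
Proof.
move=> af; have [lf [f1 fM]] := af; have lf' : lin f by [].
split.
  by rewrite -/(lin _) /fT; lin_core.
split; last by move=> s t; apply: fTM.
rewrite /fT; etransitivity; first (apply: tsum_one; lin_core).
by rewrite f1 [LHS]tsum_one //; lin_core.
Qed.

Lemma tens1M (U V W A : pzAlgebra k) (s t : U \otimes (V \otimes W)) :
  tens1 A (s * t) = tens1 A s * tens1 A t.
Proof.
rewrite -[RHS]tsum_id /tens1.
etransitivity; [nrm|symmetry; etransitivity; [nrm|]].
apply: eq_tsum2 => a b; etransitivity; last first.
  by apply: eq_tsum2 => c d; apply: tsum_exch.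
rewrite tsum_exch; apply: eq_tsum2 => c d.
rewrite tsum_exch; apply: eq_tsum2 => e g.
apply: eq_tsum2 => e' g'.
by rewrite !otM mulr1.
Qed.

Lemma alg_tens1 (U V W A : pzAlgebra k) :
  alg_map (tens1 A : U \otimes (V \otimes W) -> U \otimes (V \otimes (W \otimes A))).
Proof.
split.
  by rewrite -/(lin _) /tens1; lin_core.
split; last by move=> s t; apply: tens1M.
rewrite /tens1; etransitivity; first (apply: tsum_one; lin_core).
by rewrite [LHS]tsum_one //; lin_core.
Qed.

Lemma alg_1ot (U A : pzAlgebra k) : alg_map (fun t : A => (1 : U) \ot t).
Proof.
split; first by rewrite -/(lin _); lin_core.
by split=> // s t; rewrite otM mulr1.
Qed.

Lemma alg_inv (A B : pzAlgebra k) (f : A -> B) (x y : A) :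
  alg_map f -> inverses x y -> inverses (f x) (f y).
Proof. by move=> [lf [f1 fM]] [xy yx]; split; rewrite -fM ?xy ?yx f1. Qed.

Lemma inv_mvr (R : pzRingType) (a b b' c : R) : inverses b b' -> a * b = c -> a = c * b'.
Proof. by move=> [e _] <-; rewrite -mulrA e mulr1. Qed.
Lemma inv_mvl (R : pzRingType) (a b a' c : R) : inverses a a' -> a * b = c -> b = a' * c.
Proof. by move=> [_ e] <-; rewrite mulrA e mul1r. Qed.
Lemma inv_sym (R : pzRingType) (a b : R) : inverses a b -> inverses b a.
Proof. by case. Qed.
Lemma inv_uniq (R : pzRingType) (a b c : R) : inverses a b -> inverses a c -> b = c.
Proof. by move=> [_ ba] [ac _]; rewrite -[b]mulr1 -ac mulrA ba mul1r. Qed.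

Lemma tsum_mull U V (A : pzAlgebra k) (s : U \otimes V) (E : U -> V -> A) (x : A) :
  tsum s E * x = tsum s (fun a b => E a b * x).
Proof. by refine (@tsum_ext _ _ _ A A s E (fun y => y * x) _); lin_core. Qed.
Lemma tsum_mulr U V (A : pzAlgebra k) (s : U \otimes V) (E : U -> V -> A) (x : A) :
  x * tsum s E = tsum s (fun a b => x * E a b).
Proof. by refine (@tsum_ext _ _ _ A A s E (fun y => x * y) _); lin_core. Qed.

Lemma alg_formT (A B : pzAlgebra k) (e : A -> k^o) : linear e -> monoid_morphism e ->
  alg_map (formT e : A \otimes B -> B).
Proof.
move=> le [e1 eM]; have le' : lin e by [].
split; first by rewrite -/(lin _) /formT; lin_core.
split; first by rewrite /formT [LHS]tsum_one ?e1 ?scale1r //; lin_core.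
move=> s t; rewrite /formT.
etransitivity; first (apply: tsum_mul; lin_core); cbv beta.
rewrite tsum_mull.
apply: eq_tsum2 => a b; rewrite tsum_mulr.
by apply: eq_tsum2 => c d; rewrite eM -pzscalerAl -pzscalerAr scalerA.
Qed.

Lemma alg_idTform (A B : pzAlgebra k) (e : B -> k^o) : linear e -> monoid_morphism e ->
  alg_map (idTform e : A \otimes B -> A).
Proof.
move=> le [e1 eM]; have le' : lin e by [].
split; first by rewrite -/(lin _) /idTform; lin_core.
split; first by rewrite /idTform [LHS]tsum_one ?e1 ?scale1r //; lin_core.
move=> s t; rewrite /idTform.
etransitivity; first (apply: tsum_mul; lin_core); cbv beta.
rewrite tsum_mull.
apply: eq_tsum2 => a b; rewrite tsum_mulr.
by apply: eq_tsum2 => c d; rewrite eM -pzscalerAl -pzscalerAr scalerA.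
Qed.

Lemma alg_one (A B : pzAlgebra k) (f : A -> B) (x y : A) :
  alg_map f -> inverses x y -> f x = 1 -> f y = 1.
Proof.
move=> af /(alg_inv af) [] e _ fx; by rewrite fx mul1r in e.
Qed.

End Rules.

(** * Contraction with the counit *)

Section Counit.
Variables (k : fieldType) (H : quasiHopf k).
Implicit Types (U V W X Z : lmodType k) (A B C : pzAlgebra k).

Lemma tsumZ U V Z (a : k^o) (t : U \otimes V) (F : U -> V -> Z) :
  bil F -> tsum (a *:: t) F = a *:: tsum t F.
Proof. by move=> bF; refine (@linZ k _ Z (fun x : U \otimes V => tsum x F) _ a t); lin_core. Qed.

Lemma tsum_scale U V Z (a : k^o) (t : U \otimes V) (F : U -> V -> Z) :
  tsum t (fun u v => a *:: F u v) = a *:: tsum t F.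
Proof. by rewrite (@tsum_ext k _ _ Z Z t F (fun x => a *:: x)) //; lin_core. Qed.

Lemma eps1_rule B C Z (t : H \otimes (B \otimes C)) (F : B -> C -> Z) :
  formT (@eps k H) t = 1 -> bil F -> \sw_(a & b & c <- t) eps a *:: F b c = F 1 1.
Proof.
move=> t1 bF; transitivity (tsum (formT (@eps k H) t) F).
  rewrite /formT; symmetry; etransitivity; [nrm|].
  by apply: eq_tsum2 => a b; rewrite tsumZ ?tsum_scale.
by rewrite t1; nrm.
Qed.

Lemma eps2_rule A C Z (t : A \otimes (H \otimes C)) (F : A -> C -> Z) :
  idT (formT (@eps k H)) t = 1 -> bil F -> \sw_(a & b & c <- t) eps b *:: F a c = F 1 1.
Proof.
move=> t1 bF; transitivity (tsum (idT (formT (@eps k H)) t) F).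
  symmetry; etransitivity; [nrm|].
  apply: eq_tsum2 => a b; rewrite (@tsum_ext _ _ _ C Z _ _ (F a)); last by lin_core.
  by apply: eq_tsum2 => c d; apply: linZ; lin_core.
by rewrite t1; nrm.
Qed.

Lemma eps3_rule A B Z (t : A \otimes (B \otimes H)) (F : A -> B -> Z) :
  idT (idTform (@eps k H)) t = 1 -> bil F -> \sw_(a & b & c <- t) eps c *:: F a b = F 1 1.
Proof.
move=> t1 bF; transitivity (tsum (idT (idTform (@eps k H)) t) F).
  symmetry; etransitivity; [nrm|].
  apply: eq_tsum2 => a b; rewrite (@tsum_ext _ _ _ B Z _ _ (F a)); last by lin_core.
  by apply: eq_tsum2 => c d; apply: linZ; lin_core.
by rewrite t1; nrm.
Qed.

Lemma formT_rule V W Z (e : V -> k^o) (t : V \otimes W) (F : W -> Z) :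
  lin F -> \sw_(a & b <- t) e a *:: F b = F (formT e t).
Proof.
move=> lF; rewrite /formT (@tsum_ext _ _ _ _ Z _ _ F) //; apply: eq_tsum2 => a b.
by rewrite linZ.
Qed.

Lemma idTform_rule V W Z (e : W -> k^o) (t : V \otimes W) (F : V -> Z) :
  lin F -> \sw_(a & b <- t) e b *:: F a = F (idTform e t).
Proof.
move=> lF; rewrite /idTform (@tsum_ext _ _ _ _ Z _ _ F) //; apply: eq_tsum2 => a b.
by rewrite linZ.
Qed.

Lemma Delta_eps1 Z (h : H) (F : H -> Z) : lin F -> \sw_(a & b <- Delta h) eps a *:: F b = F h.
Proof. by move=> lF; rewrite formT_rule // epsT_Delta. Qed.
Lemma Delta_eps2 Z (h : H) (F : H -> Z) : lin F -> \sw_(a & b <- Delta h) eps b *:: F a = F h.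
Proof. by move=> lF; rewrite idTform_rule // idTeps_Delta. Qed.

Lemma lin_formT V W (e : V -> k^o) : lin e -> lin (formT e : V \otimes W -> W).
Proof. by move=> le; rewrite /formT; lin_core. Qed.
Lemma lin_idTform V W (e : W -> k^o) : lin e -> lin (idTform e : V \otimes W -> V).
Proof. by move=> le; rewrite /idTform; lin_core. Qed.
Lemma lin_idT U V W (f : V -> W) : lin f -> lin (idT f : U \otimes V -> U \otimes W).
Proof. by move=> lf; rewrite /idT; lin_core. Qed.

#[local] Hint Extern 1 (lin (formT _)) => (apply: lin_formT) : lindb.
#[local] Hint Extern 1 (lin (idTform _)) => (apply: lin_idTform) : lindb.
#[local] Hint Extern 1 (lin (idT _)) => (apply: lin_idT) : lindb.

Lemma formT_ot V W (e : V -> k^o) (v : V) (w : W) : lin e -> formT e (v \ot w) = e v *:: w.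
Proof. by move=> le; rewrite /formT tsum_ot //; lin_core. Qed.
Lemma idT_ot U V W (f : V -> W) (u : U) (v : V) : lin f -> idT f (u \ot v) = u \ot f v.
Proof. by move=> lf; rewrite /idT tsum_ot //; lin_core. Qed.

Lemma formT_fT U V W (e : U -> k^o) (f : V -> U \otimes V) (t : V \otimes W) : lin e ->
  (forall v, formT e (f v) = v) -> formT e (fT f t) = t.
Proof.
move=> le ef; rewrite -[RHS]tsum_id {1}/formT; etransitivity; [nrm|].
apply: eq_tsum2 => a b; rewrite -{2}[a]ef.
by rewrite -(@formT_rule _ _ _ _ (f a) (fun x => x \ot b)) //; lin_core.
Qed.

Lemma idT_formT_fT U V W (e : U -> k^o) (f : V -> V \otimes U) (t : V \otimes W) : lin e ->
  (forall v, idTform e (f v) = v) -> idT (formT e) (fT f t) = t.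
Proof.
move=> le ef; rewrite -[RHS]tsum_id /idT; etransitivity; [nrm|].
apply: eq_tsum2 => a b; rewrite -{2}[a]ef.
rewrite -(@idTform_rule _ _ _ _ (f a) (fun x => x \ot b)); last by lin_core.
by apply: eq_tsum2 => c d; rewrite formT_ot ?otZr.
Qed.

Lemma idT_idT U V W X (f : V -> W) (g : W -> X) (t : U \otimes V) : lin g ->
  idT g (idT f t) = idT (fun x => g (f x)) t.
Proof. by move=> lg; rewrite /idT; nrm. Qed.

Lemma eq_idT U V W (f g : V -> W) (t : U \otimes V) : f =1 g -> idT f t = idT g t.
Proof. by move=> e; apply: eq_tsum2 => a b; rewrite e. Qed.

Lemma idT_id U V (t : U \otimes V) : idT (fun x => x) t = t.
Proof. exact: tsum_id. Qed.

Lemma idT_formT_tens1 U V W A (e : V -> k^o) (t : U \otimes (V \otimes W)) : lin e ->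
  idT (formT e) (tens1 A t) = \sw_(a & b & c <- t) e b *:: (a \ot c \ot (1 : A)).
Proof.
move=> le; rewrite /idT; etransitivity; [nrm|].
apply: eq_tsum2 => a b; apply: eq_tsum2 => c d.
by rewrite formT_ot // otZr.
Qed.

Lemma idT_formT_idT U V W X (e : V -> k^o) (f : W -> X) (t : U \otimes (V \otimes W)) : lin e -> lin f ->
  idT (formT e) (idT (idT f) t) = \sw_(a & b & c <- t) e b *:: (a \ot f c).
Proof.
move=> le lf; rewrite idT_idT; last exact: lin_formT.
rewrite {1}/idT; apply: eq_tsum2 => a b; rewrite {1}/formT /idT.
rewrite tsum_idT; last by lin_core.
rewrite (@tsum_ext _ _ _ _ _ b _ (fun x => a \ot x)); last by lin_core.
by apply: eq_tsum2 => c d; rewrite otZr.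
Qed.

Lemma idT2_formT_tens1 U V W A (e : W -> k^o) (t : U \otimes (V \otimes W)) : lin e ->
  idT (idT (formT e)) (tens1 A t) = \sw_(a & b & c <- t) e c *:: (a \ot b \ot (1 : A)).
Proof.
move=> le; rewrite /idT; etransitivity; [nrm|].
apply: eq_tsum2 => a b; apply: eq_tsum2 => c d.
by rewrite tsum_ot ?formT_ot ?otZr //; rewrite /formT; lin_core.
Qed.

Lemma idT2_formT_fT U V V1 V2 W (e : U -> k^o) (f : V -> V1 \otimes V2) (t : V \otimes (U \otimes W)) : lin e -> lin f ->
  idT (idT (formT e)) (fT f t) = \sw_(a & b & c <- t) e b *:: fT f (a \ot c).
Proof.
move=> le lf; rewrite /idT; etransitivity; [nrm|].
apply: eq_tsum2 => a b; transitivity (\sw_(c & d <- b) \sw_(a1 & a2 <- f a) e c *:: (a1 \ot a2 \ot d)).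
  rewrite tsum_exch; apply: eq_tsum2 => a1 a2.
  rewrite tsum_ot; last by lin_core.
  by rewrite (@formT_rule _ _ _ _ b (fun x => a1 \ot a2 \ot x)); last by lin_core.
by apply: eq_tsum2 => c d; rewrite tsum_scale /fT tsum_ot; last by lin_core.
Qed.
End Counit.

#[global] Hint Extern 1 (lin (formT _)) => (apply: lin_formT) : lindb.
#[global] Hint Extern 1 (lin (idTform _)) => (apply: lin_idTform) : lindb.
#[global] Hint Extern 1 (lin (idT _)) => (apply: lin_idT) : lindb.

(** * Counits of the associators *)

Section EpsOne.
Variables (k : fieldType) (H : quasiHopf k).
Local Notation eps := (@eps k H).

Lemma eps_alg_formT (B : pzAlgebra k) : alg_map (formT eps : H \otimes B -> B).
Proof. exact: alg_formT (@eps_linear k H) (@eps_monoid k H). Qed.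
Lemma eps_alg_idTform (B : pzAlgebra k) : alg_map (idTform eps : B \otimes H -> B).
Proof. exact: alg_idTform (@eps_linear k H) (@eps_monoid k H). Qed.

Lemma inv_mulr_eq1 (R : pzRingType) (x x' y : R) : inverses x x' -> x * y = x -> y = 1.
Proof. by move=> [_ e] h; rewrite -[y]mul1r -e -mulrA h. Qed.
Lemma inv_mull_eq1 (R : pzRingType) (x x' y : R) : inverses x x' -> y * x = x -> y = 1.
Proof. by move=> [e _] h; rewrite -[y]mulr1 -e mulrA h. Qed.

Lemma ot1_inj (B C : pzAlgebra k) (y : C) (e : B -> k^o) : linear e -> monoid_morphism e ->
  (1 : B) \ot y = 1 -> y = 1.
Proof.
move=> le [e1 eM] h; have [_ [f1 _]] := alg_formT C le (conj e1 eM).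
by rewrite -f1 -h formT_ot // e1 /ksc scale1r.
Qed.

Lemma eps3_tens1 (A B : pzAlgebra k) (t : A \otimes (B \otimes H)) :
  \sw_(a & b & c <- t) eps c *:: (a \ot b \ot (1 : H)) = 1 -> idT (idTform eps) t = 1.
Proof.
have le : lin eps by exact: lin_eps.
move=> h; have <- : idT (idTform eps) (1 : A \otimes (B \otimes H)) = 1.
  by case: (alg_idT A (eps_alg_idTform B)) => _ [].
rewrite -h /idT; symmetry; etransitivity; [nrm|].
apply: eq_tsum2 => a b; rewrite /idTform (@tsum_ext _ _ _ _ _ _ _ (fun x => a \ot x)); last by lin_core.
apply: eq_tsum2 => c d; rewrite tsumZ; last by lin_core.
rewrite tsum_ot; last by lin_core.
by rewrite tsum_ot ?(eps_monoid H).1 ?scale1r ?otZr //; lin_core.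
Qed.

(** Only the middle counit of Phi is an axiom. Applying eps to the second factor of the cocycle
    identity turns three of its five terms into known ones and leaves (1 (x) (eps (x) id (x)
    id)(Phi)) Phi = Phi, where Phi cancels. *)
Lemma Phi_eps1 : formT eps (Phi H) = 1.
Proof.
have le : lin eps by exact: lin_eps.
have psi := congr1 (idT (formT eps)) (Phi_cocycle H).
have pM (s t : H \otimes (H \otimes (H \otimes H))) :
    idT (formT eps) (s * t) = idT (formT eps) s * idT (formT eps) t.
  by apply: idTM (eps_alg_formT _).
rewrite !pM in psi.
rewrite (idT_ot (f := formT eps)) in psi; last exact: lin_formT.
rewrite idT_idT in psi; last exact: lin_formT.
rewrite (eq_idT (g := id)) ?idT_id in psi; last first.
  by move=> x; apply: formT_fT => // v; apply: epsT_Delta.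
rewrite idT_formT_tens1 // in psi.
rewrite (idT_formT_idT _ le (@lin_Delta k H)) in psi.
rewrite idT_formT_fT // in psi; last by apply: idTeps_Delta.
rewrite (@eps2_rule _ H H H _ _ (fun a c => a \ot c \ot (1 : H)) (Phi_eps H)) in psi; last by lin_core.
rewrite (@eps2_rule _ H H H _ _ (fun a c => a \ot Delta c) (Phi_eps H)) ?Delta1 in psi; last by lin_core.
rewrite -/(1 : H \otimes (H \otimes H)) mulr1 mul1r in psi.
exact: ot1_inj (@eps_linear k H) (@eps_monoid k H) (inv_mull_eq1 (PhiV H) psi).
Qed.

(** As for [Phi_eps1], with eps applied to the third factor; the unknown term now stands on the
    right of Phi. *)
Lemma Phi_eps3 : idT (idTform eps) (Phi H) = 1.
Proof.
have le : lin eps by exact: lin_eps.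
have psi := congr1 (idT (idT (formT eps))) (Phi_cocycle H).
have pM (s t : H \otimes (H \otimes (H \otimes H))) :
    idT (idT (formT eps)) (s * t) = idT (idT (formT eps)) s * idT (idT (formT eps)) t.
  by apply: idTM (alg_idT _ (eps_alg_formT _)).
rewrite !pM in psi.
rewrite (idT_ot (f := idT (formT eps))) in psi; last by apply: lin_idT; exact: lin_formT.
rewrite Phi_eps mul1r in psi.
rewrite !idT_idT in psi; try by [apply: lin_idT; exact: lin_formT | exact: lin_formT].
rewrite (eq_idT (g := id)) ?idT_id in psi; last first.
  by move=> x; apply: idT_formT_fT => // v; apply: idTeps_Delta.
rewrite (eq_idT (f := fun x => idT (formT eps) (idT (@Delta k H) x)) (g := id)) ?idT_id in psi; last first.
  move=> x; rewrite idT_idT; last exact: lin_formT.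
  by rewrite (eq_idT (g := id)) ?idT_id // => v; apply: epsT_Delta.
rewrite idT2_formT_tens1 // (idT2_formT_fT _ le (@lin_Delta k H)) in psi.
rewrite (@eps2_rule _ H H H _ _ (fun a c => fT (@Delta k H) (a \ot c)) (Phi_eps H)) in psi; last first.
  by rewrite /fT; lin_core.
rewrite -[in RHS](otone H H) (alg_fT H (Delta_alg H)).2.1 mulr1 in psi.
have {}psi := inv_mulr_eq1 (PhiV H) psi.
exact: eps3_tens1 psi.
Qed.

Lemma Phi_inv_eps1 : formT eps (Phi_inv H) = 1.
Proof. exact: alg_one (eps_alg_formT _) (PhiV H) Phi_eps1. Qed.
Lemma Phi_inv_eps2 : idT (formT eps) (Phi_inv H) = 1.
Proof. exact: alg_one (alg_idT H (eps_alg_formT H)) (PhiV H) (Phi_eps H). Qed.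
Lemma Phi_inv_eps3 : idT (idTform eps) (Phi_inv H) = 1.
Proof. exact: alg_one (alg_idT H (eps_alg_idTform H)) (PhiV H) Phi_eps3. Qed.

Section Left.
Variables (B : pzAlgebra k) (L : leftComoduleAlgebra H B).
Lemma Phil_inv_eps1 : formT eps (Phil_inv L) = 1.
Proof. exact: alg_one (eps_alg_formT _) (PhilV L) (Phil_eps1 L). Qed.
Lemma Phil_inv_eps2 : idT (formT eps) (Phil_inv L) = 1.
Proof. exact: alg_one (alg_idT H (eps_alg_formT B)) (PhilV L) (Phil_eps2 L). Qed.
End Left.

Section Right.
Variables (B : pzAlgebra k) (R : rightComoduleAlgebra H B).
Lemma Phir_inv_eps2 : idT (formT eps) (Phir_inv R) = 1.
Proof. exact: alg_one (alg_idT B (eps_alg_formT H)) (PhirV R) (Phir_eps2 R). Qed.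
Lemma Phir_inv_eps3 : idT (idTform eps) (Phir_inv R) = 1.
Proof. exact: alg_one (alg_idT B (eps_alg_idTform H)) (PhirV R) (Phir_eps3 R). Qed.
End Right.

Section Bi.
Variable A : bicomoduleAlgebra H.

(** Applying eps to the second factor of the left mixed cocycle identity trivialises both copies of
    Phi_lambda and leaves (1 (x) (eps (x) id (x) id)(Theta)) Theta = Theta. *)
Lemma Philr_eps1 : formT eps (Philr A) = 1.
Proof.
have le : lin eps by exact: lin_eps.
have psi := congr1 (idT (formT eps)) (Philr_cocyclel A).
have pM (s t : H \otimes (H \otimes (A \otimes H))) :
    idT (formT eps) (s * t) = idT (formT eps) s * idT (formT eps) t.
  by apply: idTM (eps_alg_formT _).
rewrite !pM in psi.
rewrite (idT_ot (f := formT eps)) in psi; last exact: lin_formT.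
rewrite idT_idT in psi; last exact: lin_formT.
rewrite (eq_idT (g := id)) ?idT_id in psi; last first.
  by move=> x; apply: formT_fT => // v; apply: lam_eps.
rewrite idT_formT_tens1 // in psi.
rewrite (idT_formT_idT _ le (@lin_rho k H A A)) in psi.
rewrite idT_formT_fT // in psi; last by apply: idTeps_Delta.
rewrite (@eps2_rule _ H H A _ _ (fun a c => a \ot c \ot (1 : H)) (Phil_eps2 A)) in psi; last by lin_core.
rewrite (@eps2_rule _ H H A _ _ (fun a c => a \ot rho A c) (Phil_eps2 A)) ?rho1 in psi; last by lin_core.
rewrite -/(1 : H \otimes (A \otimes H)) mulr1 mul1r in psi.
exact: ot1_inj (@eps_linear k H) (@eps_monoid k H) (inv_mull_eq1 (PhilrV A) psi).
Qed.

(** Same argument with the right mixed cocycle identity and eps on the third factor. *)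
Lemma Philr_eps3 : idT (idTform eps) (Philr A) = 1.
Proof.
have le : lin eps by exact: lin_eps.
have psi := congr1 (idT (idT (formT eps))) (Philr_cocycler A).
have pM (s t : H \otimes (A \otimes (H \otimes H))) :
    idT (idT (formT eps)) (s * t) = idT (idT (formT eps)) s * idT (idT (formT eps)) t.
  by apply: idTM (alg_idT _ (eps_alg_formT _)).
rewrite !pM in psi.
rewrite (idT_ot (f := idT (formT eps))) in psi; last by apply: lin_idT; exact: lin_formT.
rewrite (Phir_eps2 A) mul1r in psi.
rewrite !idT_idT in psi; try by [apply: lin_idT; exact: lin_formT | exact: lin_formT].
rewrite (eq_idT (g := id)) ?idT_id in psi; last first.
  by move=> x; apply: idT_formT_fT => // v; apply: rho_eps.
rewrite (eq_idT (f := fun x => idT (formT eps) (idT (@Delta k H) x)) (g := id)) ?idT_id in psi; last first.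
  move=> x; rewrite idT_idT; last exact: lin_formT.
  by rewrite (eq_idT (g := id)) ?idT_id // => v; apply: epsT_Delta.
rewrite idT2_formT_tens1 // (idT2_formT_fT _ le (@lin_lam k H A A)) in psi.
rewrite (@eps2_rule _ H A H _ _ (fun a c => fT (lam A) (a \ot c)) (Phir_eps2 A)) in psi; last first.
  by rewrite /fT; lin_core.
rewrite -[in RHS](otone A H) (alg_fT H (lam_alg A)).2.1 mulr1 in psi.
have {}psi := inv_mulr_eq1 (PhilrV A) psi.
exact: eps3_tens1 psi.
Qed.

Lemma Philr_inv_eps1 : formT eps (Philr_inv A) = 1.
Proof. exact: alg_one (eps_alg_formT _) (PhilrV A) Philr_eps1. Qed.
Lemma Philr_inv_eps3 : idT (idTform eps) (Philr_inv A) = 1.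
Proof. exact: alg_one (alg_idT H (eps_alg_idTform A)) (PhilrV A) Philr_eps3. Qed.
End Bi.
End EpsOne.

(** * Cocycle identities *)

Section PentagonForms.
Variables (R : pzRingType) (O M T P L O' M' T' P' L' : R).
Hypothesis h : [/\ inverses O O', inverses M M', inverses T T', inverses P P' & inverses L L'].
(** O, M, T, P, L stand for the images of an associator under 1 (x) -, id (x) Delta (x) id, - (x) 1,
    id (x) id (x) Delta and Delta (x) id (x) id, or for their analogues in a comodule or bicomodule
    algebra. Since all five are invertible, the pentagon can be rearranged once and for all in an
    arbitrary ring. *)
Hypothesis e : O * M * T = P * L.
Let hO : inverses O O'. Proof. by case: h. Qed.
Let hM : inverses M M'. Proof. by case: h. Qed.
Let hT : inverses T T'. Proof. by case: h. Qed.
Let hP : inverses P P'. Proof. by case: h. Qed.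
Let hL : inverses L L'. Proof. by case: h. Qed.

Lemma pent_TL' : T * L' = M' * O' * P.
Proof.
have h1 := inv_mvl hO (etrans (mulrA _ _ _) e).
have h2 := inv_mvl hM h1.
by rewrite h2 !mulrA -[_ * L * L']mulrA hL.1 mulr1.
Qed.
Lemma pent_inv : T' * M' * O' = L' * P'.
Proof.
apply: (inv_uniq (a := P * L)).
  rewrite -e; split; rewrite !mulrA.
    by rewrite -(mulrA _ T T') hT.1 mulr1 -(mulrA _ M M') hM.1 mulr1 hO.1.
  by rewrite -(mulrA _ O' O) hO.2 mulr1 -(mulrA _ M' M) hM.2 mulr1 hT.2.
split; rewrite !mulrA.
  by rewrite -(mulrA _ L L') hL.1 mulr1 hP.1.
by rewrite -(mulrA _ P' P) hP.2 mulr1 hL.2.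
Qed.
Lemma pent_P'O : P' * O = L * T' * M'.
Proof.
have h1 : O * M = P * L * T' := inv_mvr hT e.
have h2 : O = P * L * T' * M' := inv_mvr hM h1.
by rewrite h2 !mulrA hP.2 mul1r.
Qed.
Lemma pent_LT' : L * T' = P' * O * M.
Proof.
have h1 : O * M = P * L * T' := inv_mvr hT e.
by rewrite -mulrA h1 !mulrA hP.2 mul1r.
Qed.
Lemma pent_O'P : O' * P = M * T * L'.
Proof.
have h1 : P = O * M * T * L' := inv_mvr hL (esym e).
by rewrite h1 !mulrA hO.2 mul1r.
Qed.
Lemma pent_MT : M * T = O' * P * L.
Proof. by rewrite -mulrA -e !mulrA hO.2 mul1r. Qed.
End PentagonForms.

(* An identity between tensors is turned into an identity between the Sweedler
   sums of an arbitrary multilinear map over both of its sides, so that it can be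
   applied to some of the factors of a larger expression. *)
Tactic Notation "cps" constr(E) constr(e) :=
  let h := fresh in
  have h := congr1 E e; rewrite /sw4 /sw3 /sw2 in h;
  match type of h with ?l = ?r => transitivity l; [|transitivity r; [exact h|]] end; clear h; sw.

Section HRules.
Variables (k : fieldType) (H : quasiHopf k).
Implicit Types Z : lmodType k.

Let aD := Delta_alg H.
Let hs := And5 (alg_inv (alg_1ot H (pzAlgebra_tens H (pzAlgebra_tens H H))) (PhiV H))
  (alg_inv (alg_idT H (alg_fT H aD)) (PhiV H)) (alg_inv (alg_tens1 H H H H) (PhiV H))
  (alg_inv (alg_idT H (alg_idT H aD)) (PhiV H)) (alg_inv (alg_fT (pzAlgebra_tens H H) aD) (PhiV H)).
Let pe := Phi_cocycle H.

Variables (Z : lmodType k) (E : H -> H -> H -> H -> Z).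
Hypothesis lE : mlin4 E.

Lemma Phi_TL' :
  \sw_(X1 & X2 & X3 <- Phi H) \sw_(x1 & x2 & x3 <- Phi_inv H) \sw_(a & b <- Delta x1)
    E (X1 * a) (X2 * b) (X3 * x2) x3 =
  \sw_(x1 & x2 & x3 <- Phi_inv H) \sw_(a & b <- Delta x2)
  \sw_(y1 & y2 & y3 <- Phi_inv H) \sw_(X1 & X2 & X3 <- Phi H) \sw_(c & d <- Delta X3)
    E (x1 * X1) (a * y1 * X2) (b * y2 * c) (x3 * y3 * d).
Proof. cps (sw4 E) (pent_TL' hs pe). Qed.

Lemma Phi_pent_inv :
  \sw_(x1 & x2 & x3 <- Phi_inv H) \sw_(y1 & y2 & y3 <- Phi_inv H) \sw_(a & b <- Delta y2)
  \sw_(z1 & z2 & z3 <- Phi_inv H)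
    E (x1 * y1) (x2 * a * z1) (x3 * b * z2) (y3 * z3) =
  \sw_(x1 & x2 & x3 <- Phi_inv H) \sw_(a & b <- Delta x1)
  \sw_(y1 & y2 & y3 <- Phi_inv H) \sw_(c & d <- Delta y3)
    E (a * y1) (b * y2) (x2 * c) (x3 * d).
Proof. cps (sw4 E) (pent_inv hs pe). Qed.

Lemma Phi_P'O :
  \sw_(x1 & x2 & x3 <- Phi_inv H) \sw_(c & d <- Delta x3) \sw_(X1 & X2 & X3 <- Phi H)
    E x1 (x2 * X1) (c * X2) (d * X3) =
  \sw_(X1 & X2 & X3 <- Phi H) \sw_(a & b <- Delta X1) \sw_(x1 & x2 & x3 <- Phi_inv H)
  \sw_(y1 & y2 & y3 <- Phi_inv H) \sw_(c & d <- Delta y2)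
    E (a * x1 * y1) (b * x2 * c) (X2 * x3 * d) (X3 * y3).
Proof. cps (sw4 E) (pent_P'O hs pe). Qed.

Lemma Phi_LT' :
  \sw_(X1 & X2 & X3 <- Phi H) \sw_(a & b <- Delta X1) \sw_(x1 & x2 & x3 <- Phi_inv H)
    E (a * x1) (b * x2) (X2 * x3) X3 =
  \sw_(x1 & x2 & x3 <- Phi_inv H) \sw_(c & d <- Delta x3) \sw_(X1 & X2 & X3 <- Phi H)
  \sw_(Y1 & Y2 & Y3 <- Phi H) \sw_(a & b <- Delta Y2)
    E (x1 * Y1) (x2 * X1 * a) (c * X2 * b) (d * X3 * Y3).
Proof. cps (sw4 E) (pent_LT' hs pe). Qed.

Lemma Phi_O'P :
  \sw_(x1 & x2 & x3 <- Phi_inv H) \sw_(X1 & X2 & X3 <- Phi H) \sw_(c & d <- Delta X3)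
    E X1 (x1 * X2) (x2 * c) (x3 * d) =
  \sw_(X1 & X2 & X3 <- Phi H) \sw_(a & b <- Delta X2) \sw_(Y1 & Y2 & Y3 <- Phi H)
  \sw_(x1 & x2 & x3 <- Phi_inv H) \sw_(c & d <- Delta x1)
    E (X1 * Y1 * c) (a * Y2 * d) (b * Y3 * x2) (X3 * x3).
Proof. cps (sw4 E) (pent_O'P hs pe). Qed.

Lemma Phi_pent :
  \sw_(X1 & X2 & X3 <- Phi H) \sw_(Y1 & Y2 & Y3 <- Phi H) \sw_(a & b <- Delta Y2)
  \sw_(Z1 & Z2 & Z3 <- Phi H)
    E (Y1 * Z1) (X1 * a * Z2) (X2 * b * Z3) (X3 * Y3) =
  \sw_(X1 & X2 & X3 <- Phi H) \sw_(c & d <- Delta X3)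
  \sw_(Y1 & Y2 & Y3 <- Phi H) \sw_(a & b <- Delta Y1)
    E (X1 * a) (X2 * b) (c * Y2) (d * Y3).
Proof. cps (sw4 E) pe. Qed.
End HRules.

Section Coassoc.
Variables (k : fieldType) (H : quasiHopf k).
Variables (Z : lmodType k) (E : H -> H -> H -> Z).
Hypothesis lE : mlin3 E.

Lemma coassoc_Phi (h : H) :
  \sw_(h1 & h2 <- Delta h) \sw_(a & b <- Delta h2) \sw_(X1 & X2 & X3 <- Phi H)
    E (h1 * X1) (a * X2) (b * X3) =
  \sw_(X1 & X2 & X3 <- Phi H) \sw_(h1 & h2 <- Delta h) \sw_(a & b <- Delta h1)
    E (X1 * a) (X2 * b) (X3 * h2).
Proof. cps (sw3 E) (esym (inv_mvr (inv_sym (PhiV H)) (esym (Delta_coassoc h)))). Qed.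

Lemma coassoc_Phi_inv (h : H) :
  \sw_(x1 & x2 & x3 <- Phi_inv H) \sw_(h1 & h2 <- Delta h) \sw_(a & b <- Delta h2)
    E (x1 * h1) (x2 * a) (x3 * b) =
  \sw_(h1 & h2 <- Delta h) \sw_(a & b <- Delta h1) \sw_(x1 & x2 & x3 <- Phi_inv H)
    E (a * x1) (b * x2) (h2 * x3).
Proof.
cps (sw3 E) (esym (inv_mvl (PhiV H) (etrans (mulrA _ _ _) (esym (Delta_coassoc h))))).
Qed.
End Coassoc.

Section LeftRules.
Variables (k : fieldType) (H : quasiHopf k) (B : pzAlgebra k) (L : leftComoduleAlgebra H B).
Local Notation D := (@Delta k H).

Let aD := Delta_alg H.
Let hs := And5 (alg_inv (alg_1ot H (pzAlgebra_tens H (pzAlgebra_tens H B))) (PhilV L))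
  (alg_inv (alg_idT H (alg_fT B aD)) (PhilV L)) (alg_inv (alg_tens1 H H H B) (PhiV H))
  (alg_inv (alg_idT H (alg_idT H (lam_alg L))) (PhilV L))
  (alg_inv (alg_fT (pzAlgebra_tens H B) aD) (PhilV L)).
Let pe := Phil_cocycle L.

Section R4.
Variables (Z : lmodType k) (E : H -> H -> H -> B -> Z).
Hypothesis lE : mlin4 E.

Lemma Phil_P'O :
  \sw_(x1 & x2 & x3 <- Phil_inv L) \sw_(c & d <- lam L x3) \sw_(X1 & X2 & X3 <- Phil L)
    E x1 (x2 * X1) (c * X2) (d * X3) =
  \sw_(X1 & X2 & X3 <- Phil L) \sw_(a & b <- Delta X1) \sw_(x1 & x2 & x3 <- Phi_inv H)
  \sw_(y1 & y2 & y3 <- Phil_inv L) \sw_(c & d <- Delta y2)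
    E (a * x1 * y1) (b * x2 * c) (X2 * x3 * d) (X3 * y3).
Proof. cps (sw4 E) (pent_P'O hs pe). Qed.

Lemma Phil_O'P :
  \sw_(x1 & x2 & x3 <- Phil_inv L) \sw_(X1 & X2 & X3 <- Phil L) \sw_(c & d <- lam L X3)
    E X1 (x1 * X2) (x2 * c) (x3 * d) =
  \sw_(X1 & X2 & X3 <- Phil L) \sw_(a & b <- Delta X2) \sw_(Y1 & Y2 & Y3 <- Phi H)
  \sw_(x1 & x2 & x3 <- Phil_inv L) \sw_(c & d <- Delta x1)
    E (X1 * Y1 * c) (a * Y2 * d) (b * Y3 * x2) (X3 * x3).
Proof. cps (sw4 E) (pent_O'P hs pe). Qed.

Lemma Phil_pent :
  \sw_(X1 & X2 & X3 <- Phil L) \sw_(Y1 & Y2 & Y3 <- Phil L) \sw_(a & b <- Delta Y2)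
  \sw_(Z1 & Z2 & Z3 <- Phi H)
    E (Y1 * Z1) (X1 * a * Z2) (X2 * b * Z3) (X3 * Y3) =
  \sw_(X1 & X2 & X3 <- Phil L) \sw_(c & d <- lam L X3)
  \sw_(Y1 & Y2 & Y3 <- Phil L) \sw_(a & b <- Delta Y1)
    E (X1 * a) (X2 * b) (c * Y2) (d * Y3).
Proof. cps (sw4 E) pe. Qed.

Lemma Phil_MT :
  \sw_(Y1 & Y2 & Y3 <- Phil L) \sw_(a & b <- Delta Y2) \sw_(Z1 & Z2 & Z3 <- Phi H)
    E (Y1 * Z1) (a * Z2) (b * Z3) Y3 =
  \sw_(x1 & x2 & x3 <- Phil_inv L) \sw_(X1 & X2 & X3 <- Phil L) \sw_(c & d <- lam L X3)
  \sw_(Y1 & Y2 & Y3 <- Phil L) \sw_(a & b <- Delta Y1)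
    E (X1 * a) (x1 * X2 * b) (x2 * c * Y2) (x3 * d * Y3).
Proof. cps (sw4 E) (pent_MT hs pe). Qed.

Lemma Phil_pent_inv :
  \sw_(x1 & x2 & x3 <- Phi_inv H) \sw_(y1 & y2 & y3 <- Phil_inv L) \sw_(a & b <- Delta y2)
  \sw_(z1 & z2 & z3 <- Phil_inv L)
    E (x1 * y1) (x2 * a * z1) (x3 * b * z2) (y3 * z3) =
  \sw_(x1 & x2 & x3 <- Phil_inv L) \sw_(a & b <- Delta x1)
  \sw_(y1 & y2 & y3 <- Phil_inv L) \sw_(c & d <- lam L y3)
    E (a * y1) (b * y2) (x2 * c) (x3 * d).
Proof. cps (sw4 E) (pent_inv hs pe). Qed.
End R4.

Section R3.
Variables (Z : lmodType k) (E : H -> H -> B -> Z).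
Hypothesis lE : mlin3 E.
Lemma lam_Phil (u : B) :
  \sw_(v & w <- lam L u) \sw_(a & b <- lam L w) \sw_(X1 & X2 & X3 <- Phil L)
    E (v * X1) (a * X2) (b * X3) =
  \sw_(X1 & X2 & X3 <- Phil L) \sw_(v & w <- lam L u) \sw_(a & b <- Delta v)
    E (X1 * a) (X2 * b) (X3 * w).
Proof. cps (sw3 E) (lam_coassoc L u). Qed.

Lemma lam_Phil_inv (u : B) :
  \sw_(x1 & x2 & x3 <- Phil_inv L) \sw_(v & w <- lam L u) \sw_(a & b <- lam L w)
    E (x1 * v) (x2 * a) (x3 * b) =
  \sw_(v & w <- lam L u) \sw_(a & b <- Delta v) \sw_(x1 & x2 & x3 <- Phil_inv L)
    E (a * x1) (b * x2) (w * x3).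
Proof.
have e : Phil_inv L * idT (lam L) (lam L u) = fT D (lam L u) * Phil_inv L.
  apply: (inv_mvr (PhilV L)); rewrite -mulrA lam_coassoc mulrA.
  by rewrite (PhilV L).2 mul1r.
cps (sw3 E) e.
Qed.
End R3.
End LeftRules.

Section RightRules.
Variables (k : fieldType) (H : quasiHopf k) (B : pzAlgebra k) (R : rightComoduleAlgebra H B).
Local Notation D := (@Delta k H).

Let aD := Delta_alg H.
Let hs := And5 (alg_inv (alg_1ot B (pzAlgebra_tens H (pzAlgebra_tens H H))) (PhiV H))
  (alg_inv (alg_idT B (alg_fT H aD)) (PhirV R)) (alg_inv (alg_tens1 B H H H) (PhirV R))
  (alg_inv (alg_idT B (alg_idT H aD)) (PhirV R))
  (alg_inv (alg_fT (pzAlgebra_tens H H) (rho_alg R)) (PhirV R)).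
Let pe := Phir_cocycle R.

Lemma Phir_pent_inv (Z : lmodType k) (E : B -> H -> H -> H -> Z) : mlin4 E ->
  \sw_(x1 & x2 & x3 <- Phir_inv R) \sw_(y1 & y2 & y3 <- Phir_inv R) \sw_(a & b <- Delta y2)
  \sw_(z1 & z2 & z3 <- Phi_inv H)
    E (x1 * y1) (x2 * a * z1) (x3 * b * z2) (y3 * z3) =
  \sw_(x1 & x2 & x3 <- Phir_inv R) \sw_(a & b <- rho R x1)
  \sw_(y1 & y2 & y3 <- Phir_inv R) \sw_(c & d <- Delta y3)
    E (a * y1) (b * y2) (x2 * c) (x3 * d).
Proof. move=> lE; cps (sw4 E) (pent_inv hs pe). Qed.

Lemma rho_Phir_inv (Z : lmodType k) (E : B -> H -> H -> Z) (u : B) : mlin3 E ->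
  \sw_(v & w <- rho R u) \sw_(a & b <- rho R v) \sw_(x1 & x2 & x3 <- Phir_inv R)
    E (a * x1) (b * x2) (w * x3) =
  \sw_(x1 & x2 & x3 <- Phir_inv R) \sw_(v & w <- rho R u) \sw_(a & b <- Delta w)
    E (x1 * v) (x2 * a) (x3 * b).
Proof.
move=> lE.
have e : fT (rho R) (rho R u) * Phir_inv R = Phir_inv R * idT D (rho R u).
  apply: (inv_mvl (PhirV R)); rewrite mulrA rho_coassoc -mulrA.
  by rewrite (PhirV R).1 mulr1.
cps (sw3 E) e.
Qed.
End RightRules.

Section BiRules.
Variables (k : fieldType) (H : quasiHopf k) (A : bicomoduleAlgebra H).
Let aD := Delta_alg H.
Let aH := qb_alg H.
Let aA := bca_alg A.

Let hl := And5 (alg_inv (alg_1ot aH (pzAlgebra_tens aH (pzAlgebra_tens aA aH))) (PhilrV A))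
  (alg_inv (alg_idT aH (alg_fT aH (lam_alg A))) (PhilrV A)) (alg_inv (alg_tens1 aH aH aA aH) (PhilV A))
  (alg_inv (alg_idT aH (alg_idT aH (rho_alg A))) (PhilV A))
  (alg_inv (alg_fT (pzAlgebra_tens aA aH) aD) (PhilrV A)).
Let hr := And5 (alg_inv (alg_1ot aH (pzAlgebra_tens aA (pzAlgebra_tens aH aH))) (PhirV A))
  (alg_inv (alg_idT aH (alg_fT aH (rho_alg A))) (PhilrV A)) (alg_inv (alg_tens1 aH aA aH aH) (PhilrV A))
  (alg_inv (alg_idT aH (alg_idT aA aD)) (PhilrV A))
  (alg_inv (alg_fT (pzAlgebra_tens aH aH) (lam_alg A)) (PhirV A)).

Lemma Philr_pentl (Z : lmodType k) (E : H -> H -> A -> H -> Z) : mlin4 E ->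
  \sw_(X1 & X2 & X3 <- Philr A) \sw_(Y1 & Y2 & Y3 <- Philr A) \sw_(a & b <- lam A Y2)
  \sw_(Z1 & Z2 & Z3 <- Phil A)
    E (Y1 * Z1) (X1 * a * Z2) (X2 * b * Z3) (X3 * Y3) =
  \sw_(X1 & X2 & X3 <- Phil A) \sw_(c & d <- rho A X3)
  \sw_(Y1 & Y2 & Y3 <- Philr A) \sw_(a & b <- Delta Y1)
    E (X1 * a) (X2 * b) (c * Y2) (d * Y3).
Proof. move=> lE; cps (sw4 E) (Philr_cocyclel A). Qed.

Lemma Philr_pentl_inv (Z : lmodType k) (E : H -> H -> A -> H -> Z) : mlin4 E ->
  \sw_(x1 & x2 & x3 <- Phil_inv A) \sw_(y1 & y2 & y3 <- Philr_inv A) \sw_(a & b <- lam A y2)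
  \sw_(z1 & z2 & z3 <- Philr_inv A)
    E (x1 * y1) (x2 * a * z1) (x3 * b * z2) (y3 * z3) =
  \sw_(x1 & x2 & x3 <- Philr_inv A) \sw_(a & b <- Delta x1)
  \sw_(y1 & y2 & y3 <- Phil_inv A) \sw_(c & d <- rho A y3)
    E (a * y1) (b * y2) (x2 * c) (x3 * d).
Proof. move=> lE; cps (sw4 E) (pent_inv hl (Philr_cocyclel A)). Qed.

Lemma Philr_pentr_inv (Z : lmodType k) (E : H -> A -> H -> H -> Z) : mlin4 E ->
  \sw_(x1 & x2 & x3 <- Philr_inv A) \sw_(y1 & y2 & y3 <- Philr_inv A) \sw_(a & b <- rho A y2)
  \sw_(z1 & z2 & z3 <- Phir_inv A)
    E (x1 * y1) (x2 * a * z1) (x3 * b * z2) (y3 * z3) =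
  \sw_(x1 & x2 & x3 <- Phir_inv A) \sw_(a & b <- lam A x1)
  \sw_(y1 & y2 & y3 <- Philr_inv A) \sw_(c & d <- Delta y3)
    E (a * y1) (b * y2) (x2 * c) (x3 * d).
Proof. move=> lE; cps (sw4 E) (pent_inv hr (Philr_cocycler A)). Qed.

Lemma lam_rho_Philr_inv (Z : lmodType k) (E : H -> A -> H -> Z) (u : A) : mlin3 E ->
  \sw_(x1 & x2 & x3 <- Philr_inv A) \sw_(v & w <- lam A u) \sw_(a & b <- rho A w)
    E (x1 * v) (x2 * a) (x3 * b) =
  \sw_(v & w <- rho A u) \sw_(a & b <- lam A v) \sw_(x1 & x2 & x3 <- Philr_inv A)
    E (a * x1) (b * x2) (w * x3).
Proof.
move=> lE.
have e : Philr_inv A * idT (rho A) (lam A u) = fT (lam A) (rho A u) * Philr_inv A.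
  apply: (inv_mvr (PhilrV A)); rewrite -mulrA -lam_rho mulrA.
  by rewrite (PhilrV A).2 mul1r.
cps (sw3 E) e.
Qed.

Lemma Philr_invl (Z : lmodType k) (E : H -> A -> H -> Z) : mlin3 E ->
  \sw_(x1 & x2 & x3 <- Philr_inv A) \sw_(X1 & X2 & X3 <- Philr A)
    E (x1 * X1) (x2 * X2) (x3 * X3) = E 1 1 1.
Proof. move=> lE; cps (sw3 E) (PhilrV A).2. Qed.
End BiRules.

(** * The Drinfeld twist *)

Section Kill.
Variables (k : fieldType) (H : quasiHopf k).
Implicit Types (W Z : lmodType k) (A B C : pzAlgebra k).
Variables (W : lmodType k) (K : H -> H -> W) (w : W).
Hypothesis hK : forall h, \sw_(a & b <- Delta h) K a b = eps h *:: w.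

Lemma killE Z (F : W -> Z) h : lin F -> \sw_(a & b <- Delta h) F (K a b) = eps h *:: F w.
Proof.
move=> lF; rewrite -(@tsum_ext _ _ _ W Z _ _ F) // hK.
exact: linZ.
Qed.

(** K is a pair such as S(h1) alpha h2 or h1 beta S(h2). If both its entries come from one leg of an
    associator, the counit left by the collapse falls on that leg and the whole associator
    disappears. *)
Lemma kill1 B C Z (t : H \otimes (B \otimes C)) (E : W -> B -> C -> Z) :
  formT (@eps k H) t = 1 -> mlin3 E ->
  \sw_(x & y & z <- t) \sw_(a & b <- Delta x) E (K a b) y z = E w 1 1.
Proof.
move=> ht lE; rewrite -(@eps1_rule _ _ _ _ _ t (E w)) //; last by lin_core.
by apply: under3 => x y z; apply: (killE (F := fun v => E v y z)); lin_core.
Qed.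
Lemma kill2 A C Z (t : A \otimes (H \otimes C)) (E : A -> W -> C -> Z) :
  idT (formT (@eps k H)) t = 1 -> mlin3 E ->
  \sw_(x & y & z <- t) \sw_(a & b <- Delta y) E x (K a b) z = E 1 w 1.
Proof.
move=> ht lE; rewrite -(@eps2_rule _ _ _ _ _ t (fun x z => E x w z)) //; last by lin_core.
by apply: under3 => x y z; apply: (killE (F := fun v => E x v z)); lin_core.
Qed.
Lemma kill3 A B Z (t : A \otimes (B \otimes H)) (E : A -> B -> W -> Z) :
  idT (idTform (@eps k H)) t = 1 -> mlin3 E ->
  \sw_(x & y & z <- t) \sw_(a & b <- Delta z) E x y (K a b) = E 1 1 w.
Proof.
move=> ht lE; rewrite -(@eps3_rule _ _ _ _ _ t (fun x y => E x y w)) //; last by lin_core.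
by apply: under3 => x y z; apply: (killE (F := fun v => E x y v)); lin_core.
Qed.
Lemma kill_D1 Z h (E : W -> H -> Z) : bil E ->
  \sw_(x & y <- Delta h) \sw_(a & b <- Delta x) E (K a b) y = E w h.
Proof.
move=> lE; rewrite -(@Delta_eps1 _ _ _ h (E w)); last by lin_core.
by apply: under2 => x y; apply: (killE (F := fun v => E v y)); lin_core.
Qed.
Lemma kill_D2 Z h (E : H -> W -> Z) : bil E ->
  \sw_(x & y <- Delta h) \sw_(a & b <- Delta y) E x (K a b) = E h w.
Proof.
move=> lE; rewrite -(@Delta_eps2 _ _ _ h (fun x => E x w)); last by lin_core.
by apply: under2 => x y; apply: (killE (F := fun v => E x v)); lin_core.
Qed.
Lemma kill_lam B (L : leftComoduleAlgebra H B) Z (u : B) (E : W -> B -> Z) : bil E ->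
  \sw_(x & y <- lam L u) \sw_(a & b <- Delta x) E (K a b) y = E w u.
Proof.
move=> lE; rewrite -[in RHS](@lam_eps k H B L u).
rewrite -(@formT_rule _ _ _ _ _ _ (E w)); last by lin_core.
by apply: under2 => x y; apply: (killE (F := fun v => E v y)); lin_core.
Qed.
End Kill.

(** * Uniqueness of antipodes along an algebra map *)

Section Triples.
Variables (k : fieldType) (H : quasiHopf k) (B : pzAlgebra k) (phi : H -> B).

(* What [(S, alpha, beta)] satisfies, transported along an algebra map [phi : H -> B].
   Two such triples along the same [phi] are conjugate (lemmas [conjugatorM] to
   [conjugatorK]).  The Drinfeld twist is the conjugator of two triples along [Delta]. *)
Record antipode_along (s : H -> B) (a b : B) : Prop := AntipodeAlong {
  aa_lin : lin s;
  aa_one : unital s;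
  aa_anti : antimults s;
  aa_evl : forall h, \sw_(h1 & h2 <- Delta h) (s h1 * a * phi h2) = eps h *:: a;
  aa_coev : forall h, \sw_(h1 & h2 <- Delta h) (phi h1 * b * s h2) = eps h *:: b;
  aa_Phi : \sw_(X1 & X2 & X3 <- Phi H) (phi X1 * b * s X2 * a * phi X3) = 1;
  aa_Phi_inv : \sw_(x1 & x2 & x3 <- Phi_inv H) (s x1 * a * phi x2 * b * s x3) = 1
}.

Hypotheses (lphi : lin phi) (phi1 : unital phi) (phiM : mults phi).

Lemma tsum3_mull (U V W : lmodType k) (t : U \otimes (V \otimes W)) (F : U -> V -> W -> B) x :
  (\sw_(a & b & c <- t) F a b c) * x = \sw_(a & b & c <- t) F a b c * x.
Proof. by rewrite tsum_mull; apply: eq_tsum2 => a b; rewrite tsum_mull. Qed.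
Lemma tsum3_mulr (U V W : lmodType k) (t : U \otimes (V \otimes W)) (F : U -> V -> W -> B) x :
  x * (\sw_(a & b & c <- t) F a b c) = \sw_(a & b & c <- t) x * F a b c.
Proof. by rewrite tsum_mulr; apply: eq_tsum2 => a b; rewrite tsum_mulr. Qed.

Variables (s t : H -> B) (a b c d : B).
Hypotheses (hs : antipode_along s a b) (ht : antipode_along t c d).
Let ls := aa_lin hs. Let lt := aa_lin ht.
Let s1 := aa_one hs. Let t1 := aa_one ht.
Let sM := aa_anti hs. Let tM := aa_anti ht.

(** The element (t, c) on the left of the antipode axiom for Phi^-1 is combined with (b, s) on its
    right. For two equal triples this is 1 by [aa_Phi_inv]. *)
Definition conjugator (t : H -> B) (c : B) (b : B) (s : H -> B) : B :=
  \sw_(x1 & x2 & x3 <- Phi_inv H) (t x1 * c * phi x2 * b * s x3).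

(** Insert t(h1) c phi(h2) in place of c, move Phi^-1 across the iterated coproduct of h, and
    collapse the pair phi(h2) b s(h3) that forms around b. *)
Lemma conjugatorM h : conjugator t c b s * s h = t h * conjugator t c b s.
Proof.
rewrite /conjugator tsum3_mull.
step (apply/esym/(kill_D1 (aa_evl ht) (E := fun w h2 =>
  \sw_(x1 & x2 & x3 <- Phi_inv H) (t x1 * w * phi x2 * b * s x3 * s h2)) h)).
step (apply/esym/(coassoc_Phi_inv (E := fun x y z => t x * c * phi y * b * s z) _ h)).
step (apply: (kill_D2 (aa_coev hs) (E := fun h1 w =>
  \sw_(x1 & x2 & x3 <- Phi_inv H) (t h1 * t x1 * c * phi x2 * w * s x3)) h)).
rewrite tsum3_mulr; sw.
Qed.

(** A second associator is created by expanding c along the first leg of Phi. The pentagon then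
    produces three associators: two collapse, and the third is the left-hand side of [aa_Phi]. *)
Lemma conjugator_a : conjugator t c b s * a = c.
Proof.
rewrite /conjugator tsum3_mull.
step (apply/esym/(kill1 (aa_evl ht) (Phi_eps1 H) (E := fun w y z =>
  \sw_(x1 & x2 & x3 <- Phi_inv H) (t x1 * w * phi x2 * b * s x3 * s y * a * phi z)))).
step (apply: (Phi_LT' (E := fun x y z u => t x * c * phi y * b * s z * a * phi u))).
step (apply: (kill3 (aa_evl hs) (Phi_inv_eps3 H) (E := fun x y w =>
  \sw_(X1 & X2 & X3 <- Phi H) \sw_(Y1 & Y2 & Y3 <- Phi H) \sw_(u & v <- Delta Y2)
  (t Y1 * t x * c * phi y * phi X1 * phi u * b * s v * s X2 * w * phi X3 * phi Y3)))).
step (apply: (kill2 (aa_coev hs) (Phi_eps H) (E := fun x w y =>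
  \sw_(X1 & X2 & X3 <- Phi H)
  (t x * c * phi X1 * w * s X2 * a * phi X3 * phi y)))).
rewrite -[RHS]mulr1 -(aa_Phi hs) tsum3_mulr.
sw.
Qed.

(** Dual to [conjugator_a]: d is expanded along the last leg of Phi, and a along the middle leg of
    Phi^-1, to reach one side of the pentagon. *)
Lemma conjugator_b : b * conjugator s a d t = d.
Proof.
rewrite /conjugator tsum3_mulr.
step (apply/esym/(kill3 (aa_coev ht) (Phi_eps3 H) (E := fun x y w =>
  \sw_(x1 & x2 & x3 <- Phi_inv H) (phi x * b * s y * s x1 * a * phi x2 * w * t x3)))).
step (apply/esym/(kill2 (aa_evl hs) (Phi_inv_eps2 H) (E := fun x w y =>
  \sw_(x1 & x2 & x3 <- Phi_inv H) \sw_(X1 & X2 & X3 <- Phi H) \sw_(u & v <- Delta X3)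
  (phi x * phi X1 * b * s X2 * s x1 * w * phi x2 * phi u * d * t v * t x3 * t y)))).
step (apply/esym/(Phi_TL' (E := fun x y z u => phi x * b * s y * a * phi z * d * t u))).
step (apply: (kill1 (aa_coev hs) (Phi_inv_eps1 H) (E := fun w y z =>
  \sw_(X1 & X2 & X3 <- Phi H) (phi X1 * w * s X2 * a * phi X3 * phi y * d * t z)))).
rewrite -[RHS]mul1r -(aa_Phi hs) tsum3_mull.
sw.
Qed.

(** The first factor moves through s(x1) and turns a into c; what is left is [aa_Phi_inv] for t. *)
Lemma conjugatorK : conjugator t c b s * conjugator s a d t = 1.
Proof.
rewrite {2}/conjugator tsum3_mulr -(aa_Phi_inv ht).
apply: under3 => x y z.
by rewrite !mulrA conjugatorM -(mulrA (t x)) conjugator_a.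
Qed.
End Triples.

(** * Two antipode triples along the comultiplication *)

Section Twist.
Variables (k : fieldType) (H : quasiHopf k).
Local Notation alpha := (alpha H).
Local Notation beta := (beta H).
Local Notation HH := (pzAlgebra_tens H H).
Local Notation D := (@Delta k H).

Lemma linK (U V : lmodType k) (f : U -> V) (c : k^o) x : lin f -> f (c *:: x) = c *:: f x.
Proof. by move=> lf; apply: linZ. Qed.

Lemma ev_S (h : H) : \sw_(h1 & h2 <- Delta h) (S h1 * alpha * h2) = eps h *:: alpha.
Proof. exact: S_alpha. Qed.
Lemma coev_S (h : H) : \sw_(h1 & h2 <- Delta h) (h1 * beta * S h2) = eps h *:: beta.
Proof. exact: S_beta. Qed.

Let DM : @mults k H HH D. Proof. exact: DeltaM. Qed.
Let D1 : @unital k H HH D. Proof. exact: Delta1. Qed.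

Lemma Delta_triple : @antipode_along k H HH D (fun h => D (S h)) (D alpha) (D beta).
Proof.
have lD : lin (D : H -> HH) := @lin_Delta k H.
split.
- by lin_core.
- by rewrite /unital S_one Delta1.
- by move=> x y; rewrite S_antimul DeltaM.
- move=> h; rewrite -(linK _ _ lD) -ev_S (@tsum_ext _ _ _ _ _ _ _ D) //.
  by apply: under2 => a b; rewrite !DM.
- move=> h; rewrite -(linK _ _ lD) -coev_S (@tsum_ext _ _ _ _ _ _ _ D) //.
  by apply: under2 => a b; rewrite !DM.
- rewrite -D1 -(Phi_alpha_beta H) (@tsum_ext _ _ _ _ _ _ _ D) //; apply: under2 => a b.
  by rewrite (@tsum_ext _ _ _ _ _ _ _ D) //; apply: under2 => c d; rewrite !DM.
- rewrite -D1 -(Phi_inv_alpha_beta H) (@tsum_ext _ _ _ _ _ _ _ D) //; apply: under2 => a b.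
  by rewrite (@tsum_ext _ _ _ _ _ _ _ D) //; apply: under2 => c d; rewrite !DM.
Qed.

(* The second triple along [Delta]; its first is [Delta_triple]. *)
Definition S2 (h : H) : H \otimes H := \sw_(a & b <- Delta h) (S b \ot S a).
(** Drinfeld's gamma, written with (1 (x) Phi^-1)(id (x) id (x) Delta)(Phi) instead of (Phi (x)
    1)(Delta (x) id (x) id)(Phi^-1). *)
Definition gam : H \otimes H :=
  \sw_(x1 & x2 & x3 <- Phi_inv H) \sw_(X1 & X2 & X3 <- Phi H) \sw_(c & d <- Delta X3)
    ((S (x1 * X2) * alpha * (x2 * c)) \ot (S X1 * alpha * (x3 * d))).
(** Drinfeld's delta, characterised through the twist f by Delta(beta) f^-1 = delta; see
    [Delta_beta_twist_inv]. *)
Definition del : H \otimes H :=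
  \sw_(x1 & x2 & x3 <- Phi_inv H) \sw_(c & d <- Delta x3) \sw_(X1 & X2 & X3 <- Phi H)
    ((x1 * beta * S (d * X3)) \ot (x2 * X1 * beta * S (c * X2))).

Lemma lin_S2 : lin S2. Proof. by rewrite /S2; lin_core. Qed.
Lemma S2_one : @unital k H HH S2.
Proof. by rewrite /unital /S2 Delta1 tsum_one ?S_one //; lin_core. Qed.
Lemma S2_anti : @antimults k H HH S2.
Proof. move=> a b; rewrite /S2; swf. Qed.

(** By the pentagon the two tensors defining gamma differ by (id (x) Delta (x) id)(Phi^-1), which
    collapses inside S(-) alpha (-). *)
Lemma drinfeld_gammaE : drinfeld_gamma H = gam.
Proof.
rewrite /drinfeld_gamma.
step (apply: (Phi_TL' (E := fun a b c d => (S b * alpha * c) \ot (S a * alpha * d)))).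
step (apply: (kill2 ev_S (Phi_inv_eps2 H) (E := fun x w y =>
  \sw_(x1 & x2 & x3 <- Phi_inv H) \sw_(X1 & X2 & X3 <- Phi H) \sw_(c & d <- Delta X3)
    ((S X2 * S x1 * w * x2 * c) \ot (S X1 * S x * alpha * y * x3 * d))))).
rewrite /gam; sw.
Qed.

(** After reassociation the four legs of h are nested: the inner pair S(h2) alpha h3 in the first
    tensor factor collapses, which frees the outer pair in the second. *)
Lemma S2_ev h : \sw_(h1 & h2 <- Delta h) (S2 h1 * gam * Delta h2) = eps h *:: gam.
Proof.
rewrite /S2 /gam.
stepf (apply/esym/(coassoc_Phi (E := fun a b c =>
  \sw_(x1 & x2 & x3 <- Phi_inv H) \sw_(u & v <- Delta c)
    ((S (x1 * b) * alpha * (x2 * u)) \ot (S a * alpha * (x3 * v)))) _ h)).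
step (apply: (under2 (Delta h)) => h1 h2; apply: (coassoc_Phi_inv (E := fun a b c =>
  \sw_(X1 & X2 & X3 <- Phi H) \sw_(u & v <- Delta X3)
    ((S (a * X2) * alpha * (b * u)) \ot (S (h1 * X1) * alpha * (c * v)))) _ h2)).
step (apply: (under2 (Delta h)) => h1 h2; apply: (kill_D1 ev_S (E := fun w h2 =>
  \sw_(x1 & x2 & x3 <- Phi_inv H) \sw_(X1 & X2 & X3 <- Phi H) \sw_(u & v <- Delta X3)
    ((S X2 * S x1 * w * x2 * u) \ot (S X1 * S h1 * alpha * h2 * x3 * v))) h2)).
step (apply: (killE ev_S (F := fun w =>
  \sw_(x1 & x2 & x3 <- Phi_inv H) \sw_(X1 & X2 & X3 <- Phi H) \sw_(u & v <- Delta X3)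
    ((S X2 * S x1 * alpha * x2 * u) \ot (S X1 * w * x3 * v))) h)).
congr (_ *:: _); sw.
Qed.

Lemma S2_coev h : \sw_(h1 & h2 <- Delta h) (Delta h1 * del * S2 h2) = eps h *:: del.
Proof.
rewrite /S2 /del.
stepf (apply/esym/(coassoc_Phi_inv (E := fun a b c =>
  \sw_(X1 & X2 & X3 <- Phi H) \sw_(u & v <- Delta c)
    ((a * beta * S (v * X3)) \ot (b * X1 * beta * S (u * X2)))) _ h)).
step (apply: (under3 (Phi_inv H)) => x1 x2 x3; apply: (under2 (Delta h)) => h1 h2; apply: (coassoc_Phi (E := fun a b c =>
  \sw_(u & v <- Delta x3)
    ((x1 * h1 * beta * S (v * c)) \ot (x2 * a * beta * S (u * b)))) _ h2)).
step (apply: (under2 (Delta h)) => h1 h2; apply: (kill_D1 coev_S (E := fun w h2 =>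
  \sw_(x1 & x2 & x3 <- Phi_inv H) \sw_(u & v <- Delta x3) \sw_(X1 & X2 & X3 <- Phi H)
    ((x1 * h1 * beta * S h2 * S X3 * S v) \ot (x2 * X1 * w * S X2 * S u))) h2)).
step (apply: (killE coev_S (F := fun w =>
  \sw_(x1 & x2 & x3 <- Phi_inv H) \sw_(u & v <- Delta x3) \sw_(X1 & X2 & X3 <- Phi H)
    ((x1 * w * S X3 * S v) \ot (x2 * X1 * beta * S X2 * S u))) h)).
congr (_ *:: _); sw.
Qed.

End Twist.

Section Twist2.
Variables (k : fieldType) (H : quasiHopf k).
Local Notation alpha := (alpha H).
Local Notation beta := (beta H).
Local Notation HH := (pzAlgebra_tens H H).
Local Notation D := (@Delta k H).
Local Notation S2 := (@S2 k H).
Local Notation gam := (gam H).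
Local Notation del := (del H).

Let lD : lin (D : H -> HH) := @lin_Delta k H.
Let DM : @mults k H HH D. Proof. exact: DeltaM. Qed.
Let D1 : @unital k H HH D. Proof. exact: Delta1. Qed.
Let lS2 : lin S2 := @lin_S2 k H.
Let S2M := @S2_anti k H. Let S21 := @S2_one k H.

Local Notation G5 a b c d e f :=
  ((S b * alpha * c * beta * S f) \ot (S a * alpha * d * beta * S e)).
Local Notation G4 a b c d e f :=
  ((a * beta * S d * alpha * e) \ot (b * beta * S c * alpha * f)).

Lemma ot_tsum3 (U V W U' V' W' X Y : lmodType k) (t : U \otimes (V \otimes W))
    (t' : U' \otimes (V' \otimes W')) (F : U -> V -> W -> X) (G : U' -> V' -> W' -> Y) :
  (\sw_(a & b & c <- t) F a b c) \ot (\sw_(a & b & c <- t') G a b c) =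
  \sw_(a & b & c <- t) \sw_(a' & b' & c' <- t') (F a b c \ot G a' b' c').
Proof.
rewrite (@tsum_ext _ _ _ _ _ _ _ (fun x => x \ot _)); last by lin_core.
apply: eq_tsum2 => a b.
rewrite (@tsum_ext _ _ _ _ _ _ _ (fun x => x \ot _)); last by lin_core.
apply: eq_tsum2 => c d.
rewrite (@tsum_ext _ _ _ _ _ _ _ (fun x => _ \ot x)); last by lin_core.
apply: eq_tsum2 => a' b'.
by rewrite (@tsum_ext _ _ _ _ _ _ _ (fun x => _ \ot x)); last by lin_core.
Qed.

(** Each use of the pentagon or of quasi-coassociativity prepares a collapse, until the two tensor
    factors are independent and each carries its own copy of the antipode axiom for Phi^-1. *)
Lemma S2_Phi_inv :
  \sw_(x1 & x2 & x3 <- Phi_inv H) (S2 x1 * gam * Delta x2 * del * S2 x3) = 1.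
Proof.
(* The Phi inside [gam] is merged with the two coproducts around it, which exhibits (Phi (x)
   1)(Delta (x) id (x) id)(Phi^-1). *)
transitivity (\sw_(X1 & X2 & X3 <- Phi H) \sw_(x1 & x2 & x3 <- Phi_inv H) \sw_(a & b <- Delta x1)
  \sw_(u1 & u2 & u3 <- Phi_inv H) (((S (u1 * (X2 * b)) * alpha * u2) \ot (S (X1 * a) * alpha * u3))
    * Delta (X3 * x2) * del * S2 x3)).
  rewrite /gam /S2; swf.
step (apply: (Phi_TL' (E := fun a b c d =>
  \sw_(u1 & u2 & u3 <- Phi_inv H) (((S (u1 * b) * alpha * u2) \ot (S a * alpha * u3))
    * Delta c * del * S2 d)))).
step (apply: (kill3 (@S2_coev k H) (Phi_eps3 H) (E := fun X1 X2 w =>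
  \sw_(u1 & u2 & u3 <- Phi_inv H) \sw_(x1 & x2 & x3 <- Phi_inv H) \sw_(a & b <- Delta x2)
  \sw_(y1 & y2 & y3 <- Phi_inv H)
  (((S (u1 * a * y1 * X2) * alpha * u2) \ot (S (x1 * X1) * alpha * u3))
    * Delta b * Delta y2 * w * S2 y3 * S2 x3)))).
stepf (apply: (under3 (Phi_inv H)) => x1 x2 x3; apply: (coassoc_Phi_inv (E := fun a b c =>
  \sw_(y1 & y2 & y3 <- Phi_inv H) (((S (a * y1) * alpha * b) \ot (S x1 * alpha * c))
    * Delta y2 * del * S2 y3 * S2 x3)) _ x2)).
step (apply: (under3 (Phi_inv H)) => x1 x2 x3; apply: (kill_D1 (@ev_S k H) (E := fun w h =>
  \sw_(u1 & u2 & u3 <- Phi_inv H)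
  \sw_(y1 & y2 & y3 <- Phi_inv H) (((S y1 * S u1 * w * u2) \ot (S x1 * alpha * h * u3))
    * Delta y2 * del * S2 y3 * S2 x3)) x2)).
rewrite /del /S2.
stepf (apply: (Phi_pent_inv (E := fun a b c d =>
  \sw_(x1 & x2 & x3 <- Phi_inv H) \sw_(v1 & v2 <- Delta x3) \sw_(d1 & d2 <- Delta d)
  \sw_(X1 & X2 & X3 <- Phi H)
  G5 x1 a b (x2 * c * X1) (v1 * d1 * X2) (v2 * d2 * X3)))).
step (apply: (kill1 (@ev_S k H) (Phi_inv_eps1 H) (E := fun w y z =>
  \sw_(x1 & x2 & x3 <- Phi_inv H) \sw_(v1 & v2 <- Delta x3)
  \sw_(y1 & y2 & y3 <- Phi_inv H) \sw_(c & d <- Delta y3)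
  \sw_(X1 & X2 & X3 <- Phi H) \sw_(d1 & d2 <- Delta d) \sw_(z1 & z2 <- Delta z)
  ((S y1 * w * y2 * beta * S (v2 * z2 * d2 * X3)) \ot
   (S x1 * alpha * (x2 * y * c * X1) * beta * S (v1 * z1 * d1 * X2)))))).
step (apply: (under3 (Phi_inv H)) => y1 y2 y3; apply: (coassoc_Phi (E := fun a b c =>
  \sw_(x1 & x2 & x3 <- Phi_inv H) \sw_(v1 & v2 <- Delta x3)
  G5 x1 y1 y2 (x2 * a) (v1 * b) (v2 * c)) _ y3)).
step (apply: (under3 (Phi_inv H)) => y1 y2 y3; apply: (kill_D1 (@coev_S k H) (E := fun w h =>
  \sw_(x1 & x2 & x3 <- Phi_inv H) \sw_(v1 & v2 <- Delta x3) \sw_(X1 & X2 & X3 <- Phi H)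
  ((S y1 * alpha * y2 * beta * S (v2 * X3 * h)) \ot
   (S x1 * alpha * x2 * X1 * w * S X2 * S v1))) y3)).
step (apply: (Phi_P'O (E := fun a b c d => \sw_(y1 & y2 & y3 <- Phi_inv H)
  G5 a y1 y2 b c (d * y3)))).
step (apply: (kill1 (@ev_S k H) (Phi_eps1 H) (E := fun w y z =>
  \sw_(x1 & x2 & x3 <- Phi_inv H) \sw_(z1 & z2 & z3 <- Phi_inv H) \sw_(c & d <- Delta z2)
  \sw_(y1 & y2 & y3 <- Phi_inv H)
  ((S y1 * alpha * y2 * beta * S (z * z3 * y3)) \ot
   (S z1 * S x1 * w * x2 * c * beta * S d * S x3 * S y))))).
step (apply: (kill2 (@coev_S k H) (Phi_inv_eps2 H) (E := fun z1 w z3 =>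
  \sw_(x1 & x2 & x3 <- Phi_inv H) \sw_(y1 & y2 & y3 <- Phi_inv H)
  ((S y1 * alpha * y2 * beta * S (z3 * y3)) \ot
   (S z1 * S x1 * alpha * x2 * w * S x3))))).
(* The unit on the right is replaced by the antipode axiom for Phi^-1, once in each tensor
   factor. *)
rewrite [RHS]otone -[X in X \ot _](Phi_inv_alpha_beta H) -[X in _ \ot X](Phi_inv_alpha_beta H).
rewrite ot_tsum3; sw.
Qed.

(** Same scheme as [S2_Phi_inv] with [del] and [gam] exchanged; it ends in two copies of the
    antipode axiom for Phi. *)
Lemma S2_Phi :
  \sw_(X1 & X2 & X3 <- Phi H) (Delta X1 * del * S2 X2 * gam * Delta X3) = 1.
Proof.
(* Here the Phi^-1 inside [del] is merged with the coproducts, giving (Delta (x) id (x)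
   id)(Phi)(Phi^-1 (x) 1). *)
transitivity (\sw_(X1 & X2 & X3 <- Phi H) \sw_(a & b <- Delta X1) \sw_(x1 & x2 & x3 <- Phi_inv H)
  \sw_(Z1 & Z2 & Z3 <- Phi H) (((a * x1 * beta * S Z3) \ot (b * x2 * Z1 * beta * S Z2))
    * S2 (X2 * x3) * gam * Delta X3)).
  rewrite /del /S2; swf.
step (apply: (Phi_LT' (E := fun a b c d =>
  \sw_(Z1 & Z2 & Z3 <- Phi H) (((a * beta * S Z3) \ot (b * Z1 * beta * S Z2))
    * S2 c * gam * Delta d)))).
step (apply: (kill3 (@S2_ev k H) (Phi_inv_eps3 H) (E := fun x1 x2 w =>
  \sw_(X1 & X2 & X3 <- Phi H) \sw_(Y1 & Y2 & Y3 <- Phi H) \sw_(a & b <- Delta Y2)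
  \sw_(Z1 & Z2 & Z3 <- Phi H)
  (((x1 * Y1 * beta * S Z3) \ot (x2 * X1 * a * Z1 * beta * S Z2))
    * S2 b * S2 X2 * w * Delta X3 * Delta Y3)))).
eapply step_trans; [apply: (under3 (Phi H)) => Y1 Y2 Y3; apply: (coassoc_Phi (E := fun a b c =>
  \sw_(X1 & X2 & X3 <- Phi H) (((Y1 * beta * S c) \ot (X1 * a * beta * S b))
    * S2 X2 * gam * Delta X3 * Delta Y3)) _ Y2); lin_core | rewrite /S2; swf | cbv beta].
step (apply: (under3 (Phi H)) => Y1 Y2 Y3; apply: (kill_D1 (@coev_S k H) (E := fun w h =>
  \sw_(X1 & X2 & X3 <- Phi H) \sw_(Z1 & Z2 & Z3 <- Phi H)
  (((Y1 * beta * S h * S Z3) \ot (X1 * Z1 * w * S Z2))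
    * S2 X2 * gam * Delta X3 * Delta Y3)) Y2)).
rewrite /gam /S2.
stepf (apply: (Phi_pent (E := fun a b c d =>
  \sw_(x1 & x2 & x3 <- Phi_inv H) \sw_(Y1 & Y2 & Y3 <- Phi H) \sw_(d1 & d2 <- Delta d)
  \sw_(v1 & v2 <- Delta Y3)
  G4 Y1 a b (x1 * c * Y2) (x2 * d1 * v1) (x3 * d2 * v2)))).
step (apply: (under3 (Phi H)) => X1 X2 X3; apply: (under2 (Delta X3)) => c d;
  apply: (kill1 (@coev_S k H) (Phi_eps1 H) (E := fun w y z =>
  \sw_(x1 & x2 & x3 <- Phi_inv H) \sw_(Y1 & Y2 & Y3 <- Phi H) \sw_(d1 & d2 <- Delta d)
  \sw_(z1 & z2 <- Delta z) \sw_(v1 & v2 <- Delta Y3)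
  ((Y1 * beta * S (x1 * c * y * Y2) * alpha * (x2 * d1 * z1 * v1)) \ot
   (X1 * w * S X2 * alpha * (x3 * d2 * z2 * v2)))))).
step (apply: (under3 (Phi H)) => X1 X2 X3; apply: (coassoc_Phi_inv (E := fun a b c =>
  \sw_(Y1 & Y2 & Y3 <- Phi H) \sw_(v1 & v2 <- Delta Y3)
  G4 Y1 X1 X2 (a * Y2) (b * v1) (c * v2)) _ X3)).
step (apply: (under3 (Phi H)) => X1 X2 X3; apply: (kill_D1 (@ev_S k H) (E := fun w h =>
  \sw_(x1 & x2 & x3 <- Phi_inv H) \sw_(Y1 & Y2 & Y3 <- Phi H) \sw_(v1 & v2 <- Delta Y3)
  ((Y1 * beta * S Y2 * S x1 * w * x2 * v1) \ot
   (X1 * beta * S X2 * alpha * h * x3 * v2))) X3)).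
step (apply: (Phi_O'P (E := fun a b c d => \sw_(X1 & X2 & X3 <- Phi H)
  G4 a X1 X2 b c (X3 * d)))).
step (apply: (kill2 (@ev_S k H) (Phi_eps H) (E := fun x w z =>
  \sw_(Y1 & Y2 & Y3 <- Phi H) \sw_(x1 & x2 & x3 <- Phi_inv H) \sw_(c & d <- Delta x1)
  \sw_(X1 & X2 & X3 <- Phi H)
  ((x * Y1 * c * beta * S d * S Y2 * w * Y3 * x2) \ot
   (X1 * beta * S X2 * alpha * X3 * z * x3))))).
step (apply: (kill1 (@coev_S k H) (Phi_inv_eps1 H) (E := fun w y z =>
  \sw_(Y1 & Y2 & Y3 <- Phi H) \sw_(X1 & X2 & X3 <- Phi H)
  ((Y1 * w * S Y2 * alpha * Y3 * y) \ot (X1 * beta * S X2 * alpha * X3 * z))))).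
rewrite [RHS]otone -[X in X \ot _](Phi_alpha_beta H) -[X in _ \ot X](Phi_alpha_beta H).
rewrite ot_tsum3; sw.
Qed.

Lemma S2_triple : @antipode_along k H HH D S2 gam del.
Proof.
split; [exact: lin_S2|exact: S2_one|exact: S2_anti|exact: S2_ev|exact: S2_coev
  |exact: S2_Phi|exact: S2_Phi_inv].
Qed.

Lemma twistE : drinfeld_twist H = @conjugator k H HH D S2 gam (D beta) (fun h => D (S h)).
Proof.
rewrite /drinfeld_twist drinfeld_gammaE /conjugator; apply: under3 => x y z.
by rewrite !DM !mulrA.
Qed.

End Twist2.

Section Twist3.
Variables (k : fieldType) (H : quasiHopf k).
Local Notation alpha := (alpha H).
Local Notation beta := (beta H).
Local Notation HH := (pzAlgebra_tens H H).
Local Notation D := (@Delta k H).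
Local Notation S2 := (@S2 k H).
Local Notation del := (del H).

Let lD : lin (D : H -> HH) := @lin_Delta k H.
Let DM : @mults k H HH D. Proof. exact: DeltaM. Qed.
Let D1 : @unital k H HH D. Proof. exact: Delta1. Qed.
Let lS2 : lin S2 := @lin_S2 k H.
Let S2M := @S2_anti k H. Let S21 := @S2_one k H.

Lemma twist_inverses :
  inverses (drinfeld_twist H) (@conjugator k H HH D (fun h => D (S h)) (D alpha) del S2).
Proof.
rewrite twistE; split.
- have h := conjugatorK lD D1 DM (Delta_triple H) (S2_triple H); exact: h.
- have h := conjugatorK lD D1 DM (S2_triple H) (Delta_triple H); exact: h.
Qed.

(** [inverse] is defined by choice, with value 0 if there is no inverse. The conjugator in the
    opposite direction excludes that case, and inverses are unique. *)
Lemma twist_invE :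
  drinfeld_twist_inv H = @conjugator k H HH D (fun h => D (S h)) (D alpha) del S2.
Proof.
rewrite /drinfeld_twist_inv /inverse; case: boolp.pselect => [h|[]].
  by case: boolp.cid => y hy /=; apply: inv_uniq hy twist_inverses.
by eexists; exact: twist_inverses.
Qed.

Local Notation g := (drinfeld_twist_inv H).

Lemma Delta_beta_twist_inv : Delta beta * g = del.
Proof. rewrite twist_invE; have h := conjugator_b lD D1 DM (Delta_triple H) (S2_triple H); exact: h. Qed.

Lemma twist_inv_S2 h : g * S2 h = Delta (S h) * g.
Proof. rewrite twist_invE; have e := conjugatorM lD DM (S2_triple H) (Delta_triple H) h; exact: e. Qed.
End Twist3.

(** * The elements p and q *)

Section PQ.
Variables (k : fieldType) (H : quasiHopf k) (B : pzAlgebra k) (L : leftComoduleAlgebra H B).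
Local Notation alpha := (alpha H).
Local Notation beta := (beta H).
Local Notation g := (drinfeld_twist_inv H).

(* The elements written p and q at the top of the file. *)
Definition pl : H \otimes B := \sw_(X1 & X2 & X3 <- Phil L) ((X2 * Sinv (X1 * beta)) \ot X3).
Definition ql : H \otimes B := \sw_(x1 & x2 & x3 <- Phil_inv L) ((S x1 * alpha * x2) \ot x3).

Lemma coev_Sinv (h : H) :
  \sw_(a & b <- Delta h) (b * Sinv (a * beta)) = eps h *:: Sinv beta.
Proof.
rewrite -(linK _ _ (@lin_Sinv k H)) -coev_S (@tsum_ext _ _ _ _ _ _ _ (@Sinv k H)); last exact: lin_Sinv.
by apply: under2 => a b; leaf.
Qed.

Variables (Z : lmodType k).

Lemma Phi_invr (E : H -> H -> H -> Z) : mlin3 E ->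
  \sw_(X1 & X2 & X3 <- Phi H) \sw_(x1 & x2 & x3 <- Phi_inv H)
    E (X1 * x1) (X2 * x2) (X3 * x3) = E 1 1 1.
Proof. move=> lE; cps (sw3 E) (PhiV H).1. Qed.

Section Bil.
Variable E : H -> B -> Z.
Hypothesis lE : bil E.

(** Quasi-Hopf form of the identity u_[0][-1] S^-1(u_[-1]) (x) u_[0][0] = 1 (x) u. It is what makes
    [lift] A-linear. *)
Lemma pl_lam (u : B) :
  \sw_(v & w <- lam L u) \sw_(a & b <- lam L w) \sw_(p1 & p2 <- pl) E (a * p1 * Sinv v) (b * p2) =
  \sw_(p1 & p2 <- pl) E p1 (p2 * u).
Proof.
rewrite /pl.
step (apply: (lam_Phil L (E := fun x y z => E (y * Sinv (x * beta)) z) _ u)).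
step (apply: (kill_lam coev_Sinv L u (E := fun w y =>
  \sw_(X1 & X2 & X3 <- Phil L) E (X2 * w * Sinv X1) (X3 * y)))).
sw.
Qed.

(** Counterpart of [pl_lam] for q; it gives the compatibility of pi with the actions. *)
Lemma ql_lam (u : B) :
  \sw_(v & w <- lam L u) \sw_(a & b <- lam L w) \sw_(q1 & q2 <- ql) E (S v * q1 * a) (q2 * b) =
  \sw_(q1 & q2 <- ql) E q1 (u * q2).
Proof.
rewrite /ql.
step (apply: (lam_Phil_inv L (E := fun x y z => E (S x * alpha * y) z) _ u)).
step (apply: (kill_lam (@ev_S k H) L u (E := fun w y =>
  \sw_(x1 & x2 & x3 <- Phil_inv L) E (S x1 * w * x2) (y * x3)))).
sw.
Qed.

(** One half of the mutual inversion of p and q, responsible for pi (lift phi) = phi; [pl_ql] is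
    responsible for lift (pi f) = f. *)
Lemma ql_pl :
  \sw_(q1 & q2 <- ql) \sw_(a & b <- lam L q2) \sw_(p1 & p2 <- pl) E (a * p1 * Sinv q1) (b * p2) =
  E 1 1.
Proof.
rewrite /pl /ql.
step (apply: (Phil_P'O L (E := fun a b c d => E (c * Sinv (S a * alpha * b * beta)) d))).
step (apply: (kill1 (@ev_S k H) (Phil_eps1 L) (E := fun w y z =>
  \sw_(x1 & x2 & x3 <- Phi_inv H) \sw_(y1 & y2 & y3 <- Phil_inv L) \sw_(c & d <- Delta y2)
  E (y * x3 * d * Sinv (S y1 * S x1 * w * x2 * c * beta)) (z * y3)))).
step (apply: (kill2 coev_Sinv (Phil_inv_eps2 L) (E := fun y1 w y3 =>
  \sw_(x1 & x2 & x3 <- Phi_inv H) E (x3 * w * Sinv (S y1 * S x1 * alpha * x2)) y3))).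
(* After the collapses only S^-1 of the antipode axiom for Phi^-1 is left. *)
have -> : E 1 1 = E (Sinv (\sw_(x1 & x2 & x3 <- Phi_inv H) (S x1 * alpha * x2 * beta * S x3))) 1.
  by rewrite Phi_inv_alpha_beta Sinv1.
have lF : lin (fun x => E (Sinv x) 1) by lin_core.
rewrite (@tsum_ext _ _ _ _ _ _ _ (fun x => E (Sinv x) 1)) //; apply: eq_tsum2 => a b.
rewrite (@tsum_ext _ _ _ _ _ _ _ (fun x => E (Sinv x) 1)) //; apply: eq_tsum2 => c d.
by leaf.
Qed.

Lemma pl_ql :
  \sw_(p1 & p2 <- pl) \sw_(a & b <- lam L p2) \sw_(q1 & q2 <- ql) E (S p1 * q1 * a) (q2 * b) =
  E 1 1.
Proof.
rewrite /pl /ql.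
step (apply: (Phil_O'P L (E := fun a b c d => E (a * beta * S b * alpha * c) d))).
step (apply: (kill2 (@ev_S k H) (Phil_eps2 L) (E := fun x w z =>
  \sw_(Y1 & Y2 & Y3 <- Phi H) \sw_(x1 & x2 & x3 <- Phil_inv L) \sw_(c & d <- Delta x1)
  E (x * Y1 * c * beta * S d * S Y2 * w * Y3 * x2) (z * x3)))).
step (apply: (kill1 (@coev_S k H) (Phil_inv_eps1 L) (E := fun w y z =>
  \sw_(Y1 & Y2 & Y3 <- Phi H) E (Y1 * w * S Y2 * alpha * Y3 * y) z))).
have -> : E 1 1 = E (\sw_(X1 & X2 & X3 <- Phi H) (X1 * beta * S X2 * alpha * X3)) 1.
  by rewrite Phi_alpha_beta.
have lF : lin (fun x => E x 1) by lin_core.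
rewrite (@tsum_ext _ _ _ _ _ _ _ (fun x => E x 1)) //; apply: eq_tsum2 => a b.
rewrite (@tsum_ext _ _ _ _ _ _ _ (fun x => E x 1)) //; apply: eq_tsum2 => c d.
by leaf.
Qed.
End Bil.

(** With h = S^-1(y beta), the twist property gives f^-1 S2(h) = Delta(y beta) f^-1 = Delta(y) del;
    the statement is its image under S^-1 (x) S^-1 followed by the flip. *)
Lemma Delta_Sinv_twist (y : H) (E : H -> H -> Z) : bil E ->
  \sw_(a & b <- Delta (Sinv (y * beta))) \sw_(g1 & g2 <- g) E (a * Sinv g2) (b * Sinv g1) =
  \sw_(a & b <- Delta y) \sw_(d1 & d2 <- del H) E (Sinv (b * d2)) (Sinv (a * d1)).
Proof.
move=> lE.
have e : g * S2 (Sinv (y * beta)) = Delta y * del H.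
  by rewrite twist_inv_S2 SinvK DeltaM -mulrA Delta_beta_twist_inv.
have h := congr1 (sw2 (fun x y => E (Sinv y) (Sinv x))) e.
rewrite /sw2 in h.
match type of h with ?l = ?r => transitivity l; [|transitivity r; [exact h|]] end; clear h.
- rewrite /S2; sw.
- sw.
Qed.

(** Source of f^-1 in the comultiplication. The coproduct of p1 contains Delta(S^-1(Y1 beta)), which
    [Delta_Sinv_twist] trades for [del]. The Phi^-1 inside [del] cancels after the pentagon for
    Phi_lambda; the rest is collapse. *)
Lemma pl_twist (E : H -> H -> B -> Z) : mlin3 E ->
  \sw_(X1 & X2 & X3 <- Phil L) \sw_(v & w <- lam L X3) \sw_(p1 & p2 <- pl)
  \sw_(a & b <- Delta (v * p1)) \sw_(g1 & g2 <- g)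
    E (a * Sinv (X2 * g2)) (b * Sinv (X1 * g1)) (w * p2) =
  \sw_(x1 & x2 & x3 <- Phil_inv L) \sw_(p1 & p2 <- pl) \sw_(a & b <- lam L p2)
  \sw_(p1' & p2' <- pl) E (x1 * p1) (x2 * a * p1') (x3 * b * p2').
Proof.
move=> lE; rewrite /pl.
step (apply: (under3 (Phil L)) => X1 X2 X3; apply: (under2 (lam L X3)) => v w;
  apply: (under3 (Phil L)) => Y1 Y2 Y3;
  apply: (Delta_Sinv_twist Y1 (E := fun a b =>
   \sw_(v1 & v2 <- Delta v) \sw_(s & t <- Delta Y2)
   E (v1 * s * a * Sinv X2) (v2 * t * b * Sinv X1) (w * Y3)))).
rewrite /del.
step (apply/esym/(Phil_pent L (E := fun a b c d =>
  \sw_(x1 & x2 & x3 <- Phi_inv H) \sw_(c' & d' <- Delta x3) \sw_(Z1 & Z2 & Z3 <- Phi H)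
  \sw_(s & t <- Delta c)
  E (s * c' * Z2 * Sinv (b * x2 * Z1 * beta)) (t * d' * Z3 * Sinv (a * x1 * beta)) d))).
step (apply: (Phi_invr (E := fun p q r =>
  \sw_(X1 & X2 & X3 <- Phil L) \sw_(Y1 & Y2 & Y3 <- Phil L) \sw_(a & b <- Delta Y2)
  \sw_(c' & d' <- Delta r) \sw_(Z1 & Z2 & Z3 <- Phi H)
  \sw_(s1 & t1 <- Delta X2) \sw_(s2 & t2 <- Delta b)
  E (s1 * s2 * c' * Z2 * Sinv (X1 * a * q * Z1 * beta)) (t1 * t2 * d' * Z3 * Sinv (Y1 * p * beta)) (X3 * Y3)))).
step (apply: (under3 (Phil L)) => Y1 Y2 Y3; apply: (coassoc_Phi (E := fun p q r =>
  \sw_(X1 & X2 & X3 <- Phil L) \sw_(s1 & t1 <- Delta X2)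
  E (s1 * q * Sinv (X1 * p * beta)) (t1 * r * Sinv (Y1 * beta)) (X3 * Y3)) _ Y2)).
step (apply: (under3 (Phil L)) => Y1 Y2 Y3; apply: (kill_D1 coev_Sinv (E := fun w h =>
  \sw_(X1 & X2 & X3 <- Phil L) \sw_(s1 & t1 <- Delta X2) \sw_(Z1 & Z2 & Z3 <- Phi H)
  E (s1 * Z2 * w * Sinv (X1 * Z1)) (t1 * Z3 * h * Sinv (Y1 * beta)) (X3 * Y3)) Y2)).
step (apply: (Phil_MT L (E := fun a b c d => \sw_(Y1 & Y2 & Y3 <- Phil L)
  E (b * Sinv (a * beta)) (c * Y2 * Sinv (Y1 * beta)) (d * Y3)))).
step (apply: (under3 (Phil_inv L)) => x1 x2 x3; apply: (under3 (Phil L)) => X1 X2 X3;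
  apply: (under2 (lam L X3)) => c d; apply: (kill1 coev_Sinv (Phil_eps1 L) (E := fun w y z =>
  \sw_(Y1 & Y2 & Y3 <- Phil L)
  E (x1 * X2 * w * Sinv X1) (x2 * c * y * Y2 * Sinv (Y1 * beta)) (x3 * d * z * Y3)))).
sw.
Qed.
End PQ.

(** * Compatibility of p and q with rho *)

Section Theta.
Variables (k : fieldType) (H : quasiHopf k) (A : bicomoduleAlgebra H) (Z : lmodType k).
Local Notation pl := (pl A). Local Notation ql := (ql A).
Local Notation alpha := (alpha H).
Local Notation beta := (beta H).
Variable E : H -> A -> H -> Z.
Hypothesis lE : mlin3 E.

(** Contracting the first two legs of the left mixed cocycle identity with (x, y) |-> y S^-1(x beta)
    collapses the copy of Theta on its right-hand side. [Philr_inv_ql] does the same for the inverse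
    identity. *)
Lemma Philr_pl :
  \sw_(T1 & T2 & T3 <- Philr A) \sw_(Y1 & Y2 & Y3 <- Philr A) \sw_(a & b <- lam A Y2)
  \sw_(p1 & p2 <- pl) E (T1 * a * p1 * Sinv Y1) (T2 * b * p2) (T3 * Y3) =
  \sw_(p1 & p2 <- pl) \sw_(a & b <- rho A p2) E p1 a b.
Proof.
rewrite /pl.
step (apply: (Philr_pentl (A := A) (E := fun a b c d => E (b * Sinv (a * beta)) c d))).
step (apply: (under3 (Phil A)) => X1 X2 X3; apply: (under2 (rho A X3)) => c d;
  apply: (kill1 (@coev_Sinv k H) (Philr_eps1 A) (E := fun w y z =>
  E (X2 * w * Sinv X1) (c * y) (d * z)))).
sw.
Qed.

Lemma Philr_inv_ql :
  \sw_(t1 & t2 & t3 <- Philr_inv A) \sw_(a & b <- lam A t2) \sw_(y1 & y2 & y3 <- Philr_inv A)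
  \sw_(q1 & q2 <- ql) E (S t1 * q1 * a * y1) (q2 * b * y2) (t3 * y3) =
  \sw_(q1 & q2 <- ql) \sw_(a & b <- rho A q2) E q1 a b.
Proof.
rewrite /ql.
step (apply: (Philr_pentl_inv (A := A) (E := fun a b c d => E (S a * alpha * b) c d))).
step (apply: (kill1 (@ev_S k H) (Philr_inv_eps1 A) (E := fun w y z =>
  \sw_(x1 & x2 & x3 <- Phil_inv A) \sw_(c & d <- rho A x3)
  E (S x1 * w * x2) (y * c) (z * d)))).
sw.
Qed.
End Theta.

(** * Modules over a k-algebra seen as vector spaces *)

Section Action.
Variables (k : fieldType) (A : pzAlgebra k) (M : lmodType A).

(** The action of A on [kspace M], where [*:] already denotes scaling by k. *)
Definition am (u : A) (m : kspace M) : kspace M := u *: (m : M).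

Lemma amA u v m : am u (am v m) = am (u * v) m.
Proof. exact: (@scalerA A M u v m). Qed.
Lemma am1 m : am 1 m = m.
Proof. exact: (@scale1r A M m). Qed.
Lemma am_k (a : k) (m : kspace M) : a *: m = am (a *: (1 : A)) m.
Proof. by []. Qed.
Lemma amDl u v m : am (u + v) m = am u m + am v m.
Proof. exact: (@scalerDl A M m u v). Qed.
Lemma amDr u m m' : am u (m + m') = am u m + am u m'.
Proof. exact: (@scalerDr A M u m m'). Qed.
Lemma lin_aml (U : lmodType k) (f : U -> A) (m : kspace M) : lin f -> lin (fun x => am (f x) m).
Proof. by move=> lf a x y; rewrite lf amDl am_k amA -pzscalerAl mul1r. Qed.
Lemma lin_amr (U : lmodType k) (f : U -> kspace M) (u : A) : lin f -> lin (fun x => am u (f x)).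
Proof.
move=> lf a x y; rewrite lf amDr !am_k !amA.
by rewrite -pzscalerAl mul1r -pzscalerAr mulr1.
Qed.
End Action.

Lemma lin_am_r (k : fieldType) (A : pzAlgebra k) (M : lmodType A) (u : A) : lin (@am k A M u).
Proof. exact: lin_amr. Qed.
Lemma lin_am_l (k : fieldType) (A : pzAlgebra k) (M : lmodType A) (m : kspace M) :
  lin (fun u : A => am u m).
Proof. exact: lin_aml. Qed.

#[global] Hint Extern 0 (lin (am _)) => exact: lin_am_r : lindb.
#[global] Hint Extern 0 (lin (fun _ => am _ _)) => exact: lin_am_l : lindb.

Ltac leaf_hook ::= rewrite ?(amA, am1, mulrA, mul1r, mulr1).

(** [front] compares tensors syntactically, so the acting element inside a summed tensor has to be
    normalised too. *)
Ltac nrm_hook t ::=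
  lazymatch t with
  | ?f (am ?u ?m) =>
      let h := fresh in
      assert (h := @erefl _ t);
      rewrite ?[in RHS](amA, am1, mulrA, mul1r, mulr1) in h;
      etransitivity; [apply tsum_congt; exact h|]; clear h
  end.

(** * Modules C (x) A (x)_A N *)

Section Bimod.
Variables (k : fieldType) (H : quasiHopf k) (A : bicomoduleAlgebra H) (C : bimoduleCoalgebra H).
Local Notation D := (C \otimes A)%type.

Definition Dlact (u : A) (d : D) : D :=
  \sw_(c & a <- d) \sw_(v & w <- lam A u) \sw_(w0 & w1 <- rho A w)
    ((w1 |>> c <<| Sinv v) \ot (w0 * a)).
Definition Dract (d : D) (u : A) : D := \sw_(c & a <- d) (c \ot (a * u)).

Lemma lin_Dlactl d : lin (fun u => Dlact u d).
Proof. by rewrite /Dlact; lin_core. Qed.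
Lemma lin_Dlactr u : lin (Dlact u).
Proof. by rewrite /Dlact; lin_core. Qed.
Lemma lin_Dractl u : lin (fun d => Dract d u).
Proof. by rewrite /Dract; lin_core. Qed.
Lemma lin_Dractr d : lin (Dract d).
Proof. by rewrite /Dract; lin_core. Qed.

Lemma Dlact1 d : Dlact 1 d = d.
Proof. rewrite -[RHS]tsum_id /Dlact; sw. Qed.
Lemma DlactM u v d : Dlact (u * v) d = Dlact u (Dlact v d).
Proof. rewrite /Dlact; sw. Qed.
Lemma Dract1 d : Dract d 1 = d.
Proof. rewrite -[RHS]tsum_id /Dract; sw. Qed.
Lemma DractM d u v : Dract d (u * v) = Dract (Dract d u) v.
Proof. rewrite /Dract; sw. Qed.
Lemma Dlract u d v : Dract (Dlact u d) v = Dlact u (Dract d v).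
Proof. rewrite /Dract /Dlact; sw. Qed.

Definition Dbim : bimodule A D :=
  @Bimodule A D Dlact Dract
    (fun r s v => linD (lin_Dlactl v) r s) (fun r => linD (lin_Dlactr r))
    (fun v w r => linD (lin_Dractl r) v w) (fun v => linD (lin_Dractr v))
    Dlact1 DlactM Dract1 DractM Dlract.

Lemma Dlact_ot u c a : Dlact u (c \ot a) =
  \sw_(v & w <- lam A u) \sw_(w0 & w1 <- rho A w) ((w1 |>> c <<| Sinv v) \ot (w0 * a)).
Proof. rewrite /Dlact; nrm. Qed.
Lemma Dract_ot c a u : Dract (c \ot a) u = c \ot (a * u).
Proof. rewrite /Dract; nrm. Qed.
End Bimod.

Section Cofree.
Variables (k : fieldType) (H : quasiHopf k) (A : bicomoduleAlgebra H) (C : bimoduleCoalgebra H).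
Local Notation D := (C \otimes A)%type.
Local Notation Db := (Dbim A C).

(** The carrier of the cofree comodule on N. It is available for every N before the coring
    exists. *)
Definition cofree (N : lmodType A) : Type := btens Db ( *:%R : A -> N -> N).

Section Structure.
Variable N : lmodType A.
Local Notation bal := (balanced (ract Db) ( *:%R : A -> N -> N)).

HB.instance Definition _ := GRing.Zmodule.on (cofree N).

Definition cact (u : A) (z : cofree N) : cofree N := btens_lact Db ( *:%R : A -> N -> N) u z.

Lemma cact_bal u : bal (fun d n => bpure (Dlact u d) n : cofree N).
Proof.
have [Dl Dr M] := pure_balanced (ract Db) ( *:%R : A -> N -> N).
split=> [v v' w|v w w'|v r w].
- by rewrite (linD (lin_Dlactr u)); apply: Dl.
- exact: Dr.
- by rewrite -Dlract; apply: M.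
Qed.

Lemma cact_pure u d (n : N) : cact u (bpure d n) = bpure (Dlact u d) n.
Proof. exact: tsum_pure (cact_bal u). Qed.

Lemma cactDr : right_distributive cact +%R.
Proof. by move=> u s t; apply: tsumD (cact_bal u). Qed.

Lemma cact0 u : cact u 0 = 0.
Proof. exact: tsum0 (cact_bal u). Qed.

Lemma bpureDl d d' (n : N) : bpure (d + d') n = bpure d n + bpure d' n :> cofree N.
Proof. exact: (balancedDl (pure_balanced (ract Db) ( *:%R : A -> N -> N))). Qed.
Lemma bpureDr d (n n' : N) : bpure d (n + n') = bpure d n + bpure d n' :> cofree N.
Proof. exact: (balancedDr (pure_balanced (ract Db) ( *:%R : A -> N -> N))). Qed.
Lemma bpureM d (u : A) (n : N) : bpure (Dract d u) n = bpure d (u *: n) :> cofree N.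
Proof. exact: (balancedM (pure_balanced (ract Db) ( *:%R : A -> N -> N))). Qed.

Lemma cofree_ind (P : cofree N -> Prop) :
  P 0 -> (forall c (a : A) (n : N), P (bpure (c \ot a) n)) -> (forall s t, P s -> P t -> P (s + t)) ->
  forall t, P t.
Proof.
move=> P0 Pp PD; apply: tprod_ind => // d n.
elim/tprod_ind: d => [|c a|s t Hs Ht]; last 1 first.
- by rewrite -/(bpure _ _) [bpure _ _]bpureDl; apply: PD.
- rewrite -/(bpure _ _); suff -> : bpure 0 n = 0 :> cofree N by [].
  by apply: (addIr (bpure 0 n)); rewrite -bpureDl !add0r.
- exact: Pp.
Qed.

Lemma cact1 : left_id 1 cact.
Proof.
by elim/cofree_ind => [|c a n|s t Hs Ht]; rewrite ?cact0 ?cact_pure ?Dlact1 ?cactDr ?Hs ?Ht.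
Qed.
Lemma cactA u v z : cact u (cact v z) = cact (u * v) z.
Proof.
by elim/cofree_ind: z => [|c a n|s t Hs Ht]; rewrite ?cact0 ?cact_pure ?DlactM ?cactDr ?Hs ?Ht.
Qed.
Lemma cactDl z : {morph cact^~ z : u v / u + v}.
Proof.
move=> u v /=; elim/cofree_ind: z => [|c a n|s t Hs Ht].
- by rewrite !cact0 addr0.
- by rewrite !cact_pure (linD (lin_Dlactl _)) bpureDl.
- by rewrite !cactDr Hs Ht addrACA.
Qed.

HB.instance Definition _ :=
  GRing.Zmodule_isLmodule.Build A (cofree N) cactA cact1 cactDr cactDl.
End Structure.

Section Coordinates.
Variable N : lmodType A.
Local Notation Z := (cofree N).

(* [coords] identifies C (x) A (x)_A N with N (x) C, with inverse [cogen]. *)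
Definition cogen (n : kspace N) (c : C) : kspace Z := bpure (c \ot (1 : A)) (n : N).

Definition coords (z : kspace Z) : kspace N \otimes C :=
  \sw_(d & n <- (z : Z)) \sw_(c & a <- d) (am a (n : kspace N) \ot c).

Lemma coords_bal : balanced (ract Db) ( *:%R : A -> N -> N)
  (fun d n => \sw_(c & a <- d) (am a (n : kspace N) \ot c)).
Proof.
have lE (n : kspace N) : lin (fun d : D => \sw_(c & a <- d) (am a n \ot c)) by lin_core.
split=> [v v' w|v w w'|v r w].
- exact: (linD (lE w)).
- rewrite -tsum_split; apply: eq_tsum2 => c a.
  by rewrite [am a _]amDr otDl.
- rewrite /= /Dract; etransitivity; [nrm|]; apply: eq_tsum2 => c a.
  by rewrite -amA.
Qed.

Lemma coords_pure d n : coords (bpure d n) = \sw_(c & a <- d) (am a (n : kspace N) \ot c).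
Proof. exact: tsum_pure coords_bal. Qed.
Lemma coordsD z z' : coords (z + z') = coords z + coords z'.
Proof. exact: tsumD coords_bal. Qed.
Lemma coords0 : coords 0 = 0.
Proof. exact: tsum0 coords_bal. Qed.

Lemma coords_cogen n c : coords (cogen n c) = n \ot c.
Proof. by rewrite /cogen coords_pure tsum_ot ?am1 //; lin_core. Qed.

Lemma cogenDl n n' c : cogen (n + n') c = cogen n c + cogen n' c.
Proof. exact: bpureDr. Qed.
Lemma cogenDr n c c' : cogen n (c + c') = cogen n c + cogen n c'.
Proof. by rewrite /cogen otDl; apply: bpureDl. Qed.

Lemma bpure_cogen c (a : A) (n : N) : bpure (c \ot a) n = cogen (am a n) c :> Z.
Proof. by rewrite /cogen /am -bpureM Dract_ot mul1r. Qed.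

Lemma am_1Z (a : k) (z : kspace Z) : a *: z = am (a *: (1 : A)) z.
Proof. by []. Qed.

Lemma am_cogen_k (a : k) n c : am (a *: (1 : A)) (cogen n c) = cogen n (a *: c).
Proof.
rewrite /am -[LHS]/(cact (a *: (1 : A)) (cogen n c)) /cogen cact_pure.
by rewrite (linZ (lin_Dlactl _)) Dlact1 otZl.
Qed.

Lemma lin_cogen_r n : lin (cogen n).
Proof. by move=> a x y; rewrite cogenDr am_1Z am_cogen_k. Qed.
Lemma lin_cogen_l c : lin (fun n => cogen n c).
Proof.
move=> a x y; rewrite cogenDl am_1Z am_cogen_k; congr (_ + _).
by rewrite am_k -bpure_cogen /cogen otZl otZr.
Qed.

Lemma cogen_bal : bil cogen.
Proof. by split=> [c|n]; [apply: lin_cogen_l|apply: lin_cogen_r]. Qed.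

Lemma cogen_coords z : \sw_(n & c <- coords z) cogen n c = z.
Proof.
elim/cofree_ind: z => [|c a n|s t Hs Ht].
- by rewrite coords0 (tsum0 (bil_bal cogen_bal)).
- rewrite bpure_cogen coords_cogen tsum_ot //; exact: cogen_bal.
- by rewrite coordsD [LHS](tsumD _ _ (bil_bal cogen_bal)) Hs Ht.
Qed.

Lemma coords_inj z z' : coords z = coords z' -> z = z'.
Proof. by move=> e; rewrite -[z]cogen_coords e cogen_coords. Qed.

Lemma coords_am u z : coords (am u z) =
  \sw_(n & c <- coords z) \sw_(v & w <- lam A u) \sw_(w0 & w1 <- rho A w)
    (am w0 n \ot (w1 |>> c <<| Sinv v)).
Proof.
rewrite -[z in LHS]cogen_coords; elim/tprod_ind: (coords z) => [|n c|s t Hs Ht].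
- have bE : bil (fun (n : kspace N) (c : C) => \sw_(v & w <- lam A u) \sw_(w0 & w1 <- rho A w)
    (am w0 n \ot (w1 |>> c <<| Sinv v))) by lin_core.
  rewrite (tsum0 (bil_bal bE)) (tsum0 (bil_bal cogen_bal)).
  by rewrite -[am u 0]/(cact u 0) cact0 coords0.
- rewrite -/(n \ot c) tsum_ot; last exact: cogen_bal.
  rewrite tsum_ot; last by lin_core.
  rewrite /am -[u *: _]/(cact u _) /cogen cact_pure Dlact_ot coords_pure.
  etransitivity; [nrm|]; apply: eq_tsum2 => v w; apply: eq_tsum2 => w0 w1.
  by rewrite mulr1.
- have bE : bil (fun (n : kspace N) (c : C) => \sw_(v & w <- lam A u) \sw_(w0 & w1 <- rho A w)
    (am w0 n \ot (w1 |>> c <<| Sinv v))) by lin_core.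
  rewrite [in LHS](tsumD _ _ (bil_bal cogen_bal)) [RHS](tsumD _ _ (bil_bal bE)) -Hs -Ht.
  by rewrite amDr coordsD.
Qed.

Lemma coords_tsum t : coords (tsum t cogen) = t.
Proof.
elim/tprod_ind: t => [|n c|s t Hs Ht].
- by rewrite (tsum0 (bil_bal cogen_bal)) coords0.
- by rewrite -/(n \ot c) tsum_ot ?coords_cogen //; exact: cogen_bal.
- by rewrite [in LHS](tsumD _ _ (bil_bal cogen_bal)) coordsD Hs Ht.
Qed.

Lemma lin_coords : lin coords.
Proof.
move=> a x y; rewrite -[RHS]coords_tsum; congr coords.
have l : lin (fun t : kspace N \otimes C => tsum t cogen) by refine (@lin_tsumt _ _ _ _ _ _ _ _ _); [lin_core|exact: cogen_bal].
by rewrite l !cogen_coords.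
Qed.
End Coordinates.
End Cofree.

#[global] Hint Extern 0 (lin (@coords _ _ _ _ _)) => exact: lin_coords : lindb.
#[global] Hint Extern 0 (lin (cogen _)) => exact: lin_cogen_r : lindb.
#[global] Hint Extern 0 (lin (fun _ => cogen _ _)) => exact: lin_cogen_l : lindb.

Ltac nrm_expand t ::=
  lazymatch t with
  | coords (am _ _) => apply coords_am
  | coords (cogen _ _) => apply coords_cogen
  | DeltaC (lactC _ _) => apply DeltaC_lact
  | DeltaC (ractC _ _) => apply DeltaC_ract
  end.

(** * Universal property of the cofree modules *)

Section Universal.
Variables (k : fieldType) (H : quasiHopf k) (A : bicomoduleAlgebra H) (C : bimoduleCoalgebra H).
Local Notation pl := (pl A). Local Notation ql := (ql A).
Local Notation cofree := (cofree C).
Implicit Types (L M N : lmodType A) (Z : lmodType k).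

(** The map pi, read through [coords]; it equals [coords] when Phi_lambda and alpha are trivial. *)
Definition cofree_ev N (z : kspace (cofree N)) : kspace N \otimes C :=
  \sw_(n & c <- coords z) \sw_(q1 & q2 <- ql) \sw_(a & b <- rho A q2)
    (am a n \ot (b |>> c <<| Sinv q1)).

Lemma lin_pi N : lin (@cofree_ev N).
Proof. by rewrite /cofree_ev; lin_core. Qed.

Definition compat M N (phi : kspace M -> kspace N \otimes C) : Prop := forall (u : A) m,
  \sw_(a & b <- rho A u) \sw_(n & c <- phi m) (am a n \ot (b |>> c)) =
  \sw_(v & w <- lam A u) \sw_(n & c <- phi (am w m)) (n \ot (c <<| v)).

Lemma compatE M N (phi : kspace M -> kspace N \otimes C) Z (E : kspace N -> C -> Z) u m :
  compat phi -> bil E ->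
  \sw_(a & b <- rho A u) \sw_(n & c <- phi m) E (am a n) (b |>> c) =
  \sw_(v & w <- lam A u) \sw_(n & c <- phi (am w m)) E n (c <<| v).
Proof. move=> cphi lE; cps (sw2 E) (cphi u m). Qed.

Lemma compat_pi N : compat (@cofree_ev N).
Proof.
move=> u z; rewrite /cofree_ev.
step (apply/esym/(ql_lam A (E := fun x y => \sw_(n & c <- coords z) \sw_(a & b <- rho A y)
  (am a n \ot (b |>> c <<| Sinv x))) _ u)).
sw.
Qed.

(** By [pl_ql], z is recovered from the values of pi at the elements p2 z. *)
Lemma pi_pl N Z (E : kspace N -> C -> Z) z : bil E ->
  \sw_(p1 & p2 <- pl) \sw_(n & c <- cofree_ev (am p2 z)) E n (c <<| p1) = \sw_(n & c <- coords z) E n c.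
Proof.
move=> lE; rewrite /cofree_ev.
step (apply: (pl_ql A (E := fun x y => \sw_(n & c <- coords z) \sw_(a & b <- rho A y)
  E (am a n) (b |>> c <<| Sinv x)))).
sw.
Qed.

Section Lift.
Variables (M N : lmodType A) (phi : kspace M -> kspace N \otimes C).
Hypotheses (lphi : lin phi) (cphi : compat phi).

Definition lift (m : kspace M) : kspace (cofree N) :=
  \sw_(p1 & p2 <- pl) \sw_(n & c <- phi (am p2 m)) cogen n (c <<| p1).

Lemma lin_lift : lin lift.
Proof. by rewrite /lift; lin_core. Qed.

Lemma coords_lift m : coords (lift m) = \sw_(p1 & p2 <- pl) \sw_(n & c <- phi (am p2 m)) (n \ot (c <<| p1)).
Proof.
rewrite /lift (@tsum_ext _ _ _ _ _ _ _ (@coords _ _ _ C N)); last exact: lin_coords.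
apply: eq_tsum2 => p1 p2; rewrite (@tsum_ext _ _ _ _ _ _ _ (@coords _ _ _ C N)); last exact: lin_coords.
by apply: eq_tsum2 => n c; rewrite coords_cogen.
Qed.

Lemma pi_lift m : cofree_ev (lift m) = phi m.
Proof.
rewrite /cofree_ev coords_lift -[RHS]tsum_id.
step (apply: (under2 pl) => p1 p2; apply: (under2 ql) => q1 q2;
  apply: (compatE (E := fun n c => n \ot (c <<| (p1 * Sinv q1))) q2 (am p2 m) cphi)).
step (apply: (ql_pl A (E := fun x y => \sw_(n & c <- phi (am y m)) (n \ot (c <<| x))))).
sw.
Qed.

Lemma lift_am u m : lift (am u m) = am u (lift m).
Proof.
apply: coords_inj; rewrite coords_lift coords_am coords_lift.
step (apply/esym/(pl_lam A (E := fun x y => \sw_(n & c <- phi (am y m)) (n \ot (c <<| x))) _ u)).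
step (apply: (under2 (lam A u)) => v w; apply: (under2 pl) => p1 p2;
  apply/esym/(compatE (E := fun n c => n \ot (c <<| (p1 * Sinv v))) w (am p2 m) cphi)).
sw.
Qed.
End Lift.

Lemma lift_pi M N (f : kspace M -> kspace (cofree N)) m :
  (forall u m, f (am u m) = am u (f m)) -> lift (fun m => cofree_ev (f m)) m = f m.
Proof.
move=> fA; rewrite /lift -[RHS]cogen_coords.
etransitivity; last by apply: (pi_pl (E := fun n c => cogen n c)); lin_core.
by apply: eq_tsum2 => p1 p2; rewrite fA.
Qed.

Lemma pi_inj M N (f f' : kspace M -> kspace (cofree N)) :
  (forall u m, f (am u m) = am u (f m)) -> (forall u m, f' (am u m) = am u (f' m)) ->
  (forall m, cofree_ev (f m) = cofree_ev (f' m)) -> f =1 f'.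
Proof.
move=> fA fA' e m; rewrite -(lift_pi m fA) -(lift_pi m fA').
by congr (lift _ m); apply: boolp.funext.
Qed.
End Universal.

#[global] Hint Extern 0 (lin (@cofree_ev _ _ _ _ _)) => exact: lin_pi : lindb.

(** * Iterated coactions *)

Section TwoFold.
Variables (k : fieldType) (H : quasiHopf k) (A : bicomoduleAlgebra H) (C : bimoduleCoalgebra H).
Local Notation pl := (pl A). Local Notation ql := (ql A).
Local Notation cofree := (cofree C).
Local Notation pi := (@cofree_ev k H A C _).
Implicit Types (L M N : lmodType A) (Z : lmodType k).

(* With [phi = psi] the coaction of M, [star] and [cosplit] are the two sides of
   the coassociativity axiom of Yetter-Drinfeld modules. *)
Definition star L M N (psi : kspace N -> kspace L \otimes C) (phi : kspace M -> kspace N \otimes C)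
    (m : kspace M) : kspace L \otimes (C \otimes C) :=
  \sw_(t1 & t2 & t3 <- Philr_inv A) \sw_(n & c <- phi m) \sw_(l & c' <- psi (am t2 n))
    (l \ot (c' <<| t1) \ot (t3 |>> c)).

Definition cosplit M N (phi : kspace M -> kspace N \otimes C) (m : kspace M) :
    kspace N \otimes (C \otimes C) :=
  \sw_(x1 & x2 & x3 <- Phir_inv A) \sw_(y1 & y2 & y3 <- Phil_inv A)
  \sw_(n & c <- phi (am y3 m)) \sw_(c1 & c2 <- DeltaC c)
    (am x1 n \ot (x2 |>> c1 <<| y1) \ot (x3 |>> c2 <<| y2)).

(** [compat] with C (x) C as coefficients, acted on through the iterates of rho and lambda. Both
    sides of the coassociativity axiom satisfy it, and it is the condition under which [star pi] can
    be inverted. *)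
Definition compat2 L M (psi : kspace M -> kspace L \otimes (C \otimes C)) : Prop := forall (u : A) m,
  \sw_(a & b <- rho A u) \sw_(a' & b' <- rho A a) \sw_(l & c & c' <- psi m)
    (am a' l \ot (b' |>> c) \ot (b |>> c')) =
  \sw_(v & w <- lam A u) \sw_(v' & w' <- lam A w) \sw_(l & c & c' <- psi (am w' m))
    (l \ot (c <<| v) \ot (c' <<| v')).

Lemma compat2E L M (psi : kspace M -> kspace L \otimes (C \otimes C)) Z
    (E : kspace L -> C -> C -> Z) u m : compat2 psi -> mlin3 E ->
  \sw_(a & b <- rho A u) \sw_(a' & b' <- rho A a) \sw_(l & c & c' <- psi m)
    E (am a' l) (b' |>> c) (b |>> c') =
  \sw_(v & w <- lam A u) \sw_(v' & w' <- lam A w) \sw_(l & c & c' <- psi (am w' m))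
    E l (c <<| v) (c' <<| v').
Proof. move=> cpsi lE; cps (sw3 E) (cpsi u m). Qed.

Lemma tsum3_id (U V W : lmodType k) (t : U \otimes (V \otimes W)) :
  \sw_(a & b & c <- t) (a \ot b \ot c) = t.
Proof.
rewrite -[RHS]tsum_id; apply: eq_tsum2 => a b.
by rewrite -[b in RHS]tsum_id (@tsum_ext _ _ _ _ _ _ _ (fun x => a \ot x)) //; lin_core.
Qed.

Lemma compat2_cosplit M N (phi : kspace M -> kspace N \otimes C) :
  lin phi -> compat phi -> compat2 (cosplit phi).
Proof.
move=> lphi cphi u m; symmetry; rewrite /cosplit.
step (apply: (lam_Phil_inv A (E := fun a b w => \sw_(x1 & x2 & x3 <- Phir_inv A)
  \sw_(n & c <- phi (am w m)) \sw_(c1 & c2 <- DeltaC c)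
  (am x1 n \ot (x2 |>> c1 <<| a) \ot (x3 |>> c2 <<| b))) _ u)).
step (apply: (under3 (Phil_inv A)) => y1 y2 y3; apply/esym/(compatE (E := fun n c =>
  \sw_(x1 & x2 & x3 <- Phir_inv A) \sw_(c1 & c2 <- DeltaC c)
  (am x1 n \ot (x2 |>> c1 <<| y1) \ot (x3 |>> c2 <<| y2))) u (am y3 m) cphi)).
step (apply/esym/(rho_Phir_inv A (E := fun x1 x2 x3 =>
  \sw_(y1 & y2 & y3 <- Phil_inv A) \sw_(n & c <- phi (am y3 m)) \sw_(c1 & c2 <- DeltaC c)
  (am x1 n \ot (x2 |>> c1 <<| y1) \ot (x3 |>> c2 <<| y2))) u)).
sw.
Qed.

Lemma compat2_star L M N (psi : kspace N -> kspace L \otimes C) (phi : kspace M -> kspace N \otimes C) :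
  lin psi -> lin phi -> compat psi -> compat phi -> compat2 (star psi phi).
Proof.
move=> lpsi lphi cpsi cphi u m; symmetry; rewrite /star.
step (apply: (under2 (lam A u)) => v w; apply/esym/(compatE (E := fun n c =>
  \sw_(t1 & t2 & t3 <- Philr_inv A) \sw_(l & c' <- psi (am t2 n))
    (l \ot (c' <<| (t1 * v)) \ot (t3 |>> c))) w m cphi)).
step (apply: (lam_rho_Philr_inv (A := A) (E := fun x y z => \sw_(n & c <- phi m)
  \sw_(l & c' <- psi (am y n)) (l \ot (c' <<| x) \ot (z |>> c))) u)).
step (apply: (under3 (Philr_inv A)) => t1 t2 t3; apply: (under2 (phi m)) => n c;
  apply: (under2 (rho A u)) => a b; apply/esym/(compatE (E := fun l c' =>
   (l \ot (c' <<| t1) \ot (b |>> (t3 |>> c)))) a (am t2 n) cpsi)).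
sw.
Qed.

(** [Philr_pl] with one copy of Theta moved to the other side. *)
Lemma Philr_inv_pl Z (E : H -> A -> H -> Z) : mlin3 E ->
  \sw_(t1 & t2 & t3 <- Philr_inv A) \sw_(p1 & p2 <- pl) \sw_(a & b <- rho A p2)
    E (t1 * p1) (t2 * a) (t3 * b) =
  \sw_(Y1 & Y2 & Y3 <- Philr A) \sw_(a & b <- lam A Y2) \sw_(p1 & p2 <- pl)
    E (a * p1 * Sinv Y1) (b * p2) Y3.
Proof.
move=> lE.
step (apply: (under3 (Philr_inv A)) => t1 t2 t3; apply/esym/(Philr_pl (A := A) (E := fun x y z =>
  E (t1 * x) (t2 * y) (t3 * z)))).
step (apply: (Philr_invl (A := A) (E := fun x y z =>
  \sw_(Y1 & Y2 & Y3 <- Philr A) \sw_(a & b <- lam A Y2) \sw_(p1 & p2 <- pl)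
    E (x * a * p1 * Sinv Y1) (y * b * p2) (z * Y3)))).
sw.
Qed.

Lemma ot_coords N (z : kspace (cofree N)) (c : C) :
  z \ot c = \sw_(n & c0 <- coords z) (cogen n c0 \ot c).
Proof.
by rewrite -[z in LHS]cogen_coords (@tsum_ext _ _ _ _ _ _ _ (fun x => x \ot c)) //; lin_core.
Qed.

Section Tilde.
Variables (L M : lmodType A) (psi : kspace M -> kspace L \otimes (C \otimes C)).
Hypotheses (lpsi : lin psi) (cpsi : compat2 psi).

(* Inverse of [star pi]. *)
Definition tilde (m : kspace M) : kspace (cofree L) \otimes C :=
  \sw_(p1 & p2 <- pl) \sw_(s & r <- lam A p2) \sw_(l & c & c' <- psi (am r m))
  \sw_(t1 & t2 & t3 <- Philr_inv A) \sw_(a & b <- rho A t2)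
    (cogen (am a l) (b |>> c <<| p1 <<| Sinv t1) \ot (t3 |>> c' <<| s)).

Lemma lin_tilde : lin tilde.
Proof. by rewrite /tilde; lin_core. Qed.

(** [Philr_inv_ql] absorbs the two copies of Theta^-1, one from [star] and one from [tilde]; after
    that the argument is that of [pi_lift]. *)
Lemma star_tilde m : star pi tilde m = psi m.
Proof.
rewrite /star /tilde /cofree_ev -[RHS]tsum3_id.
step (apply: (Philr_inv_ql (A := A) (E := fun x y z =>
  \sw_(p1 & p2 <- pl) \sw_(s & r <- lam A p2) \sw_(l & c & c' <- psi (am r m))
  \sw_(a & b <- rho A y)
    (am a l \ot (b |>> c <<| p1 <<| Sinv x) \ot (z |>> c' <<| s))))).
step (apply: (under2 pl) => p1 p2; apply: (under2 (lam A p2)) => s r; apply: (under2 ql) => q1 q2;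
  apply: (compat2E (E := fun l c c' => (l \ot (c <<| p1 <<| Sinv q1) \ot (c' <<| s))) q2 (am r m) cpsi)).
step (apply: (ql_pl A (E := fun x y => \sw_(s & r <- lam A y) \sw_(l & c & c' <- psi (am r m))
   (l \ot (c <<| x) \ot (c' <<| s))))).
sw.
Qed.

Lemma compat_tilde : compat tilde.
Proof.
move=> u m.
(* The first tensor factor is put in coordinates, since the action on a cofree module is computed by
   [coords_am]. *)
transitivity (\sw_(a & b <- rho A u) \sw_(z & c <- tilde m) \sw_(n & c0 <- coords (am a z))
  (cogen n c0 \ot (b |>> c))).
  by apply: under2 => a b; apply: under2 => z c; apply: ot_coords.
transitivity (\sw_(v & w <- lam A u) \sw_(z & c <- tilde (am w m)) \sw_(n & c0 <- coords z)
  (cogen n c0 \ot (c <<| v))); last first.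
  by apply: under2 => a b; apply: under2 => z c; symmetry; apply: ot_coords.
symmetry; rewrite /tilde.
step (apply/esym/(pl_lam A (E := fun x y => \sw_(s & r <- lam A y) \sw_(l & c & c' <- psi (am r m))
  \sw_(t1 & t2 & t3 <- Philr_inv A) \sw_(a & b <- rho A t2)
    (cogen (am a l) (b |>> c <<| x <<| Sinv t1) \ot (t3 |>> c' <<| s))) _ u)).
step (apply: (under2 (lam A u)) => v w; apply: (under2 pl) => p1 p2;
  apply: (under2 (lam A p2)) => s r;
  apply/esym/(compat2E (E := fun l c c' =>
  \sw_(t1 & t2 & t3 <- Philr_inv A) \sw_(a & b <- rho A t2)
    (cogen (am a l) (b |>> c <<| p1 <<| Sinv v <<| Sinv t1) \ot (t3 |>> c' <<| s))) w (am r m) cpsi)).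
step (apply: (lam_rho_Philr_inv (A := A) (E := fun x y z =>
  \sw_(p1 & p2 <- pl) \sw_(s & r <- lam A p2) \sw_(l & c & c' <- psi (am r m)) \sw_(a & b <- rho A y)
    (cogen (am a l) (b |>> c <<| p1 <<| Sinv x) \ot (z |>> c' <<| s))) u)).
sw.
Qed.
End Tilde.

Lemma tilde_star L M (a : kspace M -> kspace (cofree L) \otimes C) m :
  lin a -> compat a -> tilde (star pi a) m = a m.
Proof.
move=> la ca; rewrite /tilde /star.
transitivity (\sw_(z & c <- a m) \sw_(n & c0 <- coords z) (cogen n c0 \ot c)); last first.
  by rewrite -[RHS]tsum_id; apply: under2 => z c; rewrite -ot_coords.
step (apply: (under2 pl) => p1 p2; apply/esym/(compatE (E := fun z c =>
  \sw_(t1' & t2' & t3' <- Philr_inv A) \sw_(l & c' <- pi (am t2' z))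
  \sw_(t1 & t2 & t3 <- Philr_inv A) \sw_(e & f <- rho A t2)
   (cogen (am e l) (f |>> c' <<| t1' <<| p1 <<| Sinv t1) \ot (t3 |>> (t3' |>> c)))) p2 m ca)).
step (apply: (Philr_inv_pl (E := fun x y z => \sw_(w & c <- a m) \sw_(l & c' <- pi (am y w))
  \sw_(t1 & t2 & t3 <- Philr_inv A) \sw_(e & f <- rho A t2)
   (cogen (am e l) (f |>> c' <<| x <<| Sinv t1) \ot (t3 |>> (z |>> c)))))).
step (apply: (under3 (Philr A)) => Y1 Y2 Y3; apply: (under2 pl) => p1 p2;
  apply: (under2 (a m)) => w c; apply/esym/(compatE (E := fun l c' =>
  \sw_(t1 & t2 & t3 <- Philr_inv A) \sw_(e & f <- rho A t2)
   (cogen (am e l) (f |>> c' <<| p1 <<| Sinv Y1 <<| Sinv t1) \ot (t3 |>> (Y3 |>> c)))) Y2 (am p2 w)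
   (@compat_pi k H A C L))).
step (apply: (Philr_invl (A := A) (E := fun x y z => \sw_(p1 & p2 <- pl) \sw_(w & c <- a m)
  \sw_(l & c' <- pi (am p2 w)) \sw_(e & f <- rho A y)
   (cogen (am e l) (f |>> c' <<| p1 <<| Sinv x) \ot (z |>> c))))).
step (apply: (under2 (a m)) => w c; apply: (pi_pl (E := fun n c0 => cogen n c0 \ot c) w)).
sw.
Qed.
End TwoFold.

(** * Threefold iterates and coherence *)

Section ThreeFold.
Variables (k : fieldType) (H : quasiHopf k) (A : bicomoduleAlgebra H) (C : bimoduleCoalgebra H).
Local Notation pl := (pl A).
Local Notation cofree := (cofree C).
Local Notation pi := (@cofree_ev k H A C _).
Implicit Types (L M N : lmodType A) (Z : lmodType k).

Lemma Phi_invl Z (E : H -> H -> H -> Z) : mlin3 E ->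
  \sw_(x1 & x2 & x3 <- Phi_inv H) \sw_(X1 & X2 & X3 <- Phi H)
    E (x1 * X1) (x2 * X2) (x3 * X3) = E 1 1 1.
Proof. move=> lE; cps (sw3 E) (PhiV H).2. Qed.

(** Phi acts on C from both sides, so solving the coassociativity axiom takes two cancellations, one
    for each side. *)
Lemma DeltaC_coassoc_inv Z (E : C -> C -> C -> Z) (c : C) : mlin3 E ->
  \sw_(c1 & c2 <- DeltaC c) \sw_(a & b <- DeltaC c1) E a b c2 =
  \sw_(x1 & x2 & x3 <- Phi_inv H) \sw_(c1 & c2 <- DeltaC c) \sw_(a & b <- DeltaC c2)
  \sw_(X1 & X2 & X3 <- Phi H)
    E (x1 |>> c1 <<| X1) (x2 |>> a <<| X2) (x3 |>> b <<| X3).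
Proof.
move=> lE.
have h (F : C -> C -> C -> Z) : mlin3 F ->
  \sw_(X1 & X2 & X3 <- Phi H) \sw_(c1 & c2 <- DeltaC c) \sw_(a & b <- DeltaC c1)
  \sw_(x1 & x2 & x3 <- Phi_inv H)
    F (X1 |>> a <<| x1) (X2 |>> b <<| x2) (X3 |>> c2 <<| x3) =
  \sw_(c1 & c2 <- DeltaC c) \sw_(a & b <- DeltaC c2) F c1 a b.
  by move=> lF; cps (sw3 F) (DeltaC_coassoc c).
symmetry.
step (apply: (under3 (Phi_inv H)) => x1 x2 x3; apply/esym/(h (fun p q r =>
  \sw_(X1 & X2 & X3 <- Phi H)
    E (x1 |>> p <<| X1) (x2 |>> q <<| X2) (x3 |>> r <<| X3)))).
step (apply: (Phi_invl (E := fun x y z => \sw_(c1 & c2 <- DeltaC c) \sw_(a & b <- DeltaC c1)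
  \sw_(x1 & x2 & x3 <- Phi_inv H) \sw_(X1 & X2 & X3 <- Phi H)
   E (x |>> a <<| x1 <<| X1) (y |>> b <<| x2 <<| X2) (z |>> c2 <<| x3 <<| X3)))).
step (apply: (Phi_invl (E := fun x y z => \sw_(c1 & c2 <- DeltaC c) \sw_(a & b <- DeltaC c1)
   E (a <<| x) (b <<| y) (c2 <<| z)))).
sw.
Qed.

(* [star pi] with C (x) C in place of C. *)
Definition star3 L M (b : kspace M -> kspace (cofree L) \otimes (C \otimes C)) (m : kspace M)
  : kspace L \otimes (C \otimes (C \otimes C)) :=
  \sw_(t1 & t2 & t3 <- Philr_inv A) \sw_(e & f <- rho A t2) \sw_(s1 & s2 & s3 <- Philr_inv A)
  \sw_(z & c & c' <- b m) \sw_(l & c0 <- pi (am (s2 * e) z))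
    (l \ot (c0 <<| (s1 * t1)) \ot (s3 * f |>> c) \ot (t3 |>> c')).

(** First half of the inversion of [star3]: p undoes pi, which leaves two copies of Theta acting on
    b. *)
Lemma star3_Philr L M (b : kspace M -> kspace (cofree L) \otimes (C \otimes C)) m Z
    (F : kspace L -> C -> C -> C -> Z) : lin b -> compat2 b -> mlin4 F ->
  \sw_(p1 & p2 <- pl) \sw_(s & r <- lam A p2) \sw_(s' & r' <- lam A r)
  \sw_(l & c0 & c & c' <- star3 b (am r' m)) F l (c0 <<| p1) (c <<| s) (c' <<| s') =
  \sw_(Y1 & Y2 & Y3 <- Philr A) \sw_(a & d <- rho A Y2) \sw_(a0 & a1 <- rho A a)
  \sw_(W1 & W2 & W3 <- Philr A) \sw_(w0 & w1 <- rho A W2)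
  \sw_(z & c & c' <- b m) \sw_(l & c0 <- coords z)
    F (am (a0 * w0) l) (a1 * w1 |>> c0 <<| (Sinv W1 * Sinv Y1)) (d * W3 |>> c) (Y3 |>> c').
Proof.
move=> lb cb lF; rewrite /star3.
step (apply: (under2 pl) => p1 p2; apply/esym/(compat2E (E := fun z c c' =>
  \sw_(t1 & t2 & t3 <- Philr_inv A) \sw_(e & f <- rho A t2) \sw_(s1 & s2 & s3 <- Philr_inv A)
  \sw_(l & c0 <- pi (am (s2 * e) z))
    F l (c0 <<| (s1 * t1) <<| p1) (s3 * f |>> c) (t3 |>> c')) p2 m cb)).
step (apply: (Philr_inv_pl (E := fun x y w => 
   \sw_(e & f <- rho A y) \sw_(s1 & s2 & s3 <- Philr_inv A)
  \sw_(z & c & c' <- b m) \sw_(l & c0 <- pi (am (s2 * e) z))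
    F l (c0 <<| (s1 * x)) (s3 * f |>> c) (w |>> c')))).
step (apply: (under3 (Philr A)) => Y1 Y2 Y3; apply: (lam_rho_Philr_inv (A := A) (E := fun x y w =>
  \sw_(p1 & p2 <- pl) \sw_(e & f <- rho A p2) \sw_(z & c & c' <- b m) \sw_(l & c0 <- pi (am (y * e) z))
    F l (c0 <<| (x * p1 * Sinv Y1)) (w * f |>> c) (Y3 |>> c')) Y2)).
step (apply: (under3 (Philr A)) => Y1 Y2 Y3; apply: (under2 (rho A Y2)) => a d;
  apply: (under3 (Philr_inv A)) => t1 t2 t3; apply: (under2 pl) => p1 p2;
  apply: (under2 (rho A p2)) => e f; apply: (under3 (b m)) => z c c';
  apply/esym/(compatE (E := fun l c0 => F l (c0 <<| (t1 * p1 * Sinv Y1)) (d * t3 * f |>> c) (Y3 |>> c'))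
    a (am (t2 * e) z) (@compat_pi k H A C L))).
step (apply: (under3 (Philr A)) => Y1 Y2 Y3; apply: (under2 (rho A Y2)) => a d;
  apply: (under2 (rho A a)) => a0 a1;
  apply: (Philr_inv_pl (E := fun x y w => \sw_(z & c & c' <- b m) \sw_(l & c0 <- pi (am y z))
    F (am a0 l) (a1 |>> c0 <<| (x * Sinv Y1)) (d * w |>> c) (Y3 |>> c')))).
step (apply: (under3 (Philr A)) => Y1 Y2 Y3; apply: (under2 (rho A Y2)) => a d;
  apply: (under2 (rho A a)) => a0 a1; apply: (under3 (Philr A)) => W1 W2 W3; apply: (under2 pl) => p1 p2;
  apply: (under3 (b m)) => z c c';
  apply/esym/(compatE (E := fun l c0 => F (am a0 l) (a1 |>> c0 <<| (p1 * Sinv W1 * Sinv Y1)) (d * W3 |>> c) (Y3 |>> c'))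
    W2 (am p2 z) (@compat_pi k H A C L))).
step (apply: (under3 (Philr A)) => Y1 Y2 Y3; apply: (under2 (rho A Y2)) => a d;
  apply: (under2 (rho A a)) => a0 a1; apply: (under3 (Philr A)) => W1 W2 W3;
  apply: (under2 (rho A W2)) => w0 w1;
  apply: (under3 (b m)) => z c c';
  apply: (pi_pl (E := fun l c0 => F (am (a0 * w0) l) (a1 * w1 |>> c0 <<| (Sinv W1 * Sinv Y1)) (d * W3 |>> c) (Y3 |>> c'))
    z)).
sw.
Qed.

(** The two copies of Theta left by [star3_Philr] are cancelled by two copies of Theta^-1, the outer
    one before the inner one. *)
Lemma star3_recover L M (b : kspace M -> kspace (cofree L) \otimes (C \otimes C)) m Z
    (E : kspace L -> C -> C -> C -> Z) : lin b -> compat2 b -> mlin4 E ->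
  \sw_(p1 & p2 <- pl) \sw_(s & r <- lam A p2) \sw_(s' & r' <- lam A r)
  \sw_(l & c0 & c & c' <- star3 b (am r' m))
  \sw_(T1 & T2 & T3 <- Philr_inv A) \sw_(g & h <- rho A T2)
  \sw_(t1 & t2 & t3 <- Philr_inv A) \sw_(a & d <- rho A t2) \sw_(a0 & a1 <- rho A a)
    E (am (g * a0) l) (h * a1 |>> c0 <<| p1 <<| Sinv (T1 * t1)) (T3 * d |>> c <<| s) (t3 |>> c' <<| s')
  = \sw_(z & c & c' <- b m) \sw_(n & c0 <- coords z) E n c0 c c'.
Proof.
move=> lb cb lE.
have lF : mlin4 (fun (l : kspace L) (c0 c c' : C) => \sw_(T1 & T2 & T3 <- Philr_inv A) \sw_(g & h <- rho A T2)
  \sw_(t1 & t2 & t3 <- Philr_inv A) \sw_(a & d <- rho A t2) \sw_(a0 & a1 <- rho A a)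
    E (am (g * a0) l) (h * a1 |>> c0 <<| Sinv (T1 * t1)) (T3 * d |>> c) (t3 |>> c')).
  lin_core.
step (apply: (star3_Philr m lb cb lF)).
step (apply: (Philr_invl (A := A) (E := fun x y w => 
  \sw_(T1 & T2 & T3 <- Philr_inv A) \sw_(g & h <- rho A T2)
  \sw_(W1 & W2 & W3 <- Philr A) \sw_(w0 & w1 <- rho A W2)
  \sw_(a & d <- rho A y) \sw_(a0 & a1 <- rho A a) \sw_(z & c & c' <- b m) \sw_(l & c0 <- coords z)
    E (am (g * a0 * w0) l) (h * a1 * w1 |>> c0 <<| Sinv (T1 * x * W1)) (T3 * d * W3 |>> c) (w |>> c')))).
step (apply: (Philr_invl (A := A) (E := fun x y w => 
  \sw_(a & d <- rho A y) \sw_(z & c & c' <- b m) \sw_(l & c0 <- coords z)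
    E (am a l) (d |>> c0 <<| Sinv x) (w |>> c) c'))).
sw.
Qed.

Lemma star3_inj L M (b b' : kspace M -> kspace (cofree L) \otimes (C \otimes C)) :
  lin b -> compat2 b -> lin b' -> compat2 b' -> (forall m, star3 b m = star3 b' m) -> b =1 b'.
Proof.
move=> lb cb lb' cb' e m.
have r (b0 : kspace M -> kspace (cofree L) \otimes (C \otimes C)) :
  \sw_(z & c & c' <- b0 m) \sw_(n & c0 <- coords z) (cogen n c0 \ot c \ot c') = b0 m.
  rewrite -[RHS]tsum3_id; apply: (under3 (b0 m)) => z c c'.
  by rewrite -[z in RHS]cogen_coords (@tsum_ext _ _ _ _ _ _ _ (fun x => x \ot (c \ot c'))) //; lin_core.
rewrite -[LHS]r -[RHS]r.
etransitivity; [symmetry; apply: (star3_recover m (E := fun n c0 c c' => cogen n c0 \ot c \ot c') lb cb); lin_core|].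
etransitivity; [|apply: (star3_recover m (E := fun n c0 c c' => cogen n c0 \ot c \ot c') lb' cb'); lin_core].
by apply: under2 => p1 p2; apply: under2 => s r'; apply: under2 => s' r''; rewrite e.
Qed.

Section Coherence.
Variables (L M : lmodType A) (phi : kspace (cofree L) -> kspace (cofree L) \otimes C).
Hypotheses (lphi : lin phi) (cphi : compat phi) (phiQ : forall z, star pi phi z = cosplit pi z).

Lemma tsum4_id (U V W X : lmodType k) (t : U \otimes (V \otimes (W \otimes X))) :
  \sw_(a & b & c & d <- t) (a \ot b \ot c \ot d) = t.
Proof.
rewrite -[RHS]tsum_id; apply: eq_tsum2 => a b.
by rewrite -[b in RHS]tsum3_id (@tsum_ext _ _ _ _ _ _ _ (fun x => a \ot x)) //;
  [apply: eq_tsum2 => c d; rewrite (@tsum_ext _ _ _ _ _ _ _ (fun x => a \ot x)) //|]; lin_core.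
Qed.

Lemma star_phiE Z (E : kspace L -> C -> C -> Z) z : mlin3 E ->
  \sw_(t1 & t2 & t3 <- Philr_inv A) \sw_(n & c <- phi z) \sw_(l & c' <- pi (am t2 n))
    E l (c' <<| t1) (t3 |>> c) =
  \sw_(x1 & x2 & x3 <- Phir_inv A) \sw_(y1 & y2 & y3 <- Phil_inv A)
  \sw_(n & c <- pi (am y3 z)) \sw_(c1 & c2 <- DeltaC c)
    E (am x1 n) (x2 |>> c1 <<| y1) (x3 |>> c2 <<| y2).
Proof. by move=> lE; have h := phiQ z; rewrite /star /cosplit in h; cps (sw3 E) h. Qed.

(** Under [star3] the hypothesis [phiQ] applies twice, and every phi is replaced by pi followed by
    the comultiplication of C. *)
Lemma star3_starE Z (E : kspace L -> C -> C -> C -> Z) z : mlin4 E ->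
  \sw_(l & a & b & c <- star3 (star phi phi) z) E l a b c =
  \sw_(x1 & x2 & x3 <- Phir_inv A) \sw_(y1 & y2 & y3 <- Phil_inv A) \sw_(v & w <- lam A y3)
  \sw_(x1' & x2' & x3' <- Phir_inv A) \sw_(y1' & y2' & y3' <- Phil_inv A)
  \sw_(l & d <- pi (am (y3' * w) z)) \sw_(d1 & d2 <- DeltaC d) \sw_(c1 & c2 <- DeltaC (x2' |>> d1 <<| y1'))
    E (am (x1 * x1') l) (x2 |>> c1 <<| y1) (x3 |>> c2 <<| y2) (x3' |>> d2 <<| (y2' * v)).
Proof.
move=> lE; rewrite /star3 /star.
step (apply: (under3 (Philr_inv A)) => t1 t2 t3; apply: (under3 (Philr_inv A)) => s1 s2 s3;
  apply: (under2 (phi z)) => n c;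
  apply: (compatE (E := fun l c' => \sw_(r1 & r2 & r3 <- Philr_inv A) \sw_(e & c0 <- pi (am r2 l))
    E e (c0 <<| (r1 * t1)) (r3 |>> c' <<| s1) (t3 * s3 |>> c)) t2 (am s2 n) cphi)).
step (apply: (under3 (Philr_inv A)) => t1 t2 t3; apply: (under3 (Philr_inv A)) => s1 s2 s3;
  apply: (under2 (lam A t2)) => v w; apply: (under2 (phi z)) => n c;
  apply: (star_phiE (E := fun e c0 c' => 
    E e (c0 <<| t1) (c' <<| (v * s1)) (t3 * s3 |>> c)) (am (w * s2) n))).
step (apply: (Philr_pentl_inv (A := A) (E := fun p q r s => \sw_(x1 & x2 & x3 <- Phir_inv A)
  \sw_(n & c <- phi z) \sw_(l & d <- pi (am r n)) \sw_(c1 & c2 <- DeltaC d)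
    E (am x1 l) (x2 |>> c1 <<| p) (x3 |>> c2 <<| q) (s |>> c)))).
step (apply: (under3 (Philr_inv A)) => t1 t2 t3; apply: (under3 (Phil_inv A)) => y1 y2 y3;
  apply: (compatE (E := fun n c => \sw_(u1 & u2 <- Delta t1) \sw_(x1 & x2 & x3 <- Phir_inv A)
  \sw_(l & d <- pi (am t2 n)) \sw_(c1 & c2 <- DeltaC d)
    E (am x1 l) (x2 |>> c1 <<| (u1 * y1)) (x3 |>> c2 <<| (u2 * y2)) (t3 |>> c)) y3 z cphi)).
step (apply: (under3 (Phir_inv A)) => x1 x2 x3; apply: (under3 (Phil_inv A)) => y1 y2 y3;
  apply: (under2 (lam A y3)) => v w;
  apply: (star_phiE (E := fun l d c => \sw_(c1 & c2 <- DeltaC d)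
    E (am x1 l) (x2 |>> c1 <<| y1) (x3 |>> c2 <<| y2) (c <<| v)) (am w z))).
sw.
Qed.

(** Here one application of [phiQ] suffices: [cosplit] contains a single phi, which meets pi once
    the mixed cocycle identity has moved Theta^-1 past Phi_rho^-1. *)
Lemma star3_cosplitE Z (E : kspace L -> C -> C -> C -> Z) z : mlin4 E ->
  \sw_(l & a & b & c <- star3 (cosplit phi) z) E l a b c =
  \sw_(x1 & x2 & x3 <- Phir_inv A) \sw_(y1 & y2 & y3 <- Phil_inv A) \sw_(v & w <- rho A x1)
  \sw_(x1' & x2' & x3' <- Phir_inv A) \sw_(y1' & y2' & y3' <- Phil_inv A)
  \sw_(l & d <- pi (am (y3' * y3) z)) \sw_(d1 & d2 <- DeltaC d) \sw_(c1 & c2 <- DeltaC (x3' |>> d2 <<| y2'))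
    E (am (v * x1') l) (w * x2' |>> d1 <<| y1') (x2 |>> c1 <<| y1) (x3 |>> c2 <<| y2).
Proof.
move=> lE; rewrite /star3 /cosplit.
step (apply: (Philr_pentr_inv (A := A) (E := fun p q r s => 
  \sw_(y1 & y2 & y3 <- Phil_inv A) \sw_(n & c <- phi (am y3 z)) \sw_(c1 & c2 <- DeltaC c)
  \sw_(l & d <- pi (am q n)) E l (d <<| p) (r |>> c1 <<| y1) (s |>> c2 <<| y2)))).
step (apply: (under3 (Phir_inv A)) => x1 x2 x3; apply: (under3 (Phil_inv A)) => y1 y2 y3;
  apply: (under3 (Philr_inv A)) => t1 t2 t3; apply: (under2 (phi (am y3 z))) => n c;
  apply/esym/(compatE (E := fun l d => \sw_(u1 & u2 <- Delta t3) \sw_(c1 & c2 <- DeltaC c)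
    E l (d <<| t1) (x2 * u1 |>> c1 <<| y1) (x3 * u2 |>> c2 <<| y2)) x1 (am t2 n) (@compat_pi k H A C L))).
step (apply: (under3 (Phir_inv A)) => x1 x2 x3; apply: (under3 (Phil_inv A)) => y1 y2 y3;
  apply: (under2 (rho A x1)) => v w;
  apply: (star_phiE (E := fun l d c => \sw_(c1 & c2 <- DeltaC c)
    E (am v l) (w |>> d) (x2 |>> c1 <<| y1) (x3 |>> c2 <<| y2)) (am y3 z))).
sw.
Qed.

(** With phi eliminated, the two sides differ by the two nestings of the comultiplication of C. Its
    associators are absorbed by the pentagons of Phi_rho on the left and Phi_lambda on the right. *)
Lemma star3_coherence z : star3 (star phi phi) z = star3 (cosplit phi) z.
Proof.
rewrite -[LHS]tsum4_id -[RHS]tsum4_id.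
etransitivity; [apply: star3_starE; lin_core|].
etransitivity; [|symmetry; apply: star3_cosplitE; lin_core]; cbv beta.
step (apply: (under3 (Phir_inv A)) => x1 x2 x3; apply: (under3 (Phil_inv A)) => y1 y2 y3;
  apply: (under2 (lam A y3)) => v w; apply: (under3 (Phir_inv A)) => x1' x2' x3';
  apply: (under3 (Phil_inv A)) => y1' y2' y3'; apply: (under2 (pi (am (y3' * w) z))) => l d;
  apply: (DeltaC_coassoc_inv (E := fun a b c => \sw_(p & q <- Delta x2') \sw_(r & s <- Delta y1')
    (am (x1 * x1') l \ot (x2 * p |>> a <<| (r * y1)) \ot (x3 * q |>> b <<| (s * y2))
      \ot (x3' |>> c <<| (y2' * v)))) d)).
step (apply: (Phir_pent_inv A (E := fun a b c e =>
  \sw_(y1 & y2 & y3 <- Phil_inv A)  \sw_(v & w <- lam A y3) \sw_(X1 & X2 & X3 <- Phi H)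
  \sw_(y1' & y2' & y3' <- Phil_inv A) \sw_(l & d <- pi (am (y3' * w) z))
  \sw_(d1 & d2 <- DeltaC d) \sw_(d3 & d4 <- DeltaC d2) \sw_(r & s <- Delta y1')
    (am a l \ot (b |>> d1 <<| (X1 * r * y1)) \ot (c |>> d3 <<| (X2 * s * y2))
      \ot (e |>> d4 <<| (X3 * y2' * v)))))).
step (apply/esym/(Phil_pent_inv A (E := fun a b c e =>
  \sw_(x1 & x2 & x3 <- Phir_inv A) \sw_(v & w <- rho A x1)
  \sw_(x1' & x2' & x3' <- Phir_inv A) \sw_(g & h <- Delta x3') \sw_(X1 & X2 & X3 <- Phi H)
  \sw_(l & d <- pi (am e z)) \sw_(d1 & d2 <- DeltaC d) \sw_(d3 & d4 <- DeltaC d2)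
    (am (v * x1') l \ot (w * x2' |>> d1 <<| (X1 * a)) \ot (x2 * g |>> d3 <<| (X2 * b))
      \ot (x3 * h |>> d4 <<| (X3 * c)))))).
step (apply: (Phi_invr (E := fun a b c =>
  \sw_(y1 & y2 & y3 <- Phil_inv A) \sw_(y1' & y2' & y3' <- Phil_inv A) \sw_(r & s <- Delta y2)
  \sw_(x1 & x2 & x3 <- Phir_inv A) \sw_(v & w <- rho A x1)
  \sw_(x1' & x2' & x3' <- Phir_inv A) \sw_(g & h <- Delta x3') 
  \sw_(l & d <- pi (am (y3 * y3') z)) \sw_(d1 & d2 <- DeltaC d) \sw_(d3 & d4 <- DeltaC d2)
    (am (v * x1') l \ot (w * x2' |>> d1 <<| (a * y1)) \ot (x2 * g |>> d3 <<| (b * r * y1'))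
      \ot (x3 * h |>> d4 <<| (c * s * y2')))))).
sw.
Qed.

Lemma star_coassoc : star phi phi =1 cosplit phi.
Proof.
apply: star3_inj star3_coherence.
- by rewrite /star; lin_core.
- exact: compat2_star.
- by rewrite /cosplit; lin_core.
- exact: compat2_cosplit.
Qed.
End Coherence.
End ThreeFold.

(** * Counits of the iterated coactions *)

Section Counits.
Variables (k : fieldType) (H : quasiHopf k) (A : bicomoduleAlgebra H) (C : bimoduleCoalgebra H).
Local Notation pl := (pl A).
Local Notation cofree := (cofree C).
Local Notation pi := (@cofree_ev k H A C _).
Implicit Types (L M N : lmodType A) (Z : lmodType k).

Lemma kscA Z (a b : k^o) (z : Z) : a *:: (b *:: z) = (a * b) *:: z.
Proof. by rewrite /ksc scalerA. Qed.

Definition epsr N (t : kspace N \otimes C) : kspace N := idTform (@epsC k H C) t.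

Lemma epsrE N Z (F : kspace N -> Z) t : lin F -> \sw_(n & c <- t) epsC c *:: F n = F (epsr t).
Proof. exact: idTform_rule. Qed.

Lemma lin_epsr N : lin (@epsr N).
Proof. by apply: lin_idTform; exact: lin_epsC. Qed.
Local Hint Extern 0 (lin (@epsr _)) => exact: lin_epsr : lindb.

(** Apply the counit of C to [compat]: the H-legs of rho and lambda become counits and disappear. *)
Lemma epsr_compat M N (phi : kspace M -> kspace N \otimes C) u m :
  lin phi -> compat phi -> epsr (phi (am u m)) = am u (epsr (phi m)).
Proof.
move=> lphi cphi.
have h := compatE (E := fun n c => epsC c *:: n) u m cphi _.
transitivity (\sw_(v & w <- lam A u) eps v *:: epsr (phi (am w m))).
  by rewrite (@formT_rule _ _ _ _ _ _ (fun w => epsr (phi (am w m)))) ?lam_eps //; lin_core.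
transitivity (\sw_(a & b <- rho A u) eps b *:: am a (epsr (phi m))); last first.
  by rewrite (@idTform_rule _ _ _ _ _ _ (fun w => am w (epsr (phi m)))) ?rho_eps //; lin_core.
symmetry; etransitivity; [|etransitivity; [apply: h; lin_core|]]; cbv beta.
- apply: under2 => a b; rewrite -(epsrE (F := fun n => am a n)); last by lin_core.
  by rewrite -tsum_scale; apply: under2 => n c; rewrite epsC_lact kscA.
- apply: under2 => v w; rewrite -[epsr _](epsrE (F := fun n => n)); last by lin_core.
  by rewrite -tsum_scale; apply: under2 => n c; rewrite epsC_ract kscA mulrC.
Qed.

Lemma star_eps3 L M N (psi : kspace N -> kspace L \otimes C) (phi : kspace M -> kspace N \otimes C) m Z
    (E : kspace L -> C -> Z) : lin psi -> lin phi -> bil E ->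
  \sw_(l & c & c' <- star psi phi m) epsC c' *:: E l c = \sw_(l & c <- psi (epsr (phi m))) E l c.
Proof.
move=> lpsi lphi lE; rewrite /star.
transitivity (\sw_(l & c <- psi (am 1 (epsr (phi m)))) E l (c <<| 1)); last first.
  by rewrite am1; apply: under2 => l c; rewrite ractC1.
rewrite -(@eps3_rule _ _ _ _ _ (Philr_inv A) (fun t1 t2 => \sw_(l & c <- psi (am t2 (epsr (phi m)))) E l (c <<| t1)) (Philr_inv_eps3 A)); last by lin_core.
etransitivity; [nrm|]; apply: under3 => t1 t2 t3.
rewrite -(epsrE (F := fun n => \sw_(l & c <- psi (am t2 n)) E l (c <<| t1))); last by lin_core.
rewrite -tsum_scale; apply: under2 => n c; rewrite -!tsum_scale; apply: under2 => l c'.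
by rewrite epsC_lact !kscA.
Qed.

Lemma star_eps2 L M N (psi : kspace N -> kspace L \otimes C) (phi : kspace M -> kspace N \otimes C) m Z
    (E : kspace L -> C -> Z) : lin psi -> compat psi -> lin phi -> bil E ->
  \sw_(l & c & c' <- star psi phi m) epsC c *:: E l c' = \sw_(n & c <- phi m) E (epsr (psi n)) c.
Proof.
move=> lpsi cpsi lphi lE; rewrite /star.
transitivity (\sw_(n & c <- phi m) E (am 1 (epsr (psi n))) (1 |>> c)); last first.
  by apply: under2 => l c; rewrite lactC1 am1.
rewrite -(@eps1_rule _ _ _ _ _ (Philr_inv A) (fun t2 t3 => \sw_(n & c <- phi m) E (am t2 (epsr (psi n))) (t3 |>> c)) (Philr_inv_eps1 A)); last by lin_core.
etransitivity; [nrm|]; apply: under3 => t1 t2 t3.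
rewrite -tsum_scale; apply: under2 => n c.
rewrite -epsr_compat // -(epsrE (F := fun n => E n (t3 |>> c))); last by lin_core.
rewrite -tsum_scale; apply: under2 => l c'.
by rewrite epsC_ract !kscA mulrC.
Qed.

Lemma DeltaC_eps1 Z (F : C -> Z) (c : C) : lin F -> \sw_(c1 & c2 <- DeltaC c) epsC c1 *:: F c2 = F c.
Proof. by move=> lF; rewrite formT_rule // epsCT_DeltaC. Qed.
Lemma DeltaC_eps2 Z (F : C -> Z) (c : C) : lin F -> \sw_(c1 & c2 <- DeltaC c) epsC c2 *:: F c1 = F c.
Proof. by move=> lF; rewrite idTform_rule // idTepsC_DeltaC. Qed.

Lemma cosplit_eps3 M N (phi : kspace M -> kspace N \otimes C) m Z (E : kspace N -> C -> Z) :
  lin phi -> bil E -> \sw_(l & c & c' <- cosplit phi m) epsC c' *:: E l c = \sw_(n & c <- phi m) E n c.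
Proof.
move=> lphi lE; rewrite /cosplit.
transitivity (\sw_(n & c <- phi (am 1 m)) E (am 1 n) (1 |>> c <<| 1)); last first.
  by rewrite am1; apply: under2 => n c; rewrite am1 lactC1 ractC1.
rewrite -(@eps3_rule _ _ _ _ _ (Phir_inv A) (fun x1 x2 => \sw_(n & c <- phi (am 1 m)) E (am x1 n) (x2 |>> c <<| 1)) (Phir_inv_eps3 A)); last by lin_core.
etransitivity; [nrm|]; apply: under3 => x1 x2 x3.
rewrite -(@eps2_rule _ _ _ _ _ (Phil_inv A) (fun y1 y3 => \sw_(n & c <- phi (am y3 m)) E (am x1 n) (x2 |>> c <<| y1)) (Phil_inv_eps2 A)); last by lin_core.
rewrite -!tsum_scale; apply: under2 => y1 y23; rewrite -!tsum_scale; apply: under2 => y2 y3.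
rewrite -!tsum_scale; apply: under2 => n c.
rewrite -(DeltaC_eps2 (F := fun c => E (am x1 n) (x2 |>> c <<| y1))); last by lin_core.
rewrite -!tsum_scale; apply: under2 => c1 c2.
by rewrite epsC_ract epsC_lact !kscA; congr (_ *:: _); rewrite mulrAC.
Qed.

Lemma cosplit_eps2 M N (phi : kspace M -> kspace N \otimes C) m Z (E : kspace N -> C -> Z) :
  lin phi -> bil E -> \sw_(l & c & c' <- cosplit phi m) epsC c *:: E l c' = \sw_(n & c <- phi m) E n c.
Proof.
move=> lphi lE; rewrite /cosplit.
transitivity (\sw_(n & c <- phi (am 1 m)) E (am 1 n) (1 |>> c <<| 1)); last first.
  by rewrite am1; apply: under2 => n c; rewrite am1 lactC1 ractC1.
rewrite -(@eps2_rule _ _ _ _ _ (Phir_inv A) (fun x1 x3 => \sw_(n & c <- phi (am 1 m)) E (am x1 n) (x3 |>> c <<| 1)) (Phir_inv_eps2 A)); last by lin_core.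
etransitivity; [nrm|]; apply: under3 => x1 x2 x3.
rewrite -(@eps1_rule _ _ _ _ _ (Phil_inv A) (fun y2 y3 => \sw_(n & c <- phi (am y3 m)) E (am x1 n) (x3 |>> c <<| y2)) (Phil_inv_eps1 A)); last by lin_core.
rewrite -!tsum_scale; apply: under2 => y1 y23; rewrite -!tsum_scale; apply: under2 => y2 y3.
rewrite -!tsum_scale; apply: under2 => n c.
rewrite -(DeltaC_eps1 (F := fun c => E (am x1 n) (x3 |>> c <<| y2))); last by lin_core.
rewrite -!tsum_scale; apply: under2 => c1 c2.
by rewrite epsC_ract epsC_lact !kscA; congr (_ *:: _); rewrite mulrAC.
Qed.

(** The counit does not see the correction by q: [coords] is pi corrected by p, and eps(p1) p2 = 1
    because eps(beta) = 1. *)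
Lemma epsr_pi N (z : kspace (cofree N)) : epsr (pi z) = epsr (coords z).
Proof.
rewrite -[RHS](epsrE (F := fun n => n)); last by lin_core.
rewrite -(pi_pl (E := fun n c => epsC c *:: n)); last by lin_core.
transitivity (\sw_(p1 & p2 <- pl) eps p1 *:: am p2 (epsr (pi z))); last first.
  apply: under2 => p1 p2; rewrite -epsr_compat; [|exact: lin_pi|exact: compat_pi].
  rewrite -[epsr _](epsrE (F := fun n => n)); last by lin_core.
  by rewrite -tsum_scale; apply: under2 => n c; rewrite epsC_ract kscA mulrC.
rewrite /pl; symmetry.
transitivity (eps (1 : H) *:: am 1 (epsr (pi z))); last by rewrite (eps_monoid H).1 /ksc scale1r am1.
rewrite -(@eps1_rule _ _ _ _ _ (Phil A) (fun X2 X3 => eps X2 *:: am X3 (epsr (pi z))) (Phil_eps1 A)); last by lin_core.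
etransitivity; [nrm|]; apply: under3 => X1 X2 X3.
by rewrite kscA (eps_monoid H).2 eps_Sinv (eps_monoid H).2 eps_beta mulr1 mulrC.
Qed.
End Counits.

#[global] Hint Extern 0 (lin (@epsr _ _ _ _ _)) => exact: lin_epsr : lindb.

Section Linear.
Variables (k : fieldType) (A : pzAlgebra k) (L M : lmodType A).

Definition alin (g : kspace L -> kspace M) : Prop := lin g /\ forall u m, g (am u m) = am u (g m).

Lemma alinP (g : kspace L -> kspace M) : alin g <-> linear (g : L -> M).
Proof.
split=> [[lg gA] u x y|lg]; first by rewrite -[u *: x]/(am u x) [LHS](linD lg) gA.
have gD x y : g (x + y) = g x + g y by have := lg 1 x y; rewrite !scale1r.
have g0 : g 0 = 0 by apply: (addIr (g 0)); rewrite -gD !add0r.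
have gA u m : g (am u m) = am u (g m) by have := lg u m 0; rewrite !addr0 g0 addr0.
by split=> // a x y; rewrite gD am_k gA.
Qed.
End Linear.

(** * The comultiplication *)

Section Delta.
Variables (k : fieldType) (H : quasiHopf k) (A : bicomoduleAlgebra H) (C : bimoduleCoalgebra H).
Local Notation pl := (pl A).
Local Notation cofree := (cofree C).
Local Notation pi := (@cofree_ev k H A C _).
Local Notation Db := (Dbim A C).
Implicit Types (L M N : lmodType A) (Z : lmodType k).

Section Zmap.
Variables (L M : lmodType A) (g : kspace L -> kspace M).
Hypothesis ag : alin g.
Let lg : lin g := ag.1.

Lemma Zmap_bal : balanced (ract Db) ( *:%R : A -> L -> L) (fun d n => bpure d (g n : M) : cofree M).
Proof.
split=> [v v' w|v w w'|v r w].
- exact: bpureDl.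
- by rewrite [g _](linD lg); apply: bpureDr.
- by rewrite -[r *: w]/(am r w) ag.2; apply: bpureM.
Qed.

(** The functor [cofree] on the A-linear map g. *)
Definition Zmap (z : kspace (cofree L)) : kspace (cofree M) := \sw_(d & n <- (z : cofree L)) bpure d (g n : M).

Lemma Zmap_pure d (n : L) : Zmap (bpure d n) = bpure d (g n : M).
Proof. exact: tsum_pure Zmap_bal. Qed.
Lemma ZmapD z z' : Zmap (z + z') = Zmap z + Zmap z'.
Proof. exact: tsumD Zmap_bal. Qed.
Lemma Zmap0 : Zmap 0 = 0.
Proof. exact: tsum0 Zmap_bal. Qed.

Lemma Zmap_am u z : Zmap (am u z) = am u (Zmap z).
Proof.
rewrite /am -[u *: _]/(cact u _) -[RHS]/(cact u _).
elim/cofree_ind: z => [|c a n|s t Hs Ht].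
- by rewrite cact0 Zmap0 cact0.
- by rewrite cact_pure !Zmap_pure cact_pure.
- by rewrite cactDr !ZmapD cactDr Hs Ht.
Qed.

Lemma lin_Zmap : lin Zmap.
Proof. by move=> a x y; rewrite ZmapD !am_k Zmap_am. Qed.

Lemma alin_Zmap : alin Zmap.
Proof. by split; [exact: lin_Zmap|exact: Zmap_am]. Qed.

Lemma Zmap_cogen n c : Zmap (cogen n c) = cogen (g n) c.
Proof. exact: Zmap_pure. Qed.

Lemma coords_Zmap z : coords (Zmap z) = \sw_(n & c <- coords z) (g n \ot c).
Proof.
have lZ := lin_Zmap.
rewrite -[z in LHS]cogen_coords (@tsum_ext _ _ _ _ _ _ _ (fun z => coords (Zmap z))); last by lin_core.
by apply: under2 => n c; rewrite Zmap_cogen coords_cogen.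
Qed.

Lemma pi_Zmap z : pi (Zmap z) = \sw_(n & c <- pi z) (g n \ot c).
Proof.
rewrite /cofree_ev coords_Zmap; etransitivity; [nrm|]; symmetry; etransitivity; [nrm|].
by apply: under2 => n c; apply: under2 => q1 q2; apply: under2 => a b; rewrite ag.2.
Qed.
End Zmap.

(** [tilde] and [lift] undo the two applications of pi in the defining property [star_pi_delta]. *)
Definition delta L : kspace (cofree L) -> kspace (cofree (cofree L)) := lift (tilde (cosplit pi)).

Lemma compat2_cosplit_pi L : compat2 (cosplit (@cofree_ev k H A C L)).
Proof. by apply: compat2_cosplit; [exact: lin_pi|exact: compat_pi]. Qed.
Lemma lin_cosplit_pi L : lin (cosplit (@cofree_ev k H A C L)).
Proof. by rewrite /cosplit; lin_core. Qed.
Lemma lin_delta0 L : lin (tilde (cosplit (@cofree_ev k H A C L))).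
Proof. apply: lin_tilde; exact: lin_cosplit_pi. Qed.
Lemma compat_delta0 L : compat (tilde (cosplit (@cofree_ev k H A C L))).
Proof. by apply: compat_tilde; [exact: lin_cosplit_pi|exact: compat2_cosplit_pi]. Qed.

Lemma lin_delta L : lin (@delta L).
Proof. apply: lin_lift; exact: lin_delta0. Qed.
Lemma delta_am L u (z : kspace (cofree L)) : delta (am u z) = am u (delta z).
Proof. by apply: lift_am; [exact: lin_delta0|exact: compat_delta0]. Qed.
Lemma alin_delta L : alin (@delta L).
Proof. by split; [exact: lin_delta|exact: delta_am]. Qed.
Lemma pi_delta L (z : kspace (cofree L)) : pi (delta z) = tilde (cosplit pi) z.
Proof. by apply: pi_lift; [exact: lin_delta0|exact: compat_delta0]. Qed.
Lemma star_pi_delta L (z : kspace (cofree L)) : star pi (fun z => pi (delta z)) z = cosplit pi z.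
Proof.
rewrite -[RHS](star_tilde (@lin_cosplit_pi L) (@compat2_cosplit_pi L)).
by congr (star _ _ z); apply: boolp.funext => y; exact: pi_delta.
Qed.

(** [tilde] recovers pi f from its image under [star pi], and [pi_inj] then recovers f. *)
Lemma star_pi_inj M N (f f' : kspace M -> kspace (cofree (cofree N))) : alin f -> alin f' ->
  (forall m, star pi (fun m => pi (f m)) m = star pi (fun m => pi (f' m)) m) -> f =1 f'.
Proof.
move=> [lf fA] [lf' fA'] e; apply: pi_inj => // m.
have cc (g : kspace M -> kspace (cofree (cofree N))) :
    (forall u m, g (am u m) = am u (g m)) -> compat (fun m => pi (g m)).
  by move=> gA u m'; rewrite [LHS]compat_pi; apply: under2 => v w; rewrite gA.
rewrite -[LHS](tilde_star (a := fun m => pi (f m))); [|lin_core|exact: cc].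
rewrite -[RHS](tilde_star (a := fun m => pi (f' m))); [|lin_core|exact: cc].
by congr (tilde _ m); apply: boolp.funext.
Qed.

Section Comodule.
Variables (M : lmodType A) (f : kspace M -> kspace (cofree M)).
Hypothesis af : alin f.
Let lf : lin f := af.1.
Let phi (m : kspace M) := pi (f m).

Lemma lin_pi_comp : lin phi. Proof. by rewrite /phi; lin_core. Qed.
Lemma compat_pi_comp : compat phi.
Proof. by move=> u m; rewrite /phi [LHS]compat_pi; apply: under2 => v w; rewrite af.2. Qed.

Lemma star_pi_Zmap m : star pi (fun m => pi (Zmap f (f m))) m = star phi phi m.
Proof.
rewrite /star; apply: under3 => t1 t2 t3.
etransitivity; [apply: tsum_congt; apply: (pi_Zmap af)|].
etransitivity; [nrm|].
by apply: under2 => n c; rewrite /phi af.2.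
Qed.

Lemma star_pi_delta_comp m : star pi (fun m => pi (delta (f m))) m = cosplit phi m.
Proof.
transitivity (cosplit pi (f m)); first exact: (star_pi_delta (f m)).
by rewrite /cosplit; apply: under3 => x1 x2 x3; apply: under3 => y1 y2 y3; rewrite -af.2.
Qed.

(** Both composites M -> cofree (cofree M) are A-linear, hence determined by their images under
    [star pi], and these images are the two sides of the Yetter-Drinfeld axiom. *)
Lemma comodule_yd :
  (forall m, Zmap f (f m) = delta (f m)) <-> (forall m, star phi phi m = cosplit phi m).
Proof.
split=> e m.
  rewrite -star_pi_Zmap -star_pi_delta_comp; congr (star _ _ m).
  by apply: boolp.funext => m'; rewrite e.
have aZ : alin (fun m => Zmap f (f m)).
  by split; [have := lin_Zmap af => lZ; lin_core|move=> u m'; rewrite af.2 Zmap_am].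
have aD : alin (fun m => delta (f m)).
  by split; [have := @lin_delta M => ld; lin_core|move=> u m'; rewrite af.2 delta_am].
by apply: (star_pi_inj aZ aD) => m'; rewrite star_pi_Zmap star_pi_delta_comp.
Qed.
End Comodule.

(** Coassociativity of delta is an instance of [comodule_yd] with f = delta on the module cofree L,
    so it amounts to the Yetter-Drinfeld axiom for pi delta, which is [star_coassoc]. *)
Lemma delta_coassoc L (z : kspace (cofree L)) : Zmap (@delta L) (delta z) = delta (delta z).
Proof.
have e : (fun z : kspace (cofree L) => pi (delta z)) = tilde (cosplit (@cofree_ev k H A C L)).
  by apply: boolp.funext => y; exact: pi_delta.
apply: (proj2 (comodule_yd (@alin_delta L))) => m.
rewrite e; apply: star_coassoc; [exact: lin_delta0|exact: compat_delta0|].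
by move=> y; rewrite -e star_pi_delta.
Qed.

Section Counit.
Variable L : lmodType A.

Definition cofree_eps (z : kspace (cofree L)) : kspace L := epsr (coords z).

Lemma lin_cofree_eps : lin cofree_eps.
Proof. by rewrite /cofree_eps; lin_core. Qed.
Lemma cofree_eps_am u z : cofree_eps (am u z) = am u (cofree_eps z).
Proof.
rewrite /cofree_eps -!epsr_pi; apply: (epsr_compat (phi := @cofree_ev k H A C L)); [exact: lin_pi|exact: compat_pi].
Qed.
Lemma alin_cofree_eps : alin cofree_eps.
Proof. by split; [exact: lin_cofree_eps|exact: cofree_eps_am]. Qed.
End Counit.

(** The two counit laws come from contracting [star_pi_delta] with the counit of C: here on the last
    factor, in [Zmap_cofree_eps_delta] on the middle one. *)
Lemma cofree_eps_delta L (z : kspace (cofree L)) : cofree_eps (delta z) = z.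
Proof.
have aE : alin (fun z : kspace (cofree L) => cofree_eps (delta z)).
  split; last by move=> u m; rewrite delta_am cofree_eps_am.
  exact: (lin_comp (@lin_cofree_eps _) (@lin_delta L)).
apply: (pi_inj (f' := fun z => z) aE.2) => // m.
rewrite -[LHS]tsum_id -[RHS]tsum_id /cofree_eps -epsr_pi pi_delta.
rewrite -(star_eps3 (psi := pi) (E := fun a b => a \ot b) m); [|exact: lin_pi|exact: lin_delta0|lin_core].
rewrite star_tilde; [|exact: lin_cosplit_pi|exact: compat2_cosplit_pi].
by rewrite (cosplit_eps3 (E := fun a b => a \ot b) m) //; [exact: lin_pi|lin_core].
Qed.

Lemma Zmap_cofree_eps_delta L (z : kspace (cofree L)) : Zmap (@cofree_eps L) (delta z) = z.
Proof.
have aE : alin (fun z : kspace (cofree L) => Zmap (@cofree_eps L) (delta z)).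
  split; last by move=> u m; rewrite delta_am (Zmap_am (alin_cofree_eps L)).
  exact: (lin_comp (lin_Zmap (alin_cofree_eps L)) (@lin_delta L)).
apply: (pi_inj (f' := fun z => z) aE.2) => // m.
rewrite (pi_Zmap (alin_cofree_eps L)) pi_delta -[RHS]tsum_id.
transitivity (\sw_(n & c <- tilde (cosplit pi) m) (epsr (pi n) \ot c)).
  by apply: under2 => n c; rewrite epsr_pi.
rewrite -(star_eps2 (psi := pi) (E := fun a b => a \ot b) m); [|exact: lin_pi|exact: compat_pi|exact: lin_delta0|lin_core].
rewrite star_tilde; [|exact: lin_cosplit_pi|exact: compat2_cosplit_pi].
by rewrite (cosplit_eps2 (E := fun a b => a \ot b) m) //; [exact: lin_pi|lin_core].
Qed.

(** The copies of p in [lift] and [tilde], together with the Phi_lambda^-1 of [cosplit], form the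
    right-hand side of [pl_twist]. Once they are replaced, pi is still evaluated next to a copy of
    p, and [pi_pl] turns it into [coords]. *)
Lemma delta_formula L (z : kspace (cofree L)) :
  delta z =
  \sw_(t1 & t2 & t3 <- Philr_inv A) \sw_(t20 & t21 <- rho A t2)
  \sw_(x1 & x2 & x3 <- Phir_inv A) \sw_(X1 & X2 & X3 <- Phil A)
  \sw_(X30 & X31 <- rho A X3) \sw_(X311 & X312 <- Delta X31)
  \sw_(g1 & g2 <- drinfeld_twist_inv H) \sw_(n & c <- coords z) \sw_(c1 & c2 <- DeltaC c)
    cogen (cogen (am (t20 * x1 * X30) n) (t21 * x2 * X311 |>> c1 <<| Sinv (t1 * X2 * g2)))
       (t3 * x3 * X312 |>> c2 <<| Sinv (X1 * g1)).
Proof.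
rewrite /delta /lift /tilde /cosplit.
step (apply/esym/(pl_twist A (E := fun p q r => \sw_(x1 & x2 & x3 <- Phir_inv A)
  \sw_(n & c <- pi (am r z)) \sw_(c1 & c2 <- DeltaC c)
  \sw_(t1 & t2 & t3 <- Philr_inv A) \sw_(a & b <- rho A t2)
    cogen (cogen (am (a * x1) n) (b * x2 |>> c1 <<| (p * Sinv t1)))
       (t3 * x3 |>> c2 <<| q)))).
set F := fun (X1 X2 : H) (n : kspace L) (c : C) => 
  \sw_(g1 & g2 <- drinfeld_twist_inv H) \sw_(x1 & x2 & x3 <- Phir_inv A)
  \sw_(c1 & c2 <- DeltaC c)
  \sw_(t1 & t2 & t3 <- Philr_inv A) \sw_(a & b <- rho A t2)
    cogen (cogen (am (a * x1) n) (b * x2 |>> c1 <<| (Sinv (X2 * g2) * Sinv t1)))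
       (t3 * x3 |>> c2 <<| Sinv (X1 * g1)).
have lF X1 X2 : bil (F X1 X2) by rewrite /F; lin_core.
transitivity (\sw_(X1 & X2 & X3 <- Phil A) \sw_(v & w <- lam A X3) \sw_(p1 & p2 <- pl)
  \sw_(n & c <- pi (am w (am p2 z))) F X1 X2 n (c <<| (v * p1))).
  rewrite /F; sw.
transitivity (\sw_(X1 & X2 & X3 <- Phil A) \sw_(a & b <- rho A X3) \sw_(n & c <- coords z)
   F X1 X2 (am a n) (b |>> c)).
  (* F is generalised to an arbitrary bilinear map, so that its sums stay out of the
     normalisation. *)
  apply: under3 => X1 X2 X3; have lF' := lF X1 X2; move: (F X1 X2) lF' => G lG.
  step (apply: (under2 pl) => p1 p2; apply/esym/(compatE (E := fun n c => G n (c <<| p1)) X3 (am p2 z) (@compat_pi k H A C L))).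
  step (apply: (under2 (rho A X3)) => a b; apply: (pi_pl (E := fun n c => G (am a n) (b |>> c)) z)).
  sw.
rewrite /F; sw.
Qed.

(** Naturality follows from uniqueness: under [star pi] both composites become (g (x) id (x) id)
    applied to [cosplit pi]. *)
Lemma delta_Zmap L M (g : kspace L -> kspace M) (z : kspace (cofree L)) : alin g ->
  delta (Zmap g z) = Zmap (Zmap g) (delta z).
Proof.
move=> ag; have [lg gA] := ag; have aZ := alin_Zmap ag; have [lZ ZA] := aZ.
have [ldM dMA] := alin_delta M; have [ldL dLA] := alin_delta L.
have [lZZ ZZA] := alin_Zmap aZ.
apply: (star_pi_inj (f := fun z => delta (Zmap g z)) (f' := fun z => Zmap (Zmap g) (delta z))) => {z} [||z].
- by split; [exact: (lin_comp ldM lZ)|move=> u m; rewrite ZA dMA].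
- by split; [exact: (lin_comp lZZ ldL)|move=> u m; rewrite dLA ZZA].
transitivity (\sw_(l & c & c' <- cosplit pi z) (g l \ot c \ot c')).
  transitivity (cosplit pi (Zmap g z)); first exact: (star_pi_delta (Zmap g z)).
  rewrite /cosplit; symmetry; etransitivity; [nrm|]; symmetry.
  apply: under3 => x1 x2 x3; apply: under3 => y1 y2 y3.
  rewrite -ZA; etransitivity; [apply: tsum_congt; apply: (pi_Zmap ag)|].
  etransitivity; [nrm|].
  by apply: under2 => n c; rewrite -gA.
rewrite -star_pi_delta /star; etransitivity; [nrm|].
apply: under3 => t1 t2 t3; symmetry.
etransitivity; [apply: tsum_congt; apply: (pi_Zmap aZ)|].
etransitivity; [nrm|].
apply: under2 => n c; etransitivity; [apply: tsum_congt; rewrite -ZA; apply: (pi_Zmap ag)|].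
nrm.
Qed.
End Delta.

(** * Functoriality of the balanced tensor product *)

Section TensorMap.
Variables (R : Type) (V W : zmodType) (ra : V -> R -> V) (la : R -> W -> W).

Lemma tsum_morph (Z Z' : zmodType) (F : Z -> Z') (t : tprod ra la) (E : V -> W -> Z) :
  {morph F : x y / x + y} -> F (tsum t E) = tsum t (fun v w => F (E v w)).
Proof.
move=> FD; have F0 : F 0 = 0 by apply: (addIr (F 0)); rewrite -FD !add0r.
exact: (big_morph F FD F0).
Qed.

Variables (W' : zmodType) (la' : R -> W' -> W') (h : W -> W').
Hypotheses (hD : {morph h : x y / x + y}) (hA : forall r w, h (la r w) = la' r (h w)).

Lemma tmap_bal : balanced ra la (fun v w => pure ra la' v (h w)).
Proof.
have [Dl Dr M] := pure_balanced ra la'.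
by split=> [v v' w|v w w'|v r w]; rewrite ?hD ?hA ?Dl ?Dr ?M.
Qed.

Definition tmap (t : tprod ra la) : tprod ra la' := tsum t (fun v w => pure ra la' v (h w)).

Lemma tmap_pure v w : tmap (pure ra la v w) = pure ra la' v (h w).
Proof. exact: tsum_pure tmap_bal. Qed.
Lemma tmapD : {morph tmap : x y / x + y}.
Proof. move=> x y; exact: tsumD tmap_bal. Qed.
End TensorMap.

(** * The coring on C (x) A *)

Section Coring.
Variables (k : fieldType) (H : quasiHopf k) (A : bicomoduleAlgebra H) (C : bimoduleCoalgebra H).
Local Notation cofree := (cofree C).
Local Notation D := (C \otimes A)%type.
Local Notation Db := (Dbim A C).
Implicit Types (L M N : lmodType A).

(* C (x) A as a left A-module. *)
Definition leftD : Type := D.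
HB.instance Definition _ := GRing.Zmodule.on leftD.
HB.instance Definition _ := GRing.Zmodule_isLmodule.Build A leftD
  (fun u v d => esym (@DlactM k H A C u v d)) (@Dlact1 k H A C)
  (fun u => linD (@lin_Dlactr k H A C u)) (fun d u v => linD (@lin_Dlactl k H A C d) u v).

Lemma Dscale (u : A) (d : leftD) : u *: d = Dlact u d.
Proof. by []. Qed.

Definition regA : Type := A.
HB.instance Definition _ := GRing.Zmodule.on regA.
HB.instance Definition _ := GRing.Zmodule_isLmodule.Build A regA
  (@mulrA A) (@mul1r A) (@mulrDr A) (fun v a b => @mulrDl A a b v).

Lemma Ascale (u : A) (a : regA) : u *: a = (u * a : A).
Proof. by []. Qed.

Lemma cscale (L : lmodType A) (u : A) (z : cofree L) : u *: z = cact u z.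
Proof. by []. Qed.

Lemma regA_mul_bal : balanced (ract Db) ( *:%R : A -> regA -> regA) (fun d u => Dract d u : leftD).
Proof.
split=> [v v' w|v w w'|v r w].
- exact: (linD (lin_Dractl w)).
- exact: (linD (lin_Dractr v)).
- by rewrite /= -DractM.
Qed.

(** The canonical isomorphism D (x)_A A -> D, with inverse [regA_gen]; [Dcomul] is delta at N = A
    transported along it. *)
Definition regA_mul (z : kspace (cofree regA)) : kspace leftD := \sw_(d & u <- (z : cofree regA)) Dract d (u : A).
Definition regA_gen (d : kspace leftD) : kspace (cofree regA) := bpure (d : D) (1 : A).

Lemma regA_mul_pure (d : D) (u : A) : regA_mul (bpure d (u : regA)) = Dract d u.
Proof. exact: tsum_pure regA_mul_bal. Qed.
Lemma regA_mul0 : regA_mul 0 = 0. Proof. exact: tsum0 regA_mul_bal. Qed.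
Lemma regA_mulD z z' : regA_mul (z + z') = regA_mul z + regA_mul z'. Proof. exact: tsumD regA_mul_bal. Qed.

Lemma alin_regA_mul : alin regA_mul.
Proof.
have mA u z : regA_mul (am u z) = am u (regA_mul z).
  rewrite /am cscale Dscale.
  elim/cofree_ind: z => [|c a n|s t Hs Ht].
  - by rewrite cact0 regA_mul0 (lin0 (lin_Dlactr u)).
  - by rewrite cact_pure !regA_mul_pure Dlract.
  - by rewrite cactDr !regA_mulD Hs Ht (linD (lin_Dlactr u)).
by split=> // a x y; rewrite regA_mulD !am_k mA.
Qed.

Lemma alin_regA_gen : alin regA_gen.
Proof.
have nA u z : regA_gen (am u z) = am u (regA_gen z).
  by rewrite /am cscale Dscale /regA_gen cact_pure.
have nD x y : regA_gen (x + y) = regA_gen x + regA_gen y by exact: bpureDl.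
by split=> // a x y; rewrite nD !am_k nA.
Qed.

Lemma regA_mul_regA_gen d : regA_mul (regA_gen d) = d.
Proof. by rewrite regA_mul_pure Dract1. Qed.

Lemma regA_gen_Dract d (u : A) : regA_gen (Dract d u) = bpure d (u : regA).
Proof. by rewrite /regA_gen [LHS]bpureM Ascale mulr1. Qed.

Lemma regA_gen_regA_mul z : regA_gen (regA_mul z) = z.
Proof.
elim/cofree_ind: z => [|c a n|s t Hs Ht].
- by rewrite regA_mul0 (lin0 alin_regA_gen.1).
- by rewrite regA_mul_pure regA_gen_Dract.
- by rewrite regA_mulD (linD alin_regA_gen.1) Hs Ht.
Qed.

Definition Dcomul (d : kspace leftD) : kspace (cofree leftD) := Zmap regA_mul (delta (regA_gen d)).

Lemma alin_Dcomul : alin Dcomul.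
Proof.
have [ln nA] := alin_regA_gen; have [lZ ZA] := alin_Zmap C alin_regA_mul; have [ld dA] := @alin_delta k H A C regA.
split; first exact: (lin_comp lZ (lin_comp ld ln)).
by move=> u m; rewrite /Dcomul nA dA ZA.
Qed.

Definition Dcounit (d : D) : A := \sw_(c & u <- d) (epsC c *:: u).

Lemma lin_Dcounit : lin Dcounit.
Proof. by rewrite /Dcounit; lin_core. Qed.
Lemma Dcounit_ot c (u : A) : Dcounit (c \ot u) = epsC c *:: u.
Proof. by rewrite /Dcounit tsum_ot //; lin_core. Qed.
Lemma Dcounit_Dract d u : Dcounit (Dract d u) = Dcounit d * u.
Proof.
rewrite /Dcounit /Dract tsum_mull; etransitivity; [nrm|].
by apply: under2 => c a; rewrite /ksc pzscalerAl.
Qed.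

Lemma cofree_eps_pure L (d : D) (n : L) : cofree_eps (bpure d n : kspace (cofree L)) = am (Dcounit d) (n : kspace L).
Proof.
rewrite /cofree_eps coords_pure /Dcounit /epsr /idTform.
rewrite (@tsum_ext _ _ _ _ _ _ _ (fun a => am a (n : kspace L))); last by lin_core.
etransitivity; [nrm|]; apply: under2 => c a.
exact/esym/(linZ (lin_am_l (n : kspace L))).
Qed.

Lemma cofree_epsE L (z : cofree L) : cofree_eps z = \sw_(d & n <- z) Dcounit d *: n.
Proof.
have bE : balanced (ract Db) ( *:%R : A -> L -> L) (fun d n => Dcounit d *: n).
  split=> [v v' w|v w w'|v r w]; first by rewrite (linD lin_Dcounit) scalerDl.
  - by rewrite scalerDr.
  - by rewrite [ract _ _ _]/(Dract v r) Dcounit_Dract scalerA.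
elim/cofree_ind: z => [|c a n|s t Hs Ht].
- by rewrite (lin0 (@lin_cofree_eps _ _ _ _ L)) (tsum0 bE).
- by rewrite cofree_eps_pure [RHS](tsum_pure _ _ bE).
- by rewrite [LHS](linD (@lin_cofree_eps _ _ _ _ L)) [RHS](tsumD _ _ bE) Hs Ht.
Qed.

Lemma Dcounit_regA_gen d : Dcounit d = cofree_eps (regA_gen d).
Proof. by rewrite cofree_eps_pure /am Ascale mulr1. Qed.

Lemma Dcounit_Dlact u d : Dcounit (Dlact u d) = u * Dcounit d.
Proof.
by rewrite !Dcounit_regA_gen -[Dlact u d]/(am u (d : kspace leftD)) alin_regA_gen.2 cofree_eps_am.
Qed.

Lemma cofree_ext L (Z : zmodType) (F : cofree L -> Z) (z : cofree L) :
  {morph F : x y / x + y} -> \sw_(d & n <- z) F (bpure d n) = F z.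
Proof.
move=> FD; have F0 : F 0 = 0 by apply: (addIr (F 0)); rewrite -FD !add0r.
by rewrite [in RHS](tprodE z) (big_morph F FD F0).
Qed.

(** The reassociation of (D (x)_A D) (x)_A L, evaluated at l. *)
Definition expand L (z : kspace (cofree leftD)) (l : L) : cofree (cofree L) :=
  \sw_(d & d' <- (z : cofree leftD)) bpure d (bpure d' l : cofree L).

Lemma expand_bal L (l : L) : balanced (ract Db) ( *:%R : A -> leftD -> leftD)
  (fun d d' => bpure d (bpure d' l : cofree L) : cofree (cofree L)).
Proof.
split=> [v v' w|v w w'|v r w].
- exact: bpureDl.
- by rewrite -bpureDr; congr (bpure _ _); apply: bpureDl.
- by rewrite [LHS]bpureM cscale cact_pure.
Qed.

Lemma tsum_Zmap L M (g : kspace L -> kspace M) (Z : zmodType) (E : D -> M -> Z) (z : kspace (cofree L)) :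
  alin g -> balanced (ract Db) ( *:%R : A -> M -> M) E ->
  \sw_(d & n <- (Zmap g z : cofree M)) E d n = \sw_(d & n <- (z : cofree L)) E d (g n).
Proof.
move=> ag bE.
rewrite -(@cofree_ext L Z (fun z => tsum (Zmap g z : cofree M) E)); last first.
  by move=> x y; rewrite [Zmap g _](ZmapD ag) [LHS](tsumD _ _ bE).
by apply: eq_tsum => d n; rewrite [Zmap g _](Zmap_pure ag) [LHS](tsum_pure _ _ bE).
Qed.

Lemma Zmap_comp L M N (g : kspace L -> kspace M) (h : kspace M -> kspace N) (z : kspace (cofree L)) :
  alin g -> alin h -> Zmap h (Zmap g z) = Zmap (fun x => h (g x)) z.
Proof. by move=> ag ah; rewrite {1}/Zmap (tsum_Zmap z ag (Zmap_bal C ah)). Qed.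

Section Orbit.
Variables (L : lmodType A) (l : L).
Let orb (u : kspace regA) : kspace L := am (u : A) (l : kspace L).

Lemma alin_orb : alin orb.
Proof.
apply/alinP => u x y; rewrite /orb Ascale.
by rewrite [LHS]amDl -amA.
Qed.

Lemma Zmap_orb (z : kspace (cofree regA)) : Zmap orb z = bpure (regA_mul z : D) l.
Proof.
elim/cofree_ind: z => [|c a n|s t Hs Ht].
- rewrite (Zmap0 C alin_orb) regA_mul0; apply/esym/(addIr (bpure (0 : D) l : cofree L)).
  by rewrite -bpureDl !add0r.
- by rewrite (Zmap_pure alin_orb) regA_mul_pure [RHS]bpureM.
- by rewrite (ZmapD alin_orb) regA_mulD Hs Ht -bpureDl.
Qed.

(** d (x) l is the image of [regA_gen d] under the orbit map a |-> a l, so naturality expresses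
    delta on L through the comultiplication of the coring. *)
Lemma delta_bpure (d : D) : delta (bpure d l : kspace (cofree L)) = expand (Dcomul d) l.
Proof.
have -> : bpure d l = Zmap orb (regA_gen d) :> kspace (cofree L).
  by rewrite (Zmap_pure alin_orb) /orb am1.
rewrite delta_Zmap; last exact: alin_orb.
rewrite /expand /Dcomul (tsum_Zmap _ alin_regA_mul (expand_bal l)) {1}/Zmap.
by apply: eq_tsum => d1 n; rewrite Zmap_orb.
Qed.
End Orbit.

Lemma sum_expand L (z : kspace (cofree L)) :
  \sw_(d & n <- (z : cofree L)) expand (Dcomul d) n = delta z.
Proof.
rewrite -(@cofree_ext L _ (@delta k H A C L)); last exact: (linD (@lin_delta k H A C L)).
by apply: eq_tsum => d n; rewrite -delta_bpure.
Qed.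

Lemma Dcomul_regA_mul z : Dcomul (regA_mul z) = Zmap regA_mul (delta z).
Proof. by rewrite /Dcomul regA_gen_regA_mul. Qed.

Lemma Dcomul_coassoc d : Zmap Dcomul (Dcomul d) = delta (Dcomul d).
Proof.
have aZ := alin_Zmap C alin_regA_mul.
rewrite [in RHS]/Dcomul delta_Zmap; last exact: alin_regA_mul.
rewrite -delta_coassoc [RHS]Zmap_comp; [|exact: (alin_delta C regA)|exact: aZ].
rewrite [LHS]Zmap_comp; [|exact: alin_regA_mul|exact: alin_Dcomul].
by congr (Zmap _ _); apply: boolp.funext => z; rewrite -Dcomul_regA_mul.
Qed.

Lemma Dcounit_regA_mul z : Dcounit (regA_mul z) = cofree_eps z.
Proof. by rewrite Dcounit_regA_gen regA_gen_regA_mul. Qed.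

Lemma Dcomul_counitl d : cofree_eps (Dcomul d) = d.
Proof.
transitivity (regA_mul (cofree_eps (delta (regA_gen d)))); last by rewrite cofree_eps_delta regA_mul_regA_gen.
have h (z : kspace (cofree (cofree regA))) : cofree_eps (Zmap regA_mul z) = regA_mul (cofree_eps z).
  rewrite /cofree_eps (coords_Zmap alin_regA_mul) /epsr /idTform; etransitivity; [nrm|].
  rewrite (@tsum_ext _ _ _ _ _ _ _ regA_mul); last exact: alin_regA_mul.1.
  by apply: under2 => n c; rewrite (linZ alin_regA_mul.1).
exact: h.
Qed.

Lemma Dcounit_bal : balanced (ract Db) (lact Db) (fun d d' => Dract d (Dcounit d')).
Proof.
split=> [v v' w|v w w'|v r w].
- exact: (linD (lin_Dractl _)).
- by rewrite (linD lin_Dcounit) (linD (lin_Dractr _)).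
- by rewrite /= Dcounit_Dlact DractM.
Qed.

Lemma Dcomul_counitr d : \sw_(d1 & d2 <- (Dcomul d : cofree leftD)) Dract d1 (Dcounit d2) = d.
Proof.
rewrite /Dcomul (tsum_Zmap _ alin_regA_mul Dcounit_bal).
transitivity (regA_mul (Zmap (@cofree_eps _ _ _ _ regA) (delta (regA_gen d)))); last by rewrite Zmap_cofree_eps_delta regA_mul_regA_gen.
rewrite /regA_mul (tsum_Zmap _ (alin_cofree_eps C regA) regA_mul_bal).
by apply: eq_tsum => d1 n; rewrite Dcounit_regA_mul.
Qed.

(** Right multiplication by u is an endomorphism of the left module A, and delta is natural with
    respect to it. *)
Lemma Dcomul_Dract d (u : A) :
  Dcomul (Dract d u) = \sw_(d1 & d2 <- (Dcomul d : cofree leftD)) (bpure d1 (Dract d2 u : leftD) : cofree leftD).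
Proof.
pose r (a : kspace regA) : kspace regA := (a : A) * u.
have ar : alin r.
  apply/alinP => a x y; rewrite /r [LHS]mulrDl; congr (_ + _); exact/esym/mulrA.
have aD : alin (fun d : kspace leftD => Dract d u : kspace leftD).
  by apply/alinP => a x y; rewrite Dscale [LHS](linD (lin_Dractl u)) Dlract.
have rm z : regA_mul (Zmap r z) = Dract (regA_mul z) u.
  elim/cofree_ind: z => [|c a n|s t Hs Ht].
  - by rewrite (Zmap0 C ar) regA_mul0 (lin0 (lin_Dractl _)).
  - by rewrite (Zmap_pure ar) !regA_mul_pure /r DractM.
  - by rewrite (ZmapD ar) !regA_mulD Hs Ht (linD (lin_Dractl _)).
rewrite -[RHS]/(Zmap (fun d : kspace leftD => Dract d u : kspace leftD) (Dcomul d)) /Dcomul.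
rewrite (Zmap_comp _ alin_regA_mul aD).
have -> : regA_gen (Dract d u) = Zmap r (regA_gen d) by rewrite (Zmap_pure ar) /r mul1r regA_gen_Dract.
rewrite delta_Zmap // Zmap_comp; [|exact: alin_Zmap|exact: alin_regA_mul].
by congr (Zmap _ _); apply: boolp.funext => z; rewrite rm.
Qed.

Lemma Dcomul_Dlact (u : A) d :
  Dcomul (Dlact u d) = \sw_(d1 & d2 <- (Dcomul d : cofree leftD)) (bpure (Dlact u d1) (d2 : leftD) : cofree leftD).
Proof.
have e : Dcomul (am u (d : kspace leftD)) = am u (Dcomul d) := alin_Dcomul.2 u d.
exact: e.
Qed.

Lemma Dcomul_coassocE d :
  \sw_(d1 & d2 <- (Dcomul d : cofree leftD)) expand (Dcomul d1) d2 = Zmap Dcomul (Dcomul d).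
Proof. by rewrite sum_expand Dcomul_coassoc. Qed.

Lemma Dcomul_counitlE d : \sw_(d1 & d2 <- (Dcomul d : cofree leftD)) Dlact (Dcounit d1) d2 = d.
Proof.
have e := Dcomul_counitl d; rewrite (cofree_epsE (L := leftD) (Dcomul d)) in e.
exact: e.
Qed.

(* [btens Db (lact Db)] and [cofree leftD] are convertible, but comparing the
   towers of structures on their iterates is intractable; [tmap] along the
   identity avoids it. *)
Definition rawD (z : cofree leftD) : btens Db (lact Db) := z.
Lemma rawDD : {morph rawD : x y / x + y}. Proof. by []. Qed.
Lemma rawDA (u : A) (z : cofree leftD) : rawD (u *: z) = btens_lact Db (lact Db) u (rawD z).
Proof. by []. Qed.

Lemma Dcomul_coassoc_raw d :
  \sw_(v1 & v2 <- rawD (Dcomul d)) \sw_(v11 & v12 <- rawD (Dcomul v1)) bpure v11 (bpure v12 v2) =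
  \sw_(v1 & v2 <- rawD (Dcomul d)) bpure v1 (rawD (Dcomul v2)) :> btens Db (btens_lact Db (lact Db)).
Proof.
pose th := tmap (ra := ract Db) (la := ( *:%R : A -> cofree leftD -> cofree leftD)) (btens_lact Db (lact Db)) rawD.
have thD : {morph th : x y / x + y} by apply: tmapD; [exact: rawDD|exact: rawDA].
have thp d1 (z : cofree leftD) : th (bpure d1 z) = bpure d1 (rawD z).
  by apply: tmap_pure; [exact: rawDD|exact: rawDA].
have e := congr1 th (Dcomul_coassocE d).
rewrite (tsum_morph _ _ thD) [RHS](tsum_morph _ _ thD) in e.
etransitivity; [|etransitivity; [exact: e|]].
- apply: eq_tsum => v1 v2; rewrite /expand (tsum_morph _ _ thD).
  by apply: eq_tsum => v11 v12; rewrite thp.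
- by apply: eq_tsum => v1 v2; rewrite thp.
Qed.

Definition ydCoring : coring A D :=
  @Coring A D Db Dcomul Dcounit (linD alin_Dcomul.1) Dcomul_Dlact Dcomul_Dract
   (linD lin_Dcounit) Dcounit_Dlact Dcounit_Dract Dcomul_coassoc_raw Dcomul_counitlE Dcomul_counitr.
End Coring.

(** * The isomorphism of categories *)

Section Functors.

(* The identity of [x] read as a morphism from [x] to [y]; it lets one compare the
   values of two functors on morphisms without casts. *)
Definition eqhom (C : category) (x y : C) (e : x = y) : Defs.hom x y :=
  match e in _ = z return Defs.hom x z with erefl => idm x end.

Lemma functor_eq_id (C : category) (F : functor C C) (e : forall x, F x = x) :
  (forall x y (f : Defs.hom x y), cmp (eqhom (e y)) (fmor F f) = cmp f (eqhom (e x))) ->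
  F = fid C.
Proof.
case: F e => fo fm fi fc /= e h.
(* Once the map on objects is replaced by the identity, each e x proves x = x, hence is [erefl] by
   proof irrelevance, and [eqhom] becomes an identity morphism. *)
have E : fo = id by apply: boolp.funext.
subst fo.
have em : fm = fun x y f => f.
  apply: boolp.functional_extensionality_dep => x.
  apply: boolp.functional_extensionality_dep => y.
  apply: boolp.functional_extensionality_dep => f.
  have := h x y f; rewrite (boolp.Prop_irrelevance (e x) erefl) (boolp.Prop_irrelevance (e y) erefl) /=.
  by rewrite cmp_idl cmp_idr.
subst fm.
by rewrite /fid; congr Functor; apply: boolp.Prop_irrelevance.
Qed.
End Functors.

Section Comodules.
Variables (k : fieldType) (H : quasiHopf k) (A : bicomoduleAlgebra H) (C : bimoduleCoalgebra H).
Local Notation cofree := (cofree C).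
Local Notation D := (ydCoring A C).
Local Notation pi := (@cofree_ev k H A C _).
Implicit Types (M N : lmodType A).

Definition raw M (z : cofree M) : btens D ( *:%R : A -> M -> M) := z.
Lemma rawDl M : {morph @raw M : x y / x + y}. Proof. by []. Qed.
Lemma rawA M (u : A) (z : cofree M) : raw (u *: z) = btens_lact D ( *:%R : A -> M -> M) u (raw z).
Proof. by []. Qed.

Definition unraw M (z : btens D ( *:%R : A -> M -> M)) : cofree M := z.
Lemma unrawDl M : {morph @unraw M : x y / x + y}. Proof. by []. Qed.
Lemma unrawA M (u : A) z : unraw (btens_lact D ( *:%R : A -> M -> M) u z) = u *: unraw z.
Proof. by []. Qed.

(** Coassociativity is translated between the two presentations of the iterated tensor product. The
    equivalence needs transport both ways, hence the left inverse th' of th. *)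
Lemma comodule_raw M (f : kspace M -> kspace (cofree M)) :
  (forall m, Zmap f (f m) = delta (f m)) <->
  (forall m : M, \sw_(v & n <- raw (f m)) \sw_(v1 & v2 <- cr_Delta D v) bpure v1 (bpure v2 n) =
   \sw_(v & n <- raw (f m)) bpure v (raw (f n)) :> btens D (btens_lact D ( *:%R : A -> M -> M))).
Proof.
pose th := tmap (ra := ract D) (la := ( *:%R : A -> cofree M -> cofree M))
  (btens_lact D ( *:%R : A -> M -> M)) (@raw M).
pose th' := tmap (ra := ract D) (la := btens_lact D ( *:%R : A -> M -> M))
  ( *:%R : A -> cofree M -> cofree M) (@unraw M).
have thD : {morph th : x y / x + y} by apply: tmapD; [exact: rawDl|exact: rawA].
have thp d1 (z : cofree M) : th (bpure d1 z) = bpure d1 (raw z).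
  by apply: tmap_pure; [exact: rawDl|exact: rawA].
have thD' : {morph th' : x y / x + y} by apply: tmapD; [exact: unrawDl|exact: unrawA].
have thp' d1 (z : cofree M) : th' (bpure d1 (raw z)) = bpure d1 z.
  by apply: tmap_pure; [exact: unrawDl|exact: unrawA].
have thK (t : cofree (cofree M)) : th' (th t) = t.
  rewrite [in RHS](tprodE t) [in LHS](tprodE t).
  have th0 : th 0 = 0 by apply: (addIr (th 0)); rewrite -thD !add0r.
  have th0' : th' 0 = 0 by apply: (addIr (th' 0)); rewrite -thD' !add0r.
  rewrite (big_morph th thD th0) (big_morph th' thD' th0').
  by apply: eq_bigr => p _; rewrite thp thp'.
have e1 m : th (delta (f m)) =
  \sw_(v & n <- raw (f m)) \sw_(v1 & v2 <- cr_Delta D v) bpure v1 (bpure v2 n).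
  rewrite -sum_expand (tsum_morph _ _ thD).
  apply: eq_tsum => v n; rewrite /expand (tsum_morph _ _ thD).
  by apply: eq_tsum => v1 v2; rewrite thp.
have e2 m : th (Zmap f (f m)) = \sw_(v & n <- raw (f m)) bpure v (raw (f n)).
  rewrite /Zmap (tsum_morph _ _ thD).
  by apply: eq_tsum => v1 v2; rewrite thp.
split=> e m.
  by rewrite -e1 -e2 e.
by rewrite -[LHS]thK -[RHS]thK e1 e2 e.
Qed.

Section ToComodule.
Variable M : ydModule A C.
Let phi : kspace M -> kspace M \otimes C := @yd_coact k H A C M.

Lemma yd_lin : lin phi. Proof. exact: yd_coact_linear. Qed.
Lemma yd_compatE : compat phi. Proof. exact: yd_compat. Qed.

Definition yd_lift : kspace M -> kspace (cofree M) := lift phi.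

Lemma alin_yd_lift : alin yd_lift.
Proof.
split; first exact: (lin_lift yd_lin).
by move=> u m; apply: (lift_am yd_lin yd_compatE).
Qed.

Lemma pi_yd_lift m : pi (yd_lift m) = phi m.
Proof. exact: (pi_lift yd_lin yd_compatE). Qed.

Lemma pi_yd_liftE : (fun m => pi (yd_lift m)) = phi.
Proof. by apply: boolp.funext => m; apply: pi_yd_lift. Qed.

Lemma yd_star m : star phi phi m = cosplit phi m.
Proof. exact: yd_coassoc. Qed.

Lemma yd_lift_coassoc m : Zmap yd_lift (yd_lift m) = delta (yd_lift m).
Proof. by apply: (proj2 (comodule_yd alin_yd_lift)); rewrite pi_yd_liftE; apply: yd_star. Qed.

Lemma yd_lift_counit m : \sw_(v & n <- (yd_lift m : cofree M)) Dcounit v *: n = m.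
Proof. by rewrite -cofree_epsE /cofree_eps -epsr_pi pi_yd_lift; apply: yd_counit. Qed.

Lemma yd_liftZ (u : A) (m : M) :
  raw (yd_lift (u *: m)) = \sw_(v & n <- raw (yd_lift m)) bpure (lact D u v) n.
Proof. exact: (alin_yd_lift.2 u m). Qed.

Definition toComodule : comodule D :=
  @Comodule A _ D M (fun m => raw (yd_lift m)) (linD alin_yd_lift.1) yd_liftZ
    (proj1 (comodule_raw yd_lift) yd_lift_coassoc) yd_lift_counit.
End ToComodule.

Section FromComodule.
Variable N : comodule D.
Definition cm_unraw : kspace N -> kspace (cofree N) := fun m => unraw (cm_coact m).

Lemma alin_cm_unraw : alin cm_unraw.
Proof.
apply/alinP => u x y; rewrite /cm_unraw cm_coactD unrawDl; congr (_ + _).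
exact: cm_coactZ.
Qed.

Definition cm_pi (m : kspace N) : kspace N \otimes C := pi (cm_unraw m).

Lemma cm_pi_counit m : idTform (@epsC k H C) (cm_pi m) = m.
Proof.
rewrite -[LHS]/(epsr (cm_pi m)) /cm_pi epsr_pi -[epsr _]/(cofree_eps (cm_unraw m)) cofree_epsE.
exact: (@cm_counit A _ D N m).
Qed.

Lemma cm_pi_star m : star cm_pi cm_pi m = cosplit cm_pi m.
Proof.
apply: (proj1 (comodule_yd alin_cm_unraw)); apply: (proj2 (comodule_raw cm_unraw)).
exact: (@cm_coassoc A _ D N).
Qed.

Definition toYD : ydModule A C :=
  @YdModule k H A C N cm_pi (lin_pi_comp alin_cm_unraw) cm_pi_counit cm_pi_star
    (compat_pi_comp alin_cm_unraw).
End FromComodule.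

(** Both sides are A-linear in m, so by [pi_inj] it suffices to compare them after pi, where the
    claim is that g preserves the Yetter-Drinfeld coaction. *)
Lemma toComodule_hom (M N : ydModule A C) (g : ydHom M N) (m : M) :
  @cm_coact _ _ D (toComodule N) (g m) =
  \sw_(v & n <- @cm_coact _ _ D (toComodule M) m) bpure v (g n : toComodule N).
Proof.
have ag : alin (g : kspace M -> kspace N) by apply/alinP; exact: yd_fun_linear.
have [lN NA] := alin_yd_lift N; have [lM MA] := alin_yd_lift M.
have [lZ ZA] := alin_Zmap C ag.
suff e : (fun m => yd_lift (g m)) =1 (fun m => Zmap (g : kspace M -> kspace N) (yd_lift m)) by exact: e.
apply: pi_inj => [u x|u x|x].
- by rewrite ag.2 NA.
- by rewrite MA ZA.
- by rewrite pi_yd_lift (pi_Zmap ag) pi_yd_lift; apply: yd_fun_coact.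
Qed.

Definition toComoduleHom (M N : ydModule A C) (g : ydHom M N) : comoduleHom (toComodule M) (toComodule N) :=
  @ComoduleHom _ _ D (toComodule M) (toComodule N) g (yd_fun_linear g) (toComodule_hom g).

Lemma toYD_hom (M N : comodule D) (g : comoduleHom M N) (m : M) :
  cm_pi (g m) = \sw_(m0 & m1 <- cm_pi (m : kspace M)) ((g m0 : kspace N) \ot m1).
Proof.
have ag : alin (g : kspace M -> kspace N) by apply/alinP; exact: cm_fun_linear.
rewrite /cm_pi -(pi_Zmap ag); congr pi.
exact: (cm_fun_coact g m).
Qed.

Definition toYDHom (M N : comodule D) (g : comoduleHom M N) : ydHom (toYD M) (toYD N) :=
  @YdHom k H A C (toYD M) (toYD N) g (cm_fun_linear g) (toYD_hom g).

Definition comoduleF : functor (ydCategory A C) (comoduleCategory D).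
Proof.
exists (toComodule : ydCategory A C -> comoduleCategory D) toComoduleHom.
- by move=> M; apply: comoduleHom_eq.
- by move=> M N P g f; apply: comoduleHom_eq.
Defined.

Definition ydF : functor (comoduleCategory D) (ydCategory A C).
Proof.
exists (toYD : comoduleCategory D -> ydCategory A C) toYDHom.
- by move=> M; apply: ydHom_eq.
- by move=> M N P g f; apply: ydHom_eq.
Defined.

Lemma ydModule_eq (X : lmodType A) c l1 l2 l3 l4 c' l1' l2' l3' l4' :
  c = c' -> @YdModule k H A C X c l1 l2 l3 l4 = @YdModule k H A C X c' l1' l2' l3' l4'.
Proof.
by move=> e; subst c'; congr YdModule; apply: boolp.Prop_irrelevance.
Qed.

(** The two objects share the carrier X, so the value of the transported identity can be compared
    with m itself. *)
Lemma ydModule_eqhom (X : lmodType A) c l1 l2 l3 l4 c' l1' l2' l3' l4'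
  (e : @YdModule k H A C X c l1 l2 l3 l4 = @YdModule k H A C X c' l1' l2' l3' l4') m :
  c = c' -> yd_fun (eqhom (C := ydCategory A C) e) m = m.
Proof.
move=> ec; subst c'.
have e1 := boolp.Prop_irrelevance l1 l1'; have e2 := boolp.Prop_irrelevance l2 l2'.
have e3 := boolp.Prop_irrelevance l3 l3'; have e4 := boolp.Prop_irrelevance l4 l4'.
subst l1' l2' l3' l4'.
by rewrite (boolp.Prop_irrelevance e erefl).
Qed.

Lemma comodule_eq (X : lmodType A) c l1 l2 l3 l4 c' l1' l2' l3' l4' :
  c = c' -> @Comodule A _ D X c l1 l2 l3 l4 = @Comodule A _ D X c' l1' l2' l3' l4'.
Proof.
by move=> e; subst c'; congr Comodule; apply: boolp.Prop_irrelevance.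
Qed.

Lemma comodule_eqhom (X : lmodType A) c l1 l2 l3 l4 c' l1' l2' l3' l4'
  (e : @Comodule A _ D X c l1 l2 l3 l4 = @Comodule A _ D X c' l1' l2' l3' l4') m :
  c = c' -> cm_fun (eqhom (C := comoduleCategory D) e) m = m.
Proof.
move=> ec; subst c'.
have e1 := boolp.Prop_irrelevance l1 l1'; have e2 := boolp.Prop_irrelevance l2 l2'.
have e3 := boolp.Prop_irrelevance l3 l3'; have e4 := boolp.Prop_irrelevance l4 l4'.
subst l1' l2' l3' l4'.
by rewrite (boolp.Prop_irrelevance e erefl).
Qed.

Lemma toYD_toComodule_coact (M : ydModule A C) : cm_pi (N := toComodule M) = @yd_coact k H A C M.
Proof. exact: pi_yd_liftE. Qed.

Lemma toComodule_toYD_coact (N : comodule D) :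
  (fun m => raw (yd_lift (M := toYD N) m)) = @cm_coact _ _ D N.
Proof.
by apply: boolp.funext => m; apply: (lift_pi m (alin_cm_unraw N).2).
Qed.

(** The round trip keeps the underlying A-module definitionally; only the coaction has to be
    compared. *)
Lemma toYDK (M : ydModule A C) : toYD (toComodule M) = M.
Proof. by have := toYD_toComodule_coact M; case: M => X c l1 l2 l3 l4 e; apply: ydModule_eq. Qed.

Lemma toComoduleK (N : comodule D) : toComodule (toYD N) = N.
Proof. by have := toComodule_toYD_coact N; case: N => X c l1 l2 l3 l4 e; apply: comodule_eq. Qed.

Lemma toYDK_eqhom (M : ydModule A C) (e : toYD (toComodule M) = M) m :
  yd_fun (eqhom (C := ydCategory A C) e) m = m.
Proof.
have := toYD_toComodule_coact M; move: e m; case: M => X c l1 l2 l3 l4 e m ec.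
exact: ydModule_eqhom.
Qed.

Lemma toComoduleK_eqhom (N : comodule D) (e : toComodule (toYD N) = N) m :
  cm_fun (eqhom (C := comoduleCategory D) e) m = m.
Proof.
have := toComodule_toYD_coact N; move: e m; case: N => X c l1 l2 l3 l4 e m ec.
exact: comodule_eqhom.
Qed.

Lemma yd_comodule_iso : isomorphic_cat (ydCategory A C) (comoduleCategory D).
Proof.
exists comoduleF, ydF; split.
- apply: (functor_eq_id (F := fcomp ydF comoduleF) (e := toYDK)) => M N g; apply: ydHom_eq => m.
  by rewrite /= [LHS]toYDK_eqhom toYDK_eqhom.
- apply: (functor_eq_id (F := fcomp comoduleF ydF) (e := toComoduleK)) => M N g; apply: comoduleHom_eq => m.
  by rewrite /= [LHS]toComoduleK_eqhom toComoduleK_eqhom.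
Qed.
End Comodules.

(** * The explicit formulas for the coring *)

Lemma ydCoring_ract_lact (k : fieldType) (H : quasiHopf k)
    (A : bicomoduleAlgebra H) (C : bimoduleCoalgebra H) (u : A) (c : C) (u' u'' : A) :
  Dract (Dlact u (c \ot u')) u'' =
  \sw_(v & w <- lam A u) \sw_(w0 & w1 <- rho A w) (w1 |>> c <<| Sinv v) \ot (w0 * u' * u'').
Proof.
rewrite Dlact_ot (@tsum_ext _ _ _ _ _ _ _ (fun d => Dract d u'')); last exact: lin_Dractl.
apply: under2 => v w; rewrite (@tsum_ext _ _ _ _ _ _ _ (fun d => Dract d u'')); last exact: lin_Dractl.
by apply: under2 => w0 w1; rewrite Dract_ot.
Qed.

Lemma Dcomul_ot (k : fieldType) (H : quasiHopf k)
    (A : bicomoduleAlgebra H) (C : bimoduleCoalgebra H) (c : C) (u : A) :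
  rawD (Dcomul (c \ot u)) =
        \sw_(t1 & t2 & t3 <- Philr_inv A)
        \sw_(t20 & t21 <- rho A t2)
        \sw_(x1 & x2 & x3 <- Phir_inv A)
        \sw_(X1 & X2 & X3 <- Phil A)
        \sw_(X30 & X31 <- rho A X3)
        \sw_(X311 & X312 <- Delta X31)
        \sw_(g1 & g2 <- drinfeld_twist_inv H)
        \sw_(c1 & c2 <- DeltaC c)
          bpure (((t3 * x3 * X312) |>> c2 <<| Sinv (X1 * g1)) \ot (1 : A))
                (((t21 * x2 * X311) |>> c1 <<| Sinv (t1 * X2 * g2))
                   \ot (t20 * x1 * X30 * u)).
Proof.
pose F z : btens (Dbim A C) (lact (Dbim A C)) := rawD (Zmap (@regA_mul k H A C) z).
have FD : {morph F : x y / x + y} by move=> x y; rewrite /F (ZmapD (@alin_regA_mul k H A C)) rawDD.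
have e : coords (regA_gen (c \ot u)) = (u : kspace (regA A)) \ot c.
  by rewrite /regA_gen bpure_cogen coords_cogen; congr (_ \ot _); apply: (mulr1 u).
rewrite /Dcomul delta_formula e -/(F _).
(* Ten nested sums: two for each of the three associators, and one each for t2, X3, X31 and f^-1. *)
do 10 ![rewrite (tsum_morph _ _ FD); apply: eq_tsum => ? ?].
rewrite tsum_ot; last by lin_core.
rewrite (tsum_morph _ _ FD); apply: eq_tsum => c1 c2.
rewrite /F Zmap_cogen; last exact: alin_regA_mul.
by rewrite /cogen regA_mul_pure Dract_ot mul1r.
Qed.

Theorem corollary3p10 (k : fieldType) (H : quasiHopf k)
    (A : bicomoduleAlgebra H) (C : bimoduleCoalgebra H) :
  exists D : coring A (C \otimes A)%type,
  [/\ forall (u : A) (c : C) (u' u'' : A),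
        ract D (lact D u (c \ot u')) u'' =
        \sw_(v & w <- lam A u) \sw_(w0 & w1 <- rho A w)
          (w1 |>> c <<| Sinv v) \ot (w0 * u' * u''),
      forall (c : C) (u : A),
        cr_Delta D (c \ot u) =
        \sw_(t1 & t2 & t3 <- Philr_inv A)
        \sw_(t20 & t21 <- rho A t2)
        \sw_(x1 & x2 & x3 <- Phir_inv A)
        \sw_(X1 & X2 & X3 <- Phil A)
        \sw_(X30 & X31 <- rho A X3)
        \sw_(X311 & X312 <- Delta X31)
        \sw_(g1 & g2 <- drinfeld_twist_inv H)
        \sw_(c1 & c2 <- DeltaC c)
          bpure (((t3 * x3 * X312) |>> c2 <<| Sinv (X1 * g1)) \ot (1 : A))
                (((t21 * x2 * X311) |>> c1 <<| Sinv (t1 * X2 * g2))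
                   \ot (t20 * x1 * X30 * u)),
      forall (c : C) (u : A), cr_eps D (c \ot u) = epsC c *: u
    & isomorphic_cat (ydCategory A C) (comoduleCategory D)].
Proof.
exists (ydCoring A C); split.
- exact: ydCoring_ract_lact.
- move=> c u; exact: Dcomul_ot.
- move=> c u; exact: Dcounit_ot.
- exact: yd_comodule_iso.
Qed.
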